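(* Let $M$ be a smooth odd-dimensional manifold with a generalized almost para-contact structure $(\mathcal F,\mathcal Z,\xi)$ whose classical tensor fields are $(F,P,\sigma,\mathcal Z,\xi)$. Then the structure is normal if and only if the following conditions hold for all vector fields $X,Y,Z\in\Gamma(TM)$ and all $1$-forms $\alpha_1,\beta_1\in\Gamma(TM^* )$: (A1) $P$ satisfies $[P^\sharp\alpha_1,P^\sharp\beta_1]=P^\sharp([\alpha_1,\beta_1]_P)$. (A2) $P$ and $F$ satisfy $FP^\sharp=P^\sharp F^*$ and $$F^*([\alpha_1,\beta_1]_P)=L_{P^\sharp\alpha_1}F^*\beta_1-L_{P^\sharp\beta_1}F^*\alpha_1+d\big(P(\beta_1,F^*\alpha_1)\big).$$ (A3) $P$, $\sigma$ and $F$ satisfy $i_{\mathcal Z}\sigma=0$, $i_{\xi}P=0$, $F^2=\mathrm{Id}-P^\sharp\sigma_\sharp-\xi(\cdot)\mathcal Z$, and $$N_F(X,Y)=P^\sharp\big(i_{X\wedge Y}(d\sigma)\big)-(d\xi(X,Y))\,\mathcal Z.$$ (A4) $F(\mathcal Z)=0$, $\xi\circ F=0$, $(L_{FX}\xi)(Y)-(L_{FY}\xi)(X)=0$, and $$d\sigma_F(X,Y,Z)=d\sigma(FX,Y,Z)+d\sigma(X,FY,Z)+d\sigma(X,Y,FZ).$$ (A5) $L_{\mathcal Z}\xi=0$, $L_{\mathcal Z}P=0$, $L_{\mathcal Z}F=0$, $L_{\mathcal Z}\sigma=0$, and $L_{P^\sharp\alpha_1}\xi=0$.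
   Context: Write $\mathcal{TM}=TM\oplus TM^*$, with symmetric pairing $\langle X+\alpha,Y+\beta\rangle=\frac12(i_X\beta+i_Y\alpha)$ and Courant bracket $$\llbracket (X,\alpha),(Y,\beta)\rrbracket=[X,Y]+L_X\beta-L_Y\alpha-\tfrac12 d(i_X\beta-i_Y\alpha).$$ For a bivector field $\pi$ and a 2-form $\omega$ define $\pi^\sharp:TM^*\to TM$ and $\omega_\sharp:TM\to TM^*$ by $\beta(\pi^\sharp\alpha)=\pi(\alpha,\beta)$ and $\omega_\sharp(X)(Y)=\omega(X,Y)$. For 1-forms, $[\alpha,\beta]_\pi=L_{\pi^\sharp\alpha}\beta-L_{\pi^\sharp\beta}\alpha-d(\pi(\alpha,\beta))$. $F^*$ denotes the dual map of a bundle map $F:TM\to TM$. A generalized almost para-contact structure on a smooth odd-dimensional manifold $M$ consists of a bundle endomorphism $\mathcal F:\mathcal{TM}\to\mathcal{TM}$ and a section $\mathcal Z+\xi$ of $\mathcal{TM}$ ($\mathcal Z$ a vector field, $\xi$ a 1-form) such that $\mathcal F+\mathcal F^*=0$ (adjoint with respect to $\langle\,,\rangle$), $\xi(\mathcal Z)=1$, $\mathcal F(\xi)=0$, $\mathcal F(\mathcal Z)=0$, and $\mathcal F^2=\mathcal I-\mathcal Z\odot\xi$, where $(\mathcal Z\odot\xi)(X+\alpha)=\xi(X)\mathcal Z+\alpha(\mathcal Z)\xi$. It is written $$\mathcal F=\begin{pmatrix}F&P^\sharp\\ \sigma_\sharp&-F^*\end{pmatrix}$$ with $F:TM\to TM$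 a bundle map, $P$ a bivector field and $\sigma$ a 2-form on $M$. A generalized almost paracomplex structure on a manifold $N$ is a bundle automorphism $\mathcal J$ of $TN\oplus TN^*$ with $\mathcal J^2=I$, $\mathcal J\ne I$, $\langle\mathcal Je_1,e_2\rangle+\langle e_1,\mathcal Je_2\rangle=0$; it is written $\mathcal J=\begin{pmatrix}a&\pi^\sharp\\ \theta_\sharp&-a^*\end{pmatrix}$ with $a:TN\to TN$ a bundle map, $\pi$ a bivector field, $\theta$ a 2-form. It is integrable if $\llbracket\mathcal J u,\mathcal J v\rrbracket-\mathcal J(\llbracket\mathcal Ju,v\rrbracket+\llbracket u,\mathcal Jv\rrbracket)+\llbracket u,v\rrbracket=0$ for all sections $u,v$. On $M\times\mathbb R$ (coordinate $t$ on $\mathbb R$), $\mathcal J$ is called $M$-adapted if it is invariant by translation along $\mathbb R$, $\mathcal J(T\mathbb R\oplus 0)\subseteq 0\oplus TM^*$ and $\mathcal J(0\oplus T\mathbb R^* )\subseteq TM\oplus 0$. The $M$-adapted structure corresponding to $(F,P,\sigma,\mathcal Z,\xi)$ has classical tensor fields $a=F$, $\pi=P+\mathcal Z\wedge\frac{d}{dt}$, $\theta=\sigma+\xi\wedge dt$. The generalized almost para-contact structure is called normal if the corresponding $M$-adapted generalized almost paracomplex structure on $M\times\mathbb R$ is integrable. Further notation: $N_F(X,Y)=[FX,FY]+F^2[X,Y]-F[FX,Y]-F[X,FY]$; $i_{X\wedge Y}(d\sigma)$ is the 1-form $d\sigma(X,Y,\cdot)$; $\sigma_F(X,Y)=\sigma(FX,Y)$;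 $L$ is the Lie derivative.
   Formalization: Two signs are corrected: the structure on M×R has θ = σ − ξ∧dt (with the printed plus sign J² = I fails on d/dt), and in (A3) the last term is +dξ(X,Y)Z (the printed minus sign fails for the normal para-Sasakian structure on the Heisenberg group). *)

(* Defs.v *)
From HB Require Import structures.
From mathcomp Require Import all_boot all_order all_algebra.
From mathcomp Require Import all_classical all_reals all_analysis.
Set Implicit Arguments.
Unset Strict Implicit.
Unset Printing Implicit Defensive.
Import Order.TTheory GRing.Theory Num.Theory.
Import numFieldNormedType.Exports.
Local Open Scope classical_set_scope.
Local Open Scope ring_scope.

(* C^n and C^oo on an open subset U of a finite-dimensional space E, through
   iterated directional derivatives. *)
Fixpoint Cn_on {R : realType} {E W : normedModType R} (n : nat)
    (U : set E) (f : E -> W) : Prop :=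
  match n with
  | 0 => forall x, U x -> {for x, continuous f}
  | k.+1 => (forall x, U x -> differentiable f x) /\
            forall v, Cn_on k U ('D_v f)
  end.

Definition smooth_on {R : realType} {E W : normedModType R}
    (U : set E) (f : E -> W) : Prop := forall n, Cn_on n U f.

(* A smooth manifold modelled on the finite-dimensional space E.  The atlas is
   presented as a family of charts, chart x : chart_dom x -> E being a chart
   around x; every atlas contains such a family, which defines the same smooth
   structure.  unchart x is the inverse of chart x; chart x and unchart x are
   only meaningful on chart_dom x and on its image. *)
Record smooth_manifold (R : realType) (E : normedModType R) := SmoothManifold {
  carrier :> topologicalType;
  carrier_nonempty : [set: carrier] !=set0;
  carrier_hausdorff : hausdorff_space carrier;
  carrier_second_countable : @second_countable carrier;
  chart_dom : carrier -> set carrier;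
  chart : carrier -> carrier -> E;
  unchart : carrier -> E -> carrier;
  open_chart_dom : forall x, open (chart_dom x);
  mem_chart_dom : forall x, chart_dom x x;
  open_chart_cod : forall x, open (chart x @` chart_dom x);
  chartK : forall x y, chart_dom x y -> unchart x (chart x y) = y;
  chart_continuous : forall x y,
    chart_dom x y -> {for y, continuous (chart x)};
  unchart_continuous : forall x e,
    (chart x @` chart_dom x) e -> {for e, continuous (unchart x)};
  chart_compat : forall x y,
    smooth_on (chart x @` (chart_dom x `&` chart_dom y))
              (chart y \o unchart x)
}.

Lemma open_setX (S T : topologicalType) (A : set S) (B : set T) :
  open A -> open B -> open (A `*` B).
Proof.
rewrite !openE => oA oB [x y] [/= /oA Ax /oB By].
by exists (A, B).
Qed.

Lemma hausdorff_setX (S T : topologicalType) :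
  hausdorff_space S -> hausdorff_space T -> hausdorff_space (S * T)%type.
Proof.
move=> hS hT [x1 y1] [x2 y2] cl; congr (_, _).
- apply: hS => A B nA nB.
  have [||[u v] [/= [Au _] [Bu _]]] := cl (A `*` setT) (B `*` setT).
  + by exists (A, setT) => //; split=> //; exact: filterT.
  + by exists (B, setT) => //; split=> //; exact: filterT.
  + by exists u.
- apply: hT => A B nA nB.
  have [||[u v] [/= [_ Av] [_ Bv]]] := cl (setT `*` A) (setT `*` B).
  + by exists (setT, A) => //; split=> //; exact: filterT.
  + by exists (setT, B) => //; split=> //; exact: filterT.
  + by exists v.
Qed.

Lemma second_countable_setX (S T : topologicalType) :
  @second_countable S -> @second_countable T ->
  @second_countable (S * T)%type.
Proof.
move=> [A cA [oA bA]] [B cB [oB bB]].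
exists ((fun UV : set S * set T => UV.1 `*` UV.2) @` (A `*` B)).
  by apply: card_le_trans (card_image_le _ _) _; exact: countableX.
split=> [_ [[U V] [/= AU BV] <-]|[x y] D [[U V] [/= nU nV] UVD]].
  by apply: open_setX; [exact: oA|exact: oB].
have [U' [AU' U'x] U'U] := bA x _ nU.
have [V' [BV' V'y] V'V] := bB y _ nV.
exists (U' `*` V'); last by move=> [a b] [/= ? ?]; apply: UVD; split;
  [exact: U'U|exact: V'V].
by split=> //; exists (U', V').
Qed.

Lemma second_countable_real (R : realType) : @second_countable R.
Proof.
exists ((fun q : rat * rat => [set` `]ratr q.1 : R, ratr q.2[]) @` setT).
  by apply: card_le_trans (card_image_le _ _) _; exact: countableP.
split=> [_ [q _ <-]|x D /nbhs_ballP[e /= e0 xeD]]; first exact: interval_open.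
have /rat_in_itvoo[p /itvP xp] : x - e < x by rewrite ltrBlDr ltrDl.
have /rat_in_itvoo[q /itvP xq] : x < x + e by rewrite ltrDl.
exists [set` `]ratr p : R, ratr q[].
  by split; [exists (p, q)|rewrite /= in_itv /= xp xq].
move=> y /=; rewrite in_itv /= => /andP[py yq]; apply: xeD.
rewrite /ball /= ltr_distlC; apply/andP; split.
  by apply: lt_trans py; rewrite xp.
by apply: (lt_trans yq); rewrite xq.
Qed.

Section Near.
Context {R : realType} {V W : normedModType R}.

Lemma near_diff (f g : V -> W) (x : V) : (\near x, f x = g x) ->
  differentiable f x ->
  differentiable g x /\ ('d g x = 'd f x :> (V -> W)).
Proof.
move=> fg df.
have [cf fo] := (diff_locallyP x f).1 df.
have go : g \o shift x = cst (g x) + 'd f x +o_ 0 id.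
  apply/eqaddoP => _/posnumP[e].
  have /eqaddoP/(_ e%:num [gt0 of e%:num]) := fo.
  apply: filter_app.
  have : \forall h \near (0 : V), f (shift x h) = g (shift x h).
    by move: fg; rewrite (near_shift 0 x) subr0.
  apply: filterS => h /= fgh.
  rewrite -![(_ + _ : _ -> _) _]/(_ + _) -![(- _ : _ -> _) _]/(- _) /=.
  by rewrite /cst /= fgh (nbhs_singleton fg).
have E := diff_unique cf go.
split=> //; apply/diff_locallyP; rewrite E; split => //.
Qed.
End Near.

Section Smooth.
Context {R : realType}.

Lemma eq_Cn_on (E W : normedModType R) n (U : set E) (f g : E -> W) :
  open U -> {in U, f =1 g} -> Cn_on n U f -> Cn_on n U g.
Proof.
move=> oU; elim: n f g => [|n IHn] f g fg /=.
  move=> cf x Ux; rewrite /prop_for /continuous_at -(fg _ (mem_set Ux)).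
  apply: cvg_trans (cf x Ux); apply: near_eq_cvg.
  by apply: filterS (open_nbhs_nbhs (conj oU Ux)) => y /mem_set /fg.
move=> [df Df].
have near_fg x : U x -> \near x, f x = g x.
  move=> Ux.
  by apply: filterS (open_nbhs_nbhs (conj oU Ux)) => y /mem_set /fg.
split=> [x Ux|v]; first exact: (near_diff (near_fg x Ux) (df x Ux)).1.
apply: IHn (Df v) => x /set_mem Ux.
have [dg gf] := near_diff (near_fg x Ux) (df x Ux).
by rewrite !deriveE ?gf//; exact: df.
Qed.

Lemma is_diff_fst (V W : normedModType R) (x : V * W) : is_diff x fst fst.
Proof.
have cf : continuous (@fst V W) by move=> z; exact: cvg_fst.
by apply: DiffDef; [exact: linear_differentiable|exact: diff_lin].
Qed.

Lemma is_diff_snd (V W : normedModType R) (x : V * W) : is_diff x snd snd.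
Proof.
have cf : continuous (@snd V W) by move=> z; exact: cvg_snd.
by apply: DiffDef; [exact: linear_differentiable|exact: diff_lin].
Qed.

Lemma Cn_on_pair_affine (E W : normedModType R) n (U : set E) (f : E -> W)
    (a b : R) : open U -> Cn_on n U f ->
  Cn_on n (U `*` [set: R]) (fun e : E * R => (f e.1, a * e.2 + b)).
Proof.
move=> oU; elim: n f a b => [|n IHn] f a b /=.
  move=> cf [x t] [/= Ux _]; rewrite /prop_for /continuous_at /=.
  apply: (@cvg_pair _ _ _ _ (nbhs (f x)) (nbhs (a * t + b))).
    by apply: (@cvg_comp _ _ _ fst f _ _ _ cvg_fst); exact: cf.
  apply: cvgD; last exact: cvg_cst.
  by apply: cvgM; [exact: cvg_cst|exact: cvg_snd].
move=> [df Df].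
have isd (x : E * R) : U x.1 ->
    is_diff x (fun e : E * R => (f e.1, a * e.2 + b))
              (fun v : E * R => ('d f (x.1) v.1, a * v.2)).
  move=> Ux; apply: is_diff_pair.
    have ? := is_diff_fst x.
    have /differentiableP ? := df _ Ux.
    exact: (is_diff_comp (f := fst)).
  have ? := is_diff_snd x.
  have D : is_diff x (a *: (@snd E R) + cst b) (a *: (@snd E R) + 0).
    exact: is_diffD.
  by apply: is_diff_eq D _; rewrite addr0.
split=> [x [Ux _]|[v s]]; first by have [] := isd x Ux.
apply: (eq_Cn_on _ _ (IHn _ 0 (a * s) (Df v))) => [|x /set_mem [Ux _]].
  by apply: open_setX => //; exact: openT.
have [dx xE] := isd x Ux.
by rewrite [RHS]deriveE// xE/= -deriveE ?mul0r ?add0r//; exact: df.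
Qed.
End Smooth.

Section ProductWithLine.
Context {R : realType} {E : normedModType R} (M : smooth_manifold E).

Definition line_dom (x : M * R) : set (M * R) :=
  chart_dom x.1 `*` [set: R].
Definition line_chart (x y : M * R) : E * R := (chart x.1 y.1, y.2).
Definition line_unchart (x : M * R) (e : E * R) : M * R :=
  (unchart x.1 e.1, e.2).

Lemma line_image (x : M * R) (A : set M) :
  line_chart x @` (A `*` [set: R]) = (chart x.1 @` A) `*` [set: R].
Proof.
apply/seteqP; split=> [_ [y [Ay _] <-]|[e t] [[y Ay /= <-] _]].
  by split=> //=; exists y.1.
by exists (y, t).
Qed.

Lemma open_chart_overlap (x y : M) :
  open (chart x @` (chart_dom x `&` chart_dom y)).
Proof.
rewrite openE => _ [z [xz yz] <-].
have xze : (chart x @` chart_dom x) (chart x z) by exists z.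
have oC := open_nbhs_nbhs (conj (open_chart_cod x) xze).
have nD : nbhs (unchart x (chart x z)) (chart_dom y).
  by rewrite chartK//; exact: open_nbhs_nbhs (conj (open_chart_dom y) yz).
apply: filterS (filterI oC (unchart_continuous xze nD)) => e [[w xw <-]].
by rewrite /= chartK// => yw; exists w.
Qed.

Lemma line_nonempty : [set: M * R] !=set0.
Proof. by have [x _] := carrier_nonempty M; exists (x, 0). Qed.

Lemma line_hausdorff : hausdorff_space (M * R)%type.
Proof.
by apply: hausdorff_setX; [exact: carrier_hausdorff|exact: Rhausdorff].
Qed.

Lemma line_second_countable : @second_countable (M * R)%type.
Proof.
apply: second_countable_setX; first exact: carrier_second_countable.
exact: second_countable_real.
Qed.

Lemma line_open_dom x : open (line_dom x).
Proof. by apply: open_setX; [exact: open_chart_dom|exact: openT]. Qed.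

Lemma line_mem_dom x : line_dom x x.
Proof. by split=> //; exact: mem_chart_dom. Qed.

Lemma line_open_cod x : open (line_chart x @` line_dom x).
Proof.
rewrite line_image.
by apply: open_setX; [exact: open_chart_cod|exact: openT].
Qed.

Lemma line_chartK x y : line_dom x y -> line_unchart x (line_chart x y) = y.
Proof. by case: y => y t [/= xy _]; rewrite /line_unchart /= chartK. Qed.

Lemma line_chart_continuous x y :
  line_dom x y -> {for y, continuous (line_chart x)}.
Proof.
case: y => y t [/= xy _]; rewrite /prop_for /continuous_at /=.
apply: (@cvg_pair _ _ _ _ (nbhs (chart x.1 y)) (nbhs t) _ _ _
         (fun z => chart x.1 z.1) snd); last exact: cvg_snd.
apply: (@cvg_comp _ _ _ fst (chart x.1) _ _ _ cvg_fst).
exact: chart_continuous.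
Qed.

Lemma line_unchart_continuous x e :
  (line_chart x @` line_dom x) e -> {for e, continuous (line_unchart x)}.
Proof.
rewrite line_image; case: e => e t [/= xe _].
rewrite /prop_for /continuous_at /=.
apply: (@cvg_pair _ _ _ _ (nbhs (unchart x.1 e)) (nbhs t) _ _ _
         (fun z => unchart x.1 z.1) snd); last exact: cvg_snd.
apply: (@cvg_comp _ _ _ fst (unchart x.1) _ _ _ cvg_fst).
exact: unchart_continuous.
Qed.

Lemma line_chart_compat x y :
  smooth_on (line_chart x @` (line_dom x `&` line_dom y))
            (line_chart y \o line_unchart x).
Proof.
move=> n; have -> : line_dom x `&` line_dom y =
    (chart_dom x.1 `&` chart_dom y.1) `*` [set: R].
  by apply/seteqP; split=> -[z t] /= [[? ?]]; [case|move=> _].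
rewrite line_image.
apply: (eq_Cn_on _ _ (Cn_on_pair_affine 1 0 _ (chart_compat x.1 y.1 n))).
- by apply: open_setX; [exact: open_chart_overlap|exact: openT].
- by move=> e _ /=; rewrite mul1r addr0.
- exact: open_chart_overlap.
Qed.

Definition times_line : smooth_manifold (E * R)%type :=
  SmoothManifold line_nonempty line_hausdorff line_second_countable
    line_open_dom line_mem_dom line_open_cod line_chartK line_chart_continuous
    line_unchart_continuous line_chart_compat.

End ProductWithLine.

(* The tangent space of N at x is E, v : E standing for the tangent vector whose
   components in the chart x are v.  The cotangent space at x consists of the
   a : E -> R with scalar a, and the fibre of TN (+) TN^* at x of the pairs
   u : E * (E -> R) with scalar u.2. *)
Section Calculus.
Context {R : realType} {E : normedModType R} (N : smooth_manifold E).

Definition vfield := N -> E.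
Definition form1 := N -> E -> R.
Definition gsection := N -> E * (E -> R).
Definition gendo := N -> E * (E -> R) -> E * (E -> R).

Implicit Types (X Y Z : vfield) (a b : form1) (s : N -> E -> E -> R).

(* Derivative at x of a map along the tangent vector v at x. *)
Definition tderive (W : normedModType R) (f : N -> W) (x : N) (v : E) : W :=
  'D_v (f \o unchart x) (chart x x).

(* Components in the chart x of the tangent vector v at y. *)
Definition components (x y : N) (v : E) : E := tderive (chart x) y v.

Definition smooth_fun (W : normedModType R) (f : N -> W) : Prop :=
  forall x, smooth_on (chart x @` chart_dom x) (f \o unchart x).

Definition smooth_vfield X : Prop :=
  forall x, smooth_on (chart x @` chart_dom x)
    ((fun y => components x y (X y)) \o unchart x).

(* Forms and bundle endomorphisms are smooth when they send smooth arguments to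
   smooth values. *)
Definition smooth_form1 a : Prop :=
  (forall x, scalar (a x)) /\
  forall X, smooth_vfield X -> smooth_fun (fun x => a x (X x) : R).

Definition smooth_gsection (u : gsection) : Prop :=
  smooth_vfield (fun x => (u x).1) /\ smooth_form1 (fun x => (u x).2).

Definition bundle_endo (J : gendo) : Prop :=
  [/\ forall x (u : E * (E -> R)), scalar u.2 -> scalar (J x u).2,
      forall x (k : R) (u v : E * (E -> R)), scalar u.2 -> scalar v.2 ->
        J x (k *: u + v) = k *: J x u + J x v &
      forall u, smooth_gsection u -> smooth_gsection (fun x => J x (u x))].

Definition vact X (f : N -> R) : N -> R := fun x => tderive f x (X x).

(* In the chart x, [X, Y]^i = X(Y^i) - Y(X^i). *)
Definition lie_bracket X Y : vfield := fun x =>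
  tderive (fun y => components x y (Y y)) x (X x) -
  tderive (fun y => components x y (X y)) x (Y x).

Definition dfun (f : N -> R) : form1 := fun x v => tderive f x v.

(* The field with constant components v in the chart x, meaningful near x; it
   extends the tangent vector v at x. *)
Definition coord_field (x : N) (v : E) : vfield := fun y =>
  'D_v (chart y \o unchart x) (chart x y).

(* (L_X a)(Y) = X(a(Y)) - a([X, Y]) for any local extension Y of v. *)
Definition lieD_form1 X a : form1 := fun x v =>
  vact X (fun y => a y (coord_field x v y)) x -
  a x (lie_bracket X (coord_field x v) x).

Definition lieD_endo X (F : N -> E -> E) Y : vfield := fun x =>
  lie_bracket X (fun y => F y (Y y)) x - F x (lie_bracket X Y x).

Definition lieD_form2 X s Y Z : N -> R := fun x =>
  vact X (fun y => s y (Y y) (Z y)) x -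
  s x (lie_bracket X Y x) (Z x) - s x (Y x) (lie_bracket X Z x).

Definition lieD_bivector X (P : N -> (E -> R) -> (E -> R) -> R) a b : N -> R :=
  fun x => vact X (fun y => P y (a y) (b y)) x -
    P x (lieD_form1 X a x) (b x) - P x (a x) (lieD_form1 X b x).

Definition d_form1 a X Y : N -> R := fun x =>
  vact X (fun y => a y (Y y)) x - vact Y (fun y => a y (X y)) x -
  a x (lie_bracket X Y x).

Definition d_form2 s X Y Z : N -> R := fun x =>
  vact X (fun y => s y (Y y) (Z y)) x - vact Y (fun y => s y (X y) (Z y)) x +
  vact Z (fun y => s y (X y) (Y y)) x - s x (lie_bracket X Y x) (Z x) +
  s x (lie_bracket X Z x) (Y x) - s x (lie_bracket Y Z x) (X x).

Definition contract_d_form2 X Y s : form1 := fun x v =>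
  d_form2 s X Y (coord_field x v) x.

Definition nijenhuis (F : N -> E -> E) X Y : vfield := fun x =>
  let FX := fun y => F y (X y) in let FY := fun y => F y (Y y) in
  lie_bracket FX FY x + F x (F x (lie_bracket X Y x)) -
  F x (lie_bracket FX Y x) - F x (lie_bracket X FY x).

Definition gpairing (u v : E * (E -> R)) : R := 2^-1 * (v.2 u.1 + u.2 v.1).

Definition courant (u v : gsection) : gsection := fun x =>
  let X := fun y => (u y).1 in let a := fun y => (u y).2 in
  let Y := fun y => (v y).1 in let b := fun y => (v y).2 in
  (lie_bracket X Y x,
   fun w => lieD_form1 X b x w - lieD_form1 Y a x w -
     2^-1 * dfun (fun y => b y (X y) - a y (Y y)) x w).

Definition gskew (J : gendo) : Prop := forall x (u v : E * (E -> R)),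
  scalar u.2 -> scalar v.2 -> gpairing (J x u) v + gpairing u (J x v) = 0.

(* The blocks F, P^#, P and sigma_#, sigma of a skew-symmetric endomorphism. *)
Definition tens_end (J : gendo) (x : N) (v : E) : E := (J x (v, 0)).1.
Definition tens_sharp (J : gendo) (x : N) (a : E -> R) : E := (J x (0, a)).1.
Definition tens_bivector (J : gendo) (x : N) (a b : E -> R) : R :=
  b (tens_sharp J x a).
Definition tens_flat (J : gendo) (x : N) (v : E) : E -> R := (J x (v, 0)).2.
Definition tens_form2 (J : gendo) (x : N) (v w : E) : R := tens_flat J x v w.

(* [a, b]_P = L_{P^# a} b - L_{P^# b} a - d(P(a, b)) *)
Definition bracket_sharp (J : gendo) a b : form1 := fun x w =>
  lieD_form1 (fun y => tens_sharp J y (a y)) b x w -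
  lieD_form1 (fun y => tens_sharp J y (b y)) a x w -
  dfun (fun y => tens_bivector J y (a y) (b y)) x w.

Definition gen_almost_paracontact (J : gendo) Z a : Prop :=
  [/\ bundle_endo J, smooth_vfield Z /\ smooth_form1 a, gskew J,
      forall x, [/\ a x (Z x) = 1, J x (0, a x) = 0 & J x (Z x, 0) = 0] &
      forall x (u : E * (E -> R)), scalar u.2 ->
        J x (J x u) = u - (a x u.1 *: Z x, fun w => u.2 (Z x) * a x w)].

Definition gen_almost_paracomplex (J : gendo) : Prop :=
  [/\ bundle_endo J, gskew J,
      forall x (u : E * (E -> R)), scalar u.2 -> J x (J x u) = u &
      exists x (u : E * (E -> R)), scalar u.2 /\ J x u <> u].

Definition integrable_paracomplex (J : gendo) : Prop :=
  forall u v : gsection, smooth_gsection u -> smooth_gsection v ->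
  let Ju := fun x => J x (u x) in let Jv := fun x => J x (v x) in
  forall x, courant Ju Jv x - J x (courant Ju v x + courant u Jv x) +
            courant u v x = 0.

End Calculus.

Section Normal.
Context {R : realType} {E : normedModType R} (M : smooth_manifold E).

(* The charts of M * R being products with the identity of R, the differentials
   of the translations along R are the identity of E * R. *)
Definition M_adapted (J : gendo (times_line M)) : Prop :=
  [/\ forall (x : M) (t t' : R) (u : (E * R) * (E * R -> R)),
        scalar u.2 -> J (x, t) u = J (x, t') u,
      forall x (k : R),
        (J x ((0, k), 0)).1 = 0 /\ (J x ((0, k), 0)).2 (0, 1) = 0 &
      forall x (k : R), (J x (0, fun w : E * R => k * w.2)).1.2 = 0 /\
        (J x (0, fun w : E * R => k * w.2)).2 = 0].

(* a = F, pi = P + Z /\ d/dt and theta = sigma - xi /\ dt.  The relative sign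
   of the last two terms is imposed by J^2 = I: with theta = sigma + xi /\ dt,
   J^2 would map d/dt to - d/dt. *)
Definition corresponding_tensors (FF : gendo M) (Z : vfield M) (xi : form1 M)
    (J : gendo (times_line M)) : Prop :=
  [/\ forall (x : M * R) (v : E * R),
        tens_end (N := times_line M) J x v = (tens_end FF x.1 v.1, 0),
      forall (x : M * R) (a b : E * R -> R), scalar a -> scalar b ->
        tens_bivector (N := times_line M) J x a b =
        tens_bivector FF x.1 (fun v => a (v, 0)) (fun v => b (v, 0)) +
        (a (Z x.1, 0) * b (0, 1) - a (0, 1) * b (Z x.1, 0)) &
      forall (x : M * R) (v w : E * R),
        tens_form2 (N := times_line M) J x v w =
        tens_form2 FF x.1 v.1 w.1 -
        (xi x.1 v.1 * w.2 - v.2 * xi x.1 w.1)].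

Definition normal_paracontact (FF : gendo M) (Z : vfield M) (xi : form1 M) :
    Prop :=
  exists J : gendo (times_line M),
    [/\ gen_almost_paracomplex J, M_adapted J,
        corresponding_tensors FF Z xi J & integrable_paracomplex J].

End Normal.

(* Main.v *)
Require Import Defs.
From HB Require Import structures.
From mathcomp Require Import all_boot all_order all_algebra.
From mathcomp Require Import all_classical all_reals all_analysis.
From mathcomp Require Import ring lra.
Set Implicit Arguments.
Unset Strict Implicit.
Unset Printing Implicit Defensive.
Import Order.TTheory GRing.Theory Num.Theory.
Import numFieldNormedType.Exports.
Local Open Scope classical_set_scope.
Local Open Scope ring_scope.

(* Write <u,v> for the pairing and S_X for the derivative of a skew endomorphism J
   of the generalized tangent bundle along X, at a point and in a chart.  When
   J^2 = I, pairing the integrability expression of J at (e1, e2) with e3 gives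
     T(e1,e2,e3) = cyclic sum of <S_(J e1) e2, e3> + <S_(e1) e2, J e3>,
   which is tensorial, so that J is integrable iff T vanishes pointwise.
   The tensors F, P, sigma, Z, xi determine the M-adapted J on M x R, and T is then
   a polynomial in the d/dt- and dt-components of e1, e2, e3 whose coefficients
   are four tensors on M: a 3-tensor, two 2-tensors and a 1-tensor.
   Their values on vectors and covectors are the differential conditions A1-A5:
   A1, A2, A3, the last condition of A4 for the 3-tensor, the conditions on xi
   and on L_Z for the others.  Bump functions extend a vector or a covector at a
   point to a global smooth field, which links both directions; the algebraic
   conditions in A2-A4 restate F^2 = I - Z (.) xi. *)

(** * Calculus *)

(** Why [T] is tensorial: in the chart at a point, differentiation of components is a flat
    torsion-free connection D. Brackets and Lie derivatives are expressions in D, and D(Ju) = J(Du)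
    + (DJ)u. In the integrability expression every term with Du or Dv cancels by [J^2 = I] and
    skewness, so only DJ survives. The same cancellation, carried out tensor by tensor, identifies
    each differential condition of A1-A5 with one block of [T]. On M the square of [FF] is I - Z (.)
    xi instead of I. The terms in DZ and D xi that this defect produces are what distinguishes the
    3-tensor from the torsion of [FF] alone, and they leave the d xi term of A3. Normality only asks
    for some J with the prescribed tensors. Skewness makes that J unique on linear elements, so it
    can be replaced by the explicit [line_endo]. Two encodings shape the technical part. Forms and
    endomorphisms are smooth when they act well on global fields, while derivatives are taken along
    coordinate fields living in one chart domain, so cutoffs mediate everywhere. Covectors are bare
    functions, so linearity is carried along as a separate hypothesis. *)

Section SmoothCalculus.
Context {R : realType}.
Implicit Types E V W : normedModType R.

Lemma sub_Cn_on E W n (U V : set E) (f : E -> W) :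
  U `<=` V -> Cn_on n V f -> Cn_on n U f.
Proof.
move=> UV; elim: n f => [|n IHn] f /= => [cf x /UV|[df Df]]; first exact: cf.
by split=> [x /UV|v]; [exact: df|exact/IHn/Df].
Qed.

(** [V] can be any set through the point: [Cn_on] speaks of [f] itself at the points of [V], never
    of its restriction to [V]. *)
Lemma Cn_on_local E W n (U : set E) (f : E -> W) :
  (forall x, U x -> exists2 V : set E, V x & Cn_on n V f) -> Cn_on n U f.
Proof.
elim: n f => [|n IHn] f /= loc => [x Ux|].
  by have [V Vx] := loc x Ux; apply.
split=> [x Ux|v]; first by have [V Vx [df _]] := loc x Ux; exact: df.
by apply: IHn => x Ux; have [V Vx [_ Df]] := loc x Ux; exists V.
Qed.

Lemma Cn_onW E W n (U : set E) (f : E -> W) : Cn_on n.+1 U f -> Cn_on n U f.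
Proof.
elim: n f => [|n IHn] f [df Df].
  by move=> x Ux; apply: differentiable_continuous; exact: df.
by split=> // v; apply/IHn/Df.
Qed.

Lemma Cn_on_cst E W n (U : set E) (c : W) : Cn_on n U (fun _ : E => c).
Proof.
elim: n c => [|n IHn] c /=; first by move=> x _; exact: cvg_cst.
split=> [x _|v]; first exact: differentiable_cst.
suff -> : 'D_v (fun _ : E => c) = (fun _ => 0) by exact: IHn.
by apply/funext => x; exact: derive_cst.
Qed.

(** Openness of [U] serves the induction, here and in the lemmas that follow: the formula for the
    derivative is known on [U] only, and [eq_Cn_on] transports regularity between functions that
    agree on an open set. *)
Lemma Cn_onD E W n (U : set E) (f g : E -> W) : open U ->
  Cn_on n U f -> Cn_on n U g -> Cn_on n U (fun x => f x + g x).
Proof.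
move=> oU; elim: n f g => [|n IHn] f g /=.
  by move=> cf cg x Ux; exact: cvgD (cf x Ux) (cg x Ux).
move=> [df Df] [dg Dg]; split=> [x Ux|v].
  exact: differentiableD (df x Ux) (dg x Ux).
apply: (eq_Cn_on oU _ (IHn _ _ (Df v) (Dg v))) => x /set_mem Ux.
by rewrite -[RHS]/('D_v (f + g) x) deriveD //; apply: diff_derivable;
  [exact: df|exact: dg].
Qed.

Lemma Cn_onM E n (U : set E) (f g : E -> R) : open U ->
  Cn_on n U f -> Cn_on n U g -> Cn_on n U (fun x => f x * g x).
Proof.
move=> oU; elim: n f g => [|n IHn] f g.
  by move=> cf cg x Ux; exact: cvgM (cf x Ux) (cg x Ux).
move=> Cf Cg; have [df Df] := Cf; have [dg Dg] := Cg; split=> [x Ux|v].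
  exact: differentiableM (df x Ux) (dg x Ux).
have := Cn_onD oU (IHn _ _ (Cn_onW Cf) (Dg v)) (IHn _ _ (Cn_onW Cg) (Df v)).
apply: eq_Cn_on => // x /set_mem Ux.
rewrite -[RHS]/('D_v (f * g) x) deriveM //; apply: diff_derivable;
  [exact: df|exact: dg].
Qed.

Lemma Cn_on_linear E V W n (U : set E) (L : {linear V -> W}) (f : E -> V) :
  open U -> continuous L -> Cn_on n U f -> Cn_on n U (fun x => L (f x)).
Proof.
move=> oU cL; elim: n f => [|n IHn] f /=.
  by move=> cf x Ux; apply: continuous_comp; [exact: cf|exact: cL].
move=> [df Df]; split=> [x Ux|v].
  by apply: differentiable_comp; [exact: df|exact: linear_differentiable].
apply: (eq_Cn_on oU _ (IHn _ (Df v))) => x /set_mem Ux.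
have dL : differentiable L (f x) by exact: linear_differentiable.
have dfx := df x Ux.
rewrite [in RHS]deriveE; last exact: differentiable_comp.
by rewrite diff_comp // diff_lin //= deriveE.
Qed.

Lemma Cn_on_sum E W (I : Type) (r : seq I) n (U : set E) (f : I -> E -> W) :
  open U -> (forall i, Cn_on n U (f i)) ->
  Cn_on n U (fun x => \sum_(i <- r) f i x).
Proof.
move=> oU Cf; elim: r => [|i r IHr].
  apply: (eq_Cn_on oU _ (@Cn_on_cst E W n U 0)) => x _.
  by rewrite big_nil.
apply: (eq_Cn_on oU _ (Cn_onD oU (Cf i) IHr)) => x _.
by rewrite big_cons.
Qed.

Lemma Cn_onV E n (U : set E) (f : E -> R) : open U ->
  (forall x, U x -> f x != 0) -> Cn_on n U f -> Cn_on n U (fun x => (f x)^-1).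
Proof.
move=> oU f0; elim: n => [|n IHn] Cf.
  by move=> x Ux; apply: cvgV; [exact: f0|exact: Cf].
have [df Df] := Cf; split=> [x Ux|v].
  by apply: (differentiableV (f := f)); [exact: df|exact: f0].
have CV := IHn (Cn_onW Cf).
have := Cn_onM oU (Cn_on_cst n U (-1 : R)) (Cn_onM oU (Cn_onM oU CV CV) (Df v)).
apply: eq_Cn_on => // x /set_mem Ux.
rewrite (deriveV (f := f)) ?f0 //; last exact/diff_derivable/df.
by rewrite mulN1r -exprVn expr2 scaleNr.
Qed.

End SmoothCalculus.

(** Finite-dimensionality in the form used below. Keeping it abstract lets one development serve
    both M and M x R, whose frame is obtained by adding one vector. *)
Record frame (R : realType) (E : normedModType R) := Frame {
  fdim : nat;
  fvec : 'I_fdim -> E;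
  fcoord : 'I_fdim -> E -> R;
  fcoord_scalar : forall i, scalar (fcoord i);
  fcoord_continuous : forall i, continuous (fcoord i);
  fcoordE : forall v, v = \sum_i fcoord i v *: fvec i
}.
Arguments fvec {R E} f i.
Arguments fcoord {R E} f i v.
Arguments fcoord_scalar {R E} f i.
Arguments fcoord_continuous {R E} f i.
Arguments fcoordE {R E} f v.

Section Scalars.
Context {R : realType}.

Lemma scalarD (E : lmodType R) (a : E -> R) u v :
  scalar a -> a (u + v) = a u + a v.
Proof. by move=> sa; have := sa 1 u v; rewrite scale1r mul1r. Qed.

Lemma scalar0 (E : lmodType R) (a : E -> R) : scalar a -> a 0 = 0.
Proof. by move=> sa; apply: (@addrI _ (a 0)); rewrite -scalarD // !addr0. Qed.

Lemma scalar_scaler (E : lmodType R) (a : E -> R) k u :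
  scalar a -> a (k *: u) = k * a u.
Proof. by move=> sa; have := sa k u 0; rewrite !addr0 scalar0 // addr0. Qed.

Lemma scalarN (E : lmodType R) (a : E -> R) u : scalar a -> a (- u) = - a u.
Proof. by move=> sa; rewrite -scaleN1r scalar_scaler // mulN1r. Qed.

Lemma scalarB (E : lmodType R) (a : E -> R) u v :
  scalar a -> a (u - v) = a u - a v.
Proof. by move=> sa; rewrite scalarD // scalarN. Qed.

Lemma scalar_sum (E : lmodType R) (a : E -> R) (I : Type) (r : seq I)
    (f : I -> E) : scalar a -> a (\sum_(i <- r) f i) = \sum_(i <- r) a (f i).
Proof.
move=> sa; elim: r => [|i r IHr]; first by rewrite !big_nil scalar0.
by rewrite !big_cons scalarD // IHr.
Qed.

Lemma scalar_linear (E : lmodType R) (a : E -> R) : scalar a -> linear a.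
Proof. by []. Qed.

Definition scalar_lin (E : lmodType R) (a : E -> R) (sa : scalar a) :
  {linear E -> R} :=
  HB.pack_for {linear E -> R} a
    (GRing.isLinear.Build R E R *:%R a (scalar_linear sa)).

End Scalars.

Section SmoothFrame.
Context {R : realType}.
Implicit Types E V W : normedModType R.

Lemma scalar_frameE E (fr : frame E) (a : E -> R) : scalar a ->
  forall v, a v = \sum_i fcoord fr i v * a (fvec fr i).
Proof.
move=> sa v; rewrite {1}(fcoordE fr v) scalar_sum //.
by apply: eq_bigr => i _; rewrite scalar_scaler.
Qed.

Lemma Cn_on_scalar E V n (U : set E) (a : V -> R) (f : E -> V) : open U ->
  scalar a -> continuous a -> Cn_on n U f -> Cn_on n U (fun x => a (f x)).
Proof. by move=> oU sa ca Cf; exact: (Cn_on_linear (L := scalar_lin sa)). Qed.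

Lemma Cn_on_fcoord E V (fr : frame V) i n (U : set E) (f : E -> V) : open U ->
  Cn_on n U f -> Cn_on n U (fun x => fcoord fr i (f x)).
Proof.
by move=> oU; apply: Cn_on_scalar => //;
  [exact: fcoord_scalar|exact: fcoord_continuous].
Qed.
Arguments Cn_on_fcoord {E V} fr i {n U f}.

Lemma Cn_onZl E V n (U : set E) (f : E -> R) (b : V) : open U ->
  Cn_on n U f -> Cn_on n U (fun x => f x *: b).
Proof.
move=> oU; elim: n f => [|n IHn] f /=.
  by move=> cf x Ux; apply: cvgZl; exact: cf.
move=> [df Df]; split=> [x Ux|v].
  by apply: differentiableZl; exact: df.
apply: (eq_Cn_on oU _ (IHn _ (Df v))) => x /set_mem Ux.
rewrite [in RHS]deriveE; last exact/differentiableZl/df.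
by rewrite diffZl ?deriveE //; exact: df.
Qed.

Lemma Cn_on_coord E W (fr : frame W) n (U : set E) (f : E -> W) : open U ->
  (forall i, Cn_on n U (fun x => fcoord fr i (f x))) -> Cn_on n U f.
Proof.
move=> oU Cf.
have := Cn_on_sum (index_enum 'I_(fdim fr)) oU
  (fun i => Cn_onZl (fvec fr i) oU (Cf i)).
by apply: eq_Cn_on => // x _; rewrite [RHS](fcoordE fr).
Qed.

Lemma Cn_onZ E W (fr : frame W) n (U : set E) (f : E -> R) (g : E -> W) :
  open U -> Cn_on n U f -> Cn_on n U g -> Cn_on n U (fun x => f x *: g x).
Proof.
move=> oU Cf Cg; apply: (Cn_on_coord (fr := fr)) => // i.
have := Cn_onM oU Cf (Cn_on_fcoord fr i oU Cg).
apply: eq_Cn_on => // x _.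
by rewrite scalar_scaler //; exact: fcoord_scalar.
Qed.

Lemma derive_frameE E W (fr : frame E) (f : E -> W) x v : differentiable f x ->
  'D_v f x = \sum_i fcoord fr i v *: 'D_(fvec fr i) f x.
Proof.
move=> df; rewrite deriveE // {1}(fcoordE fr v) linear_sum.
by apply: eq_bigr => i _; rewrite linearZ deriveE.
Qed.

Lemma derive_comp E V W (f : V -> W) (g : E -> V) x v :
  differentiable g x -> differentiable f (g x) ->
  'D_v (fun y => f (g y)) x = 'D_('D_v g x) f (g x).
Proof.
move=> dg df; rewrite !deriveE //; last exact: differentiable_comp.
by rewrite diff_comp.
Qed.

(** By the chain rule the derivative of the composite is [f] differentiated in a direction that
    moves with the point. Expanding that direction in the frame leaves derivatives of [f] in fixed
    directions, to which the induction applies. *)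
Lemma Cn_on_comp E V W (fr : frame V) (frW : frame W) n
    (U : set E) (U' : set V) (f : V -> W) (g : E -> V) :
  open U -> (forall x, U x -> U' (g x)) ->
  Cn_on n U' f -> Cn_on n U g -> Cn_on n U (fun x => f (g x)).
Proof.
move=> oU UU'; elim: n f => [|n IHn] f.
  by move=> cf cg x Ux; apply: continuous_comp; [exact: cg|exact/cf/UU'].
move=> [df Df] Cg; have [dg Dg] := Cg; split=> [x Ux|v].
  by apply: differentiable_comp; [exact: dg|exact/df/UU'].
have Ci i := IHn _ (Df (fvec fr i)) (Cn_onW Cg).
have := Cn_on_sum (index_enum 'I_(fdim fr)) oU
  (fun i => Cn_onZ frW oU (Cn_on_fcoord fr i oU (Dg v)) (Ci i)).
apply: eq_Cn_on => // x /set_mem Ux.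
rewrite [RHS](derive_comp (f := f)); [|exact: dg|exact/df/UU'].
by rewrite [RHS](derive_frameE fr) //; exact/df/UU'.
Qed.

Lemma derive_fst E V W (f : E -> W) (x v : E * V) :
  'D_v (fun e : E * V => f e.1) x = 'D_(v.1) f x.1.
Proof. by []. Qed.

Lemma Cn_on_fst E V W n (U : set E) (f : E -> W) : open U ->
  Cn_on n U f -> Cn_on n (U `*` [set: V]) (fun e : E * V => f e.1).
Proof.
move=> oU; elim: n f => [|n IHn] f /=.
  move=> cf x [Ux _]; apply: (@cvg_comp _ _ _ fst f _ _ _ cvg_fst).
  exact: cf.
move=> [df Df]; split=> [x [Ux _]|v].
  have [dfst _] := is_diff_fst x.
  by apply: (differentiable_comp (f := fst) (g := f)) => //; exact: df.
have -> : 'D_v (fun e : E * V => f e.1) = (fun e => 'D_(v.1) f e.1).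
  by apply/funext => x; exact: derive_fst.
exact: (IHn ('D_(v.1) f) (Df v.1)).
Qed.

End SmoothFrame.
Arguments Cn_on_fcoord {R E V} fr i {n U f}.

(** * Bump functions and the extension of fields *)

Section Bump.
Context {R : realType}.

(** The classical exp(-1/s), multiplied by a power of 1/s so that linear combinations of the family
    are stable under differentiation. *)
Definition flat (k : nat) (s : R) : R :=
  if 0 < s then s^-1 ^+ k * expR (- s^-1) else 0.

Lemma flat_gt0 k s : 0 < s -> 0 < flat k s.
Proof. by move=> s0; rewrite /flat s0 mulr_gt0 ?exprn_gt0 ?invr_gt0 ?expR_gt0. Qed.

Lemma flat_le0 k s : s <= 0 -> flat k s = 0.
Proof. by move=> s0; rewrite /flat ltNge s0. Qed.

Lemma flat_ge0 k s : 0 <= flat k s.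
Proof. by case: (ltrP 0 s) => [/(flat_gt0 k)/ltW//|/(flat_le0 k) ->]. Qed.

(** From exp(y) >= y^(k+2) / (k+2)! at y = 1/s. A quadratic bound is what makes the derivative at 0
    vanish. *)
Lemma flat_le_sqr k s : flat k s <= k.+2`!%:R * s ^+ 2.
Proof.
have [s0|s0] := ltrP 0 s; last by rewrite flat_le0 // mulr_ge0 // sqr_ge0.
rewrite /flat s0 expRN; set y := s^-1.
have y0 : 0 < y by rewrite invr_gt0.
have -> : s = y^-1 by rewrite invrK.
have f0 : 0 < k.+2`!%:R :> R by rewrite ltr0n fact_gt0.
have yk : y ^+ k.+2 / k.+2`!%:R <= expR y.
  by apply: le_trans (expR_ge1Dxn k.+1 (ltW y0)); rewrite lerDr.
rewrite ler_pdivrMr ?expR_gt0 // -ler_pdivrMl ?mulr_gt0 ?exprn_gt0 ?invr_gt0 //.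
apply: le_trans yk; rewrite le_eqVlt; apply/orP; left; apply/eqP.
move: (k.+2`!%:R) f0 => c c0; rewrite !exprS; field.
by rewrite (gt_eqF c0) (gt_eqF y0).
Qed.

Lemma flat_is_derive k (s : R) :
  is_derive s (1 : R) (flat k) (flat k.+2 s - k%:R * flat k.+1 s).
Proof.
have [s0|s0|->] := ltrgt0P s.
- have : is_derive s (1 : R) (fun r => (GRing.inv ^+ k) r * expR (- r^-1))
      (flat k.+2 s - k%:R * flat k.+1 s).
    have sN0 : s != 0 by rewrite gt_eqF.
    have dV : is_derive s (1 : R) GRing.inv (- s ^- 2).
      apply: DeriveDef; first exact: (derivableV (f := id)).
      by rewrite (deriveV (f := id)) // derive_id; exact: mulr1.
    have dX : is_derive s (1 : R) (GRing.inv ^+ k) ((k%:R * s^-1 ^+ k.-1) *: - s ^- 2).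
      by case: (k) => [|m]; [rewrite mul0r scale0r expr0; exact: is_derive_cst|
        exact: is_deriveX].
    have dE : is_derive s (1 : R) (fun r => expR (- r^-1)) (expR (- s^-1) * s ^- 2).
      apply: is_derive_eq (is_derive1_comp (is_derive_expR _) (is_deriveN dV)) _.
      by rewrite opprK.
    apply: is_derive_eq (is_deriveM dX dE) _.
    rewrite /flat s0 fctE !scalerA /GRing.scale /=.
    by case: (k) => [|m] /=; rewrite !exprS; field.
  apply: near_eq_is_derive; near=> r.
  have r0 : 0 < r by near: r; exact: lt_nbhsr.
  by rewrite /flat r0 fctE.
- rewrite !(flat_le0 _ (ltW s0)) mulr0 subrr.
  have := is_derive_cst (0 : R) s 1; apply: near_eq_is_derive; near=> r.
  have r0 : r < 0 by near: r; exact: lt_nbhsl.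
  by rewrite (flat_le0 _ (ltW r0)).
- rewrite !(flat_le0 _ (lexx 0)) mulr0 subrr.
  (* The quadratic bound divided by |h| leaves a constant times |h|. *)
  have cvg0 : h^-1 *: ((flat k \o shift 0) (h *: 1) - flat k 0) @[h --> 0^']
      --> (0 : R).
    apply/cvgr0Pnorm_le => e e0; near=> h.
    have h0 : h != 0 by near: h; exact: nbhs_dnbhs_neq.
    have C0 : 0 < k.+2`!%:R :> R by rewrite ltr0n fact_gt0.
    rewrite /= (flat_le0 _ (lexx 0)) subr0 addr0 /GRing.scale /= mulr1.
    rewrite normrM normfV ger0_norm ?flat_ge0 // ler_pdivrMl ?normr_gt0 //.
    apply: le_trans (flat_le_sqr k h) _.
    rewrite -real_normK ?num_real // expr2 mulrA mulrC ler_pM2l ?normr_gt0 //.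
    rewrite -ler_pdivlMl //; near: h.
    apply: nbhs_dnbhs; apply: (@cvgr0_norm_le R R R (nbhs 0) _ id).
      exact: cvg_id.
    by rewrite mulr_gt0 ?invr_gt0.
  by apply: DeriveDef; [apply/cvg_ex; exists 0|exact: cvg_lim].
Unshelve. all: by end_near.
Qed.

Lemma Cn_on_id (E : normedModType R) n (U : set E) : Cn_on n U id.
Proof.
case: n => [|n]; first by move=> x _; exact: cvg_id.
split=> [x _|v]; first by have [] := is_diff_id x.
rewrite (_ : 'D_v id = fun=> v); first exact: Cn_on_cst.
by apply/funext => x; exact: derive_id.
Qed.

Lemma real_frame : frame R.
Proof.
apply: (@Frame R R 1 (fun=> 1) (fun=> id)) => [_ k u v|_ u|v] //.
by rewrite big_ord1; exact/esym/mulr1.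
Qed.

Lemma Cn_on_flat n k : Cn_on n [set: R] (flat k).
Proof.
elim: n k => [|n IHn] k.
  move=> s _; apply: differentiable_continuous; apply/derivable1_diffP.
  by case: (flat_is_derive k s).
have df (s : R) : differentiable (flat k) s.
  by apply/derivable1_diffP; case: (flat_is_derive k s).
split=> // v.
have := Cn_onM openT (Cn_on_cst n [set: R] v) (Cn_onD openT (IHn k.+2)
  (Cn_onM openT (Cn_on_cst n [set: R] (- k%:R : R)) (IHn k.+1))).
apply: eq_Cn_on => [|s _]; first exact: openT.
rewrite deriveE // -[in RHS](mulr1 v) -[v * 1]/(v *: (1 : R)) linearZ /=.
have [_ dE] := flat_is_derive k s.
by rewrite -deriveE // dE mulNr.
Qed.

(* Equal to 1 for |s| <= 1 and to 0 for s^2 >= 2. *)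
Definition bump1 (s : R) : R :=
  flat 0 (2 - s * s) / (flat 0 (2 - s * s) + flat 0 (s * s - 1)).

Lemma bump1_denom_gt0 s : 0 < flat 0 (2 - s * s) + flat 0 (s * s - 1).
Proof.
have [s1|s1] := ltrP 1 (s * s).
  by rewrite ltr_wpDl ?flat_ge0 // flat_gt0 // subr_gt0.
by rewrite ltr_pwDl ?flat_ge0 // flat_gt0 //; lra.
Qed.

Lemma bump1_eq1 s : s * s <= 1 -> bump1 s = 1.
Proof.
move=> s1; have := bump1_denom_gt0 s; rewrite /bump1.
rewrite (flat_le0 0 (_ : s * s - 1 <= 0)) ?subr_le0 // addr0 => s0.
by rewrite divff // gt_eqF.
Qed.

Lemma bump1_neq0 s : bump1 s != 0 -> `|s| <= 2.
Proof.
rewrite /bump1 => b0; have [//|s2] := lerP `|s| 2.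
move: b0; rewrite flat_le0 ?mul0r ?eqxx // subr_le0.
have : s * s = `|s| * `|s| by rewrite -!expr2 real_normK ?num_real.
by move=> ->; nra.
Qed.

Lemma Cn_on_bump1 n : Cn_on n [set: R] bump1.
Proof.
have oT := @openT R; have fr := real_frame; have Cid := Cn_on_id n [set: R].
have Cs := Cn_onM oT Cid Cid.
have C2 : Cn_on n [set: R] (fun s : R => 2 - s * s).
  have := Cn_onD oT (Cn_on_cst n [set: R] (2 : R))
    (Cn_onM oT (Cn_on_cst n [set: R] (-1 : R)) Cs).
  by apply: eq_Cn_on => // s _; rewrite mulN1r.
have C1 := Cn_onD oT Cs (Cn_on_cst n [set: R] (-1 : R)).
have Cf := Cn_on_comp fr fr oT (fun _ _ => I) (Cn_on_flat n 0) C2.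
have Cg := Cn_on_comp fr fr oT (fun _ _ => I) (Cn_on_flat n 0) C1.
apply: (Cn_onM oT Cf); apply: (Cn_onV oT) => [s _|].
  by rewrite gt_eqF // bump1_denom_gt0.
exact: Cn_onD.
Qed.

Lemma Cn_on_prod (E : normedModType R) (I : Type) (r : seq I) n (U : set E)
    (f : I -> E -> R) : open U -> (forall i, Cn_on n U (f i)) ->
  Cn_on n U (fun x => \prod_(i <- r) f i x).
Proof.
move=> oU Cf; elim: r => [|i r IHr].
  apply: (eq_Cn_on oU _ (@Cn_on_cst R E R n U 1)) => x _.
  by rewrite big_nil.
apply: (eq_Cn_on oU _ (Cn_onM oU (Cf i) IHr)) => x _.
by rewrite big_cons.
Qed.

(** Compactness is imported from row vectors, where closed boxes are compact: [K] is the image of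
    such a box under the continuous map v |-> e0 + sum of v_i e_i. *)
Lemma frame_box (E : normedModType R) (fr : frame E) (U : set E) e0 :
  open U -> U e0 -> exists2 r : R, 0 < r &
  exists2 K : set E, compact K /\ K `<=` U &
    forall e, (forall i, `|fcoord fr i (e - e0)| <= r) -> K e.
Proof.
move=> oU Ue0.
pose g (v : 'rV[R]_(fdim fr)) := e0 + \sum_i v ord0 i *: fvec fr i.
have cg : continuous g.
  have cs : continuous (fun v : 'rV[R]_(fdim fr) => \sum_i v ord0 i *: fvec fr i).
    have Cc i : Cn_on 0 [set: 'rV[R]_(fdim fr)]
        (fun v : 'rV[R]_(fdim fr) => v ord0 i).
      by move=> v _; exact: coord_continuous.
    move=> v; apply: (Cn_on_sum (n := 0) (index_enum 'I_(fdim fr)) openT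
      (fun i => Cn_onZl (fvec fr i) openT (Cc i))) => //.
  by move=> v; exact: cvgD (cvg_cst _) (cs v).
have g0 : g 0 = e0.
  by rewrite /g big1 ?addr0 // => i _; rewrite mxE scale0r.
have : \forall v \near (0 : 'rV[R]_(fdim fr)), U (g v).
  by apply: cg; rewrite g0; exact: open_nbhs_nbhs.
move=> /nbhs_ballP[r /= r0 rU].
(* Halving [r] puts the closed box inside the open ball of radius [r]. *)
exists (r / 2); first by rewrite divr_gt0.
exists (g @` [set v : 'rV[R]_(fdim fr) |
    forall i, `[- (r / 2), r / 2]%classic (v ord0 i)]).
  split.
    apply: continuous_compact; first exact: continuous_subspaceT.
    by apply: (@rV_compact R _ (fun=> `[- (r / 2), r / 2]%classic)) => i;
      exact: segment_compact.
  move=> _ [v vr <-]; apply: rU; split=> // i j; rewrite ord1 mxE.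
  have := vr j; rewrite /= in_itv /= => /andP[v1 v2].
  rewrite /ball /= sub0r normrN ltr_norml; apply/andP; split; lra.
move=> e er; exists (\row_i fcoord fr i (e - e0)).
  by move=> i /=; rewrite mxE in_itv /= -ler_norml.
rewrite /g; under eq_bigr do rewrite mxE.
by rewrite -fcoordE addrC subrK.
Qed.

Lemma bump_exists (E : normedModType R) (fr : frame E) (U : set E) e0 :
  open U -> U e0 -> exists chi : E -> R,
  [/\ forall n, Cn_on n [set: E] chi, \forall e \near e0, chi e = 1 &
    exists K : set E, [/\ compact K, K `<=` U & forall e, chi e != 0 -> K e]].
Proof.
move=> oU Ue0; have [r r0 [K [cK KU] rK]] := frame_box fr oU Ue0.
(* The factor 2 / r turns the bound 2 of [bump1_neq0] into the bound [r] of the box, so the product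
   of bumps is supported in [K]. *)
pose c i e := fcoord fr i (e - e0) * (2 / r).
have Cc i n : Cn_on n [set: E] (c i).
  apply: Cn_onM; [exact: openT| |exact: Cn_on_cst].
  apply: Cn_on_fcoord; first exact: openT.
  by apply: Cn_onD; [exact: openT|exact: Cn_on_id|exact: Cn_on_cst].
exists (fun e => \prod_i bump1 (c i e)); split.
- move=> n; apply: Cn_on_prod => [|i]; first exact: openT.
  by apply: (Cn_on_comp real_frame real_frame openT _ (Cn_on_bump1 n) (Cc i n)).
- suff : \forall e \near e0, forall i, `|c i e| < 1.
    apply: filterS => e ce; apply: big1 => i _; apply: bump1_eq1.
    have := ce i => ci.
    have -> : c i e * c i e = `|c i e| * `|c i e|.
      by rewrite -!expr2 real_normK ?num_real.
    by have := normr_ge0 (c i e); nra.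
  apply: filter_forall => i.
  have cc : {for e0, continuous (c i)} by exact: (Cc i 0).
  have c0 : c i e0 = 0.
    by rewrite /c subrr scalar0 ?mul0r //; exact: fcoord_scalar.
  have := cc; rewrite /prop_for /continuous_at c0 => /cvgr0_norm_lt; exact.
- exists K; split=> // e /prodf_neq0 ce; apply: rK => i.
  have := bump1_neq0 (ce i isT); rewrite /c normrM (ger0_norm (_ : 0 <= 2 / r)).
    by rewrite mulrA ler_pdivrMr // mulrC ler_pM2l.
  by rewrite divr_ge0 // ltW.
Qed.

End Bump.

Section SmoothOn.
Context {R : realType}.
Implicit Types E W : normedModType R.

Lemma smooth_on_near E W (U : set E) (f : E -> W) :
  (forall e, U e -> exists V : set E, exists g : E -> W,
    [/\ open V, V e, smooth_on V g & \forall e' \near e, g e' = f e']) ->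
  smooth_on U f.
Proof.
move=> loc n; apply: Cn_on_local => e Ue.
have [V [g [oV Ve Cg gf]]] := loc e Ue.
move: gf; rewrite -nbhs_nearE nbhsE; case=> O [oO Oe] Ogf.
exists (V `&` O) => //; apply: (@eq_Cn_on _ _ _ _ _ g).
- exact: openI.
- by move=> e' /set_mem[_ /Ogf].
- by apply: sub_Cn_on (Cg n) => ? [].
Qed.

Lemma sub_smooth_on E W (U V : set E) (f : E -> W) :
  U `<=` V -> smooth_on V f -> smooth_on U f.
Proof. by move=> UV Cf n; exact: sub_Cn_on (Cf n). Qed.

Lemma eq_smooth_on E W (U : set E) (f g : E -> W) :
  open U -> (forall e, U e -> f e = g e) -> smooth_on U f -> smooth_on U g.
Proof.
by move=> oU fg Cf n; apply: eq_Cn_on (Cf n) => // e /set_mem; exact: fg.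
Qed.

Lemma smooth_differentiable E W (U : set E) (f : E -> W) e :
  smooth_on U f -> U e -> differentiable f e.
Proof. by move=> /(_ 1)[+ _]; apply. Qed.

Lemma derive_inverse E W (f : E -> W) (g : W -> E) e w :
  differentiable f e -> differentiable g (f e) ->
  (\forall e' \near e, g (f e') = e') -> 'D_('D_w f e) g (f e) = w.
Proof.
move=> df dg gf; rewrite -derive_comp // (near_eq_derive w gf).
exact: derive_id.
Qed.

Lemma deriveP E W (f : E -> W) e k u v : differentiable f e ->
  'D_(k *: u + v) f e = k *: 'D_u f e + 'D_v f e.
Proof. by move=> df; rewrite !deriveE // linearP. Qed.

End SmoothOn.

(** * Chart transitions and the components of tangent vectors *)

Section Charts.
Context {R : realType} {E : normedModType R} (fr : frame E).
Variable N : smooth_manifold E.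
Implicit Types (x y z : N) (v w : E).

Definition chart_cod x : set E := chart x @` chart_dom x.

Lemma chart_codP x y : chart_dom x y -> chart_cod x (chart x y).
Proof. by exists y. Qed.

Lemma unchart_dom x e : chart_cod x e -> chart_dom x (unchart x e).
Proof. by move=> [y xy <-]; rewrite chartK. Qed.

Lemma unchartK x e : chart_cod x e -> chart x (unchart x e) = e.
Proof. by move=> [y xy <-]; rewrite chartK. Qed.

Lemma near_unchart x y (P : N -> Prop) : chart_dom x y ->
  (\forall y' \near y, P y') -> \forall e \near chart x y, P (unchart x e).
Proof.
move=> xy nP; apply: (unchart_continuous (chart_codP xy)).
by rewrite chartK.
Qed.

Lemma near_dom x y : chart_dom x y -> \forall y' \near y, chart_dom x y'.
Proof. by move=> xy; apply: open_nbhs_nbhs; split=> //; exact: open_chart_dom. Qed.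

Lemma near_cod x y : chart_dom x y ->
  \forall e \near chart x y, chart_cod x e.
Proof.
move=> xy; apply: open_nbhs_nbhs; split; first exact: open_chart_cod.
exact: chart_codP.
Qed.

Lemma open_cod_preimage x (O : set N) : open O ->
  open [set e | chart_cod x e /\ O (unchart x e)].
Proof.
move=> oO; rewrite openE => e [xe Oe].
apply: filterI; first by apply: open_nbhs_nbhs; split=> //; exact: open_chart_cod.
by apply: (unchart_continuous xe); exact: open_nbhs_nbhs.
Qed.

Lemma overlapE x y :
  chart x @` (chart_dom x `&` chart_dom y) =
  [set e | chart_cod x e /\ chart_dom y (unchart x e)].
Proof.
apply/seteqP; split=> [_ [z [xz yz] <-]|e [[z xz <-]]] /=.
  by rewrite chartK //; split=> //; exists z.
by rewrite chartK // => yz; exists z.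
Qed.

Lemma transition_smooth x y :
  smooth_on [set e | chart_cod x e /\ chart_dom y (unchart x e)]
    (chart y \o unchart x).
Proof. by rewrite -overlapE; exact: chart_compat. Qed.

Lemma transition_differentiable x y p : chart_dom x p -> chart_dom y p ->
  differentiable (chart y \o unchart x) (chart x p).
Proof.
move=> xp yp; apply: (smooth_differentiable (@transition_smooth x y)).
by split; [exact: chart_codP|rewrite chartK].
Qed.

Lemma components_linear x y k u v : chart_dom x y ->
  components x y (k *: u + v) = k *: components x y u + components x y v.
Proof.
move=> xy; apply: deriveP; apply: transition_differentiable => //.
exact: mem_chart_dom.
Qed.

Lemma components0 x y : components x y 0 = 0.
Proof. exact: derive0. Qed.

Lemma componentsZ x y k v : chart_dom x y ->
  components x y (k *: v) = k *: components x y v.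
Proof.
by move=> xy; have := components_linear k v 0 xy; rewrite components0 !addr0.
Qed.

Lemma coord_field_linear x y k u v : chart_dom x y ->
  coord_field x (k *: u + v) y = k *: coord_field x u y + coord_field x v y.
Proof.
move=> xy; apply: deriveP; apply: transition_differentiable => //.
exact: mem_chart_dom.
Qed.

(** The chart at [y], in which tangent vectors at [y] are written, drops out by the chain rule; only
    the transition from [x] to [z] remains, which is smooth in [y]. *)
Lemma components_coord_field x z y w : chart_dom x y -> chart_dom z y ->
  components z y (coord_field x w y) =
  'D_w (chart z \o unchart x) (chart x y).
Proof.
move=> xy zy; rewrite /components /tderive /coord_field.
have yy := mem_chart_dom y.
have -> : chart y y = (chart y \o unchart x) (chart x y) by rewrite /= chartK.
rewrite -derive_comp.
- apply: near_eq_derive; near=> e => /=; rewrite chartK //.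
  by near: e; apply: near_unchart => //; exact: near_dom.
- exact: transition_differentiable.
- by rewrite /= chartK //; exact: transition_differentiable.
Unshelve. all: by end_near. Qed.

Lemma coord_fieldK x y w : chart_dom x y ->
  components x y (coord_field x w y) = w.
Proof.
move=> xy; rewrite components_coord_field // -[RHS](derive_id (chart x y) w).
apply: near_eq_derive; near=> e => /=; rewrite unchartK //.
by near: e; exact: near_cod.
Unshelve. all: by end_near. Qed.

Lemma componentsK x y v : chart_dom x y ->
  coord_field x (components x y v) y = v.
Proof.
move=> xy; have yy := mem_chart_dom y.
rewrite /coord_field /components /tderive.
have -> : chart x y = (chart x \o unchart y) (chart y y) by rewrite /= chartK.
apply: derive_inverse.
- exact: transition_differentiable.
- by rewrite /= chartK //; exact: transition_differentiable.
- near=> e => /=; rewrite chartK ?unchartK //; near: e; first exact: near_cod.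
  by apply: near_unchart => //; exact: near_dom.
Unshelve. all: by end_near. Qed.

(** At its own base point a chart identifies tangent vectors with themselves. Hence derivatives at
    [p] are always taken in the chart at [p], and no change of frame appears in pointwise
    formulas. *)
Lemma components_self x v : components x x v = v.
Proof.
have xx := mem_chart_dom x.
by rewrite -[RHS](coord_fieldK v xx) components_coord_field.
Qed.

Lemma coord_field_self x v : coord_field x v x = v.
Proof. by rewrite -{1}(components_self x v) componentsK //; exact: mem_chart_dom. Qed.

Lemma smooth_change_chart (W : normedModType R) (frW : frame W) (f : N -> W)
    x z (O : set N) : open O -> O `<=` chart_dom x ->
  smooth_on (chart_cod x) (f \o unchart x) ->
  smooth_on [set e | chart_cod z e /\ O (unchart z e)] (f \o unchart z).
Proof.
move=> oO Ox Cf n; have oU := open_cod_preimage z oO.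
have Ct : Cn_on n [set e | chart_cod z e /\ O (unchart z e)]
    (chart x \o unchart z).
  by apply: sub_Cn_on (@transition_smooth z x n) => e [ze /Ox].
have Uc e : [set e | chart_cod z e /\ O (unchart z e)] e ->
    chart_cod x ((chart x \o unchart z) e).
  by move=> [_ /Ox]; exact: chart_codP.
have := Cn_on_comp fr frW oU Uc (Cf n) Ct; apply: eq_Cn_on => // e.
by move=> /set_mem[_ /Ox xe] /=; rewrite chartK.
Qed.

End Charts.

(** * Global fields obtained by cutting off coordinate fields *)

Section Cutoff.
Context {R : realType} {E : normedModType R} (fr : frame E).
Variable N : smooth_manifold E.
Implicit Types (x y z : N) (v w : E).

(** The closed set [K] keeps the support away from the boundary of the chart domain, where
    coordinate fields are meaningless: outside [K] a cut-off field is zero on an open set. *)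
Definition cutoff x (psi : N -> R) : Prop :=
  smooth_on (chart_cod x) (psi \o unchart x) /\
  exists K : set N, [/\ closed K, K `<=` chart_dom x &
    forall y, psi y != 0 -> K y].

Lemma cutoff_exists x y0 : chart_dom x y0 ->
  exists2 psi : N -> R, cutoff x psi & \forall y \near y0, psi y = 1.
Proof.
move=> xy; have [chi [Cchi chi1 [K [cK KU chiK]]]] :=
  bump_exists fr (open_chart_cod x) (chart_codP xy).
pose psi y := if `[< chart_dom x y >] then chi (chart x y) else 0.
have psiE y : chart_dom x y -> psi y = chi (chart x y).
  by move=> xy'; rewrite /psi asboolT.
exists psi; first split.
- apply: (eq_smooth_on (f := chi)).
  + exact: open_chart_cod.
  + by move=> e xe /=; rewrite psiE ?unchartK //; exact: unchart_dom.
  + by apply: (sub_smooth_on (V := setT)) => // n; exact: Cchi.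
- exists (unchart x @` K); split.
  (* The support is compact in the model space; its image is closed in the whole manifold because
     the manifold is Hausdorff. *)
  + apply: compact_closed; first exact: carrier_hausdorff.
    apply: continuous_compact => //; apply: continuous_in_subspaceT => e.
    by move=> /set_mem /KU; exact: unchart_continuous.
  + by move=> _ [e Ke <-]; apply: unchart_dom; exact: KU.
  + move=> y; rewrite /psi; case: asboolP => [xy' /chiK Ky|_]; last by rewrite eqxx.
    by exists (chart x y) => //; rewrite chartK.
- near=> y; rewrite psiE; last by near: y; exact: near_dom.
  near: y; exact: (chart_continuous xy chi1).
Unshelve. all: by end_near. Qed.

Lemma cutoff_dom x psi y : cutoff x psi -> psi y != 0 -> chart_dom x y.
Proof. by move=> [_ [K [_ Kx psiK]]] /psiK /Kx. Qed.

(** The chart domain of [x] and the complement of [K] cover the manifold: on the first the product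
    is smooth, on the second it is zero. *)
Lemma smooth_cutoff (W : normedModType R) (frW : frame W) x psi z
    (f : N -> W) : cutoff x psi ->
  smooth_on [set e | chart_cod z e /\ chart_dom x (unchart z e)]
    (f \o unchart z) ->
  smooth_on (chart_cod z) ((fun y => psi y *: f y) \o unchart z).
Proof.
move=> [Cpsi [K [cK Kx psiK]]] Cf; apply: smooth_on_near => e ze.
have [xe|nxe] := pselect (chart_dom x (unchart z e)).
  have oU := open_cod_preimage z (@open_chart_dom _ _ N x).
  exists [set e | chart_cod z e /\ chart_dom x (unchart z e)].
  exists ((fun y => psi y *: f y) \o unchart z); split=> //; last exact: nearW.
  move=> n; apply: (Cn_onZ frW oU) (Cf n).
  have C := smooth_change_chart (x := x) fr (@real_frame R) z
    (@open_chart_dom _ _ N x) (fun y xy => xy) Cpsi.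
  exact: (C n).
have oK : open (~` K) by exact: closed_openC.
exists [set e | chart_cod z e /\ (~` K) (unchart z e)], (fun=> 0); split.
- exact: open_cod_preimage.
- by split=> // /Kx.
- by move=> n; exact: Cn_on_cst.
- have: \forall e' \near e,
      [set e | chart_cod z e /\ (~` K) (unchart z e)] e'.
    apply: open_nbhs_nbhs; split; first exact: open_cod_preimage.
    by split=> // /Kx.
  apply: filterS => e' [ze' Ke'] /=.
  have [->|/psiK//] := eqVneq (psi (unchart z e')) 0.
  by rewrite scale0r.
Qed.

(* The section near [x] with the constant components [c] in the chart at [x]. *)
Definition tau x y (c : E * (E -> R)) : E * (E -> R) :=
  (coord_field x c.1 y, fun v => c.2 (components x y v)).

Lemma tau_scalar x y c : chart_dom x y -> scalar c.2 -> scalar (tau x y c).2.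
Proof. by move=> xy sc k u v /=; rewrite components_linear // sc. Qed.

Lemma smooth_coord_field_cutoff x psi w : cutoff x psi ->
  smooth_vfield (fun y => psi y *: coord_field x w y).
Proof.
move=> Cpsi z.
apply: (eq_smooth_on (f := (fun y => psi y *: 'D_w (chart z \o unchart x)
    (chart x y)) \o unchart z)).
- exact: open_chart_cod.
- move=> e ze /=; set y := unchart z e.
  have zy : chart_dom z y by exact: unchart_dom.
  rewrite componentsZ //; have [->|py] := eqVneq (psi y) 0.
    by rewrite !scale0r.
  have xy := cutoff_dom Cpsi py.
  by rewrite (components_coord_field w xy zy).
- apply: (smooth_cutoff fr Cpsi) => n.
  have oU := open_cod_preimage z (@open_chart_dom _ _ N x).
  have oV := open_cod_preimage x (@open_chart_dom _ _ N z).
  (* Order n+1, since the components of the coordinate field are first derivatives of the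
     transition. *)
  have [_ Dt] := @transition_smooth _ _ N x z n.+1.
  have Ct : Cn_on n [set e | chart_cod z e /\ chart_dom x (unchart z e)]
    (chart x \o unchart z) by exact: transition_smooth.
  apply: (Cn_on_comp fr fr oU _ (Dt w) Ct) => e [ze xe] /=.
  by split; [exact: chart_codP|rewrite chartK //; exact: unchart_dom].
Qed.

(** A linear form is a finite combination of the continuous frame coordinates. *)
Lemma scalar_continuous (a : E -> R) : scalar a -> continuous a.
Proof.
move=> sa; have -> : a = fun v => \sum_i fcoord fr i v *: a (fvec fr i).
  by apply/funext => v; exact: scalar_frameE.
have C0 := Cn_on_sum (n := 0) (index_enum 'I_(fdim fr)) (@openT E) (fun i =>
  Cn_onZl (a (fvec fr i)) (@openT E)
    (Cn_on_fcoord fr i openT (@Cn_on_id R E 0 setT))).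
by move=> v; exact: C0.
Qed.

Lemma smooth_coframe_cutoff x psi (a : E -> R) : cutoff x psi -> scalar a ->
  smooth_form1 (fun y v => psi y * a (components x y v)).
Proof.
move=> Cpsi sa; split=> [y k u v|X CX z].
  have [->|py] := eqVneq (psi y) 0; first by rewrite !mul0r mulr0 addr0.
  rewrite components_linear ?sa; last exact: cutoff_dom py.
  by rewrite mulrDr mulrCA.
apply: (smooth_cutoff (@real_frame R) Cpsi
  (f := fun y => a (components x y (X y)))).
apply: (smooth_change_chart (x := x) fr (@real_frame R) z) => [||n] //.
  exact: open_chart_dom.
apply: (Cn_on_scalar (open_chart_cod x) sa _ (CX x n)).
exact: scalar_continuous.
Qed.

(** The bridge between pointwise and global statements: the extension has constant components near
    the point, so both its value and its derivative there are known. *)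
Lemma section_extension x y0 c : chart_dom x y0 -> scalar c.2 ->
  exists2 u : gsection N, smooth_gsection u & \forall y \near y0, u y = tau x y c.
Proof.
move=> xy sc; have [psi Cpsi psi1] := cutoff_exists xy.
exists (fun y => (psi y *: coord_field x c.1 y,
                  fun v => psi y * c.2 (components x y v))).
  split; first exact: smooth_coord_field_cutoff.
  exact: (smooth_coframe_cutoff Cpsi sc).
apply: filterS psi1 => y ->; rewrite scale1r /tau; congr (_, _).
by apply/funext => v; rewrite mul1r.
Qed.

End Cutoff.

(** * Spanning families in the fibres of the generalized tangent bundle *)

Section GeneralizedVectors.
Context {R : realType} {E : normedModType R} (fr : frame E).
Implicit Types (u v : E * (E -> R)).

(** The second component ranges over all functions, so this predicate cuts out the actual fibre of
    TN + TN^*. *)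
Definition gscalar u := scalar u.2.

Lemma gscalarP k u v : gscalar u -> gscalar v -> gscalar (k *: u + v).
Proof.
move=> su sv l a b.
rewrite -[(k *: u + v).2]/(fun x => k * u.2 x + v.2 x).
by rewrite /= su sv; ring.
Qed.

Lemma gscalar0 : gscalar 0.
Proof. by move=> k a b; rewrite -[(0 : E * (E -> R)).2]/(fun=> 0 : R) mulr0 addr0. Qed.

Lemma gscalarD u v : gscalar u -> gscalar v -> gscalar (u + v).
Proof. by rewrite -[u in u + v]scale1r; exact: gscalarP. Qed.

Lemma gscalarZ k u : gscalar u -> gscalar (k *: u).
Proof. by move=> su; rewrite -[_ *: _]addr0; apply: gscalarP => //; exact: gscalar0. Qed.

Lemma gscalarN u : gscalar u -> gscalar (- u).
Proof. by rewrite -scaleN1r; exact: gscalarZ. Qed.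

Lemma gscalar_sum (I : Type) (r : seq I) (f : I -> E * (E -> R)) :
  (forall i, gscalar (f i)) -> gscalar (\sum_(i <- r) f i).
Proof.
by move=> sf; apply: big_ind => //; [exact: gscalar0|exact: gscalarD].
Qed.

Lemma gscalar_vec (X : E) : gscalar (X, 0).
Proof. by move=> k a b; rewrite -[(X, 0).2]/(fun=> 0 : R) mulr0 addr0. Qed.

Definition gidx := ('I_(fdim fr) + 'I_(fdim fr))%type.

Definition gbasis (j : gidx) : E * (E -> R) :=
  match j with inl i => (fvec fr i, 0) | inr i => (0, fcoord fr i) end.

Definition gcoef (j : gidx) u : R :=
  match j with inl i => fcoord fr i u.1 | inr i => u.2 (fvec fr i) end.

Lemma gbasis_scalar j : gscalar (gbasis j).
Proof. by case: j => i; [exact: gscalar_vec|exact: fcoord_scalar]. Qed.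

Lemma gvectorE u : gscalar u -> u = \sum_j gcoef j u *: gbasis j.
Proof.
case: u => X a sa; have {}sa : scalar a := sa; rewrite big_sumType /=.
have E1 : \sum_i fcoord fr i X *: (fvec fr i, 0 : E -> R) = (X, 0).
  rewrite {2}(fcoordE fr X).
  elim/big_ind2: _ => [//|x1 x2 y1 y2 -> ->|i _].
    by congr (_, _); rewrite /= addr0.
  by congr (_, _); rewrite /= scaler0.
have E2 : \sum_i a (fvec fr i) *: (0 : E, fcoord fr i) = (0, a).
  have -> : a = \sum_i a (fvec fr i) *: fcoord fr i.
    apply/funext => v; rewrite fct_sumE (scalar_frameE fr sa).
    by apply: eq_bigr => i _; rewrite mulrC.
  under eq_bigr => i _.
    rewrite fct_sumE.
    have -> : \sum_i0 (a (fvec fr i0) *: fcoord fr i0) (fvec fr i) =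
      a (fvec fr i).
      rewrite (scalar_frameE fr sa); apply: eq_bigr => k _.
      by rewrite mulrC.
    over.
  elim/big_ind2: _ => [//|x1 x2 y1 y2 -> ->|i _].
    by congr (_, _); rewrite /= addr0.
  by congr (_, _); rewrite /= scaler0.
by rewrite E1 E2; congr (_, _); rewrite /= ?addr0 ?add0r.
Qed.

End GeneralizedVectors.
Arguments gbasis {R E} fr j.
Arguments gcoef {R E} fr j u.

(** * Local coefficients of smooth sections and endomorphisms *)

Section Coefficients.
Context {R : realType} {E : normedModType R} (fr : frame E).
Variable N : smooth_manifold E.
Implicit Types (x y p : N) (u v c : E * (E -> R)).

Definition tauinv x y u : E * (E -> R) :=
  (components x y u.1, fun w => u.2 (coord_field x w y)).

Lemma tauK x y u : chart_dom x y -> tau x y (tauinv x y u) = u.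
Proof.
move=> xy; case: u => X a; rewrite /tau /tauinv /= componentsK //.
by congr (_, _); apply/funext => v; rewrite componentsK.
Qed.

Lemma tauinv_scalar x y u : chart_dom x y -> gscalar u ->
  gscalar (tauinv x y u).
Proof. by move=> xy su k a b /=; rewrite coord_field_linear // su. Qed.

Lemma tau_linear x y k c c' : chart_dom x y ->
  tau x y (k *: c + c') = k *: tau x y c + tau x y c'.
Proof.
by move=> xy; rewrite /tau [(_ + _).1]/= coord_field_linear.
Qed.

Lemma tau_self p c : tau p p c = c.
Proof.
case: c => X a; rewrite /tau /= coord_field_self; congr (_, _).
by apply/funext => v; rewrite components_self.
Qed.

Lemma tauinv_self p u : tauinv p p u = u.
Proof. by rewrite -[RHS](tauK u (mem_chart_dom p)) tau_self. Qed.

Definition smooth_coefs x (u : gsection N) : Prop :=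
  smooth_on (chart_cod x) ((fun y => components x y (u y).1) \o unchart x) /\
  forall w, smooth_on (chart_cod x)
    ((fun y => (u y).2 (coord_field x w y)) \o unchart x).

(** Smoothness of [a] can only be tested on global fields. Near each point the coordinate field is
    replaced by a cut-off copy that agrees with it where the cutoff equals 1. *)
Lemma smooth_form1_coef (a : form1 N) : smooth_form1 a -> forall x w,
  smooth_on (chart_cod x) ((fun y => a y (coord_field x w y)) \o unchart x).
Proof.
move=> [sa Ca] x w; apply: smooth_on_near => e xe.
have xy := unchart_dom xe.
have [psi Cpsi psi1] := cutoff_exists fr xy.
exists (chart_cod x),
  ((fun y => a y (psi y *: coord_field x w y)) \o unchart x).
split=> //; first exact: open_chart_cod.
  exact: (Ca _ (smooth_coord_field_cutoff fr w Cpsi)).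
rewrite -{1}(unchartK xe).
have : \forall y \near unchart x e, a y (psi y *: coord_field x w y) =
    a y (coord_field x w y) by apply: filterS psi1 => y ->; rewrite scale1r.
exact: near_unchart.
Qed.

Lemma form1_of_coef (a : form1 N) : (forall y, scalar (a y)) ->
  (forall x w, smooth_on (chart_cod x)
    ((fun y => a y (coord_field x w y)) \o unchart x)) -> smooth_form1 a.
Proof.
move=> sa Ca; split=> // X CX x n; have oU := open_chart_cod x.
have := Cn_on_sum (index_enum 'I_(fdim fr)) oU (fun i =>
  Cn_onM oU (Cn_on_fcoord fr i oU (CX x n)) (Ca x (fvec fr i) n)).
apply: eq_Cn_on => // e /set_mem xe /=; set y := unchart x e.
have xy : chart_dom x y by exact: unchart_dom.
have sc : scalar (fun w => a y (coord_field x w y)).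
  by move=> k v w; rewrite coord_field_linear // sa.
by rewrite -(scalar_frameE fr sc) componentsK.
Qed.

Lemma gsection_coefs (u : gsection N) : smooth_gsection u ->
  forall x, smooth_coefs x u.
Proof.
by move=> [Cu1 Cu2] x; split=> [|w];
  [exact: Cu1|exact: (smooth_form1_coef Cu2)].
Qed.

Lemma gsection_of_coefs (u : gsection N) : (forall y, gscalar (u y)) ->
  (forall x, smooth_coefs x u) -> smooth_gsection u.
Proof.
move=> su Cu; split=> [x|]; first by have [] := Cu x.
by apply: form1_of_coef => // x w; have [_] := Cu x; apply.
Qed.

Section Endo.
Variable J : gendo N.
Hypothesis bJ : bundle_endo J.

Lemma endo_gscalar y u : gscalar u -> gscalar (J y u).
Proof. by case: bJ => + _ _; apply. Qed.

Lemma endoP y k u v : gscalar u -> gscalar v ->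
  J y (k *: u + v) = k *: J y u + J y v.
Proof. by case: bJ => _ + _; apply. Qed.

Lemma endoD y u v : gscalar u -> gscalar v -> J y (u + v) = J y u + J y v.
Proof. by move=> su sv; have := endoP y 1 su sv; rewrite !scale1r. Qed.

Lemma endo0 y : J y 0 = 0.
Proof.
have := endoD y (@gscalar0 R E) (@gscalar0 R E).
by rewrite addr0 => /eqP; rewrite -[X in X == _]addr0 eq_sym (inj_eq (addrI _)) => /eqP.
Qed.

Lemma endoZ y k u : gscalar u -> J y (k *: u) = k *: J y u.
Proof.
by move=> su; have := endoP y k su (@gscalar0 R E); rewrite !addr0 endo0 addr0.
Qed.

Lemma endoN y u : gscalar u -> J y (- u) = - J y u.
Proof. by move=> su; rewrite -scaleN1r endoZ // scaleN1r. Qed.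

Lemma endo_sum y (I : Type) (r : seq I) (f : I -> E * (E -> R)) :
  (forall i, gscalar (f i)) ->
  J y (\sum_(i <- r) f i) = \sum_(i <- r) J y (f i).
Proof.
move=> sf; elim: r => [|i r IHr]; first by rewrite !big_nil endo0.
by rewrite !big_cons endoD ?IHr //; exact: gscalar_sum.
Qed.

(** Separates the coefficients of [u], which carry its dependence on the section, from the values of
    [J] on a fixed local family. Both differentiation and smoothness of [J u] rest on this. *)
Lemma endo_frameE x y u : chart_dom x y -> gscalar u ->
  J y u = \sum_j gcoef fr j (tauinv x y u) *: J y (tau x y (gbasis fr j)).
Proof.
move=> xy su; rewrite -{1}(tauK u xy).
have sj j : gscalar (tau x y (gbasis fr j)).
  by apply: tau_scalar => //; exact: gbasis_scalar.
rewrite (gvectorE fr (tauinv_scalar xy su)).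
have -> : tau x y (\sum_j gcoef fr j (tauinv x y u) *: gbasis fr j) =
    \sum_j gcoef fr j (tauinv x y u) *: tau x y (gbasis fr j).
  elim/big_rec2: _ => [|j c' c _ <-]; last by rewrite tau_linear.
  have := tau_linear (-1) 0 0 xy; rewrite scaleN1r addrC subrr => ->.
  by rewrite scaleN1r addrC subrr.
rewrite endo_sum => [|j]; last exact: gscalarZ.
by under eq_bigr do rewrite endoZ //; rewrite -gvectorE //; exact: tauinv_scalar.
Qed.

(** The section [tau x y c] is local while [bundle_endo] concerns global sections;
    [section_extension] supplies a global one equal to it near each point of the domain. *)
Lemma endo_coefs x c : gscalar c -> smooth_coefs x (fun y => J y (tau x y c)).
Proof.
move=> sc.
have key e : chart_cod x e -> exists2 u : gsection N, smooth_coefs x u &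
    \forall e' \near e, u (unchart x e') = J (unchart x e') (tau x (unchart x e') c).
  move=> xe; have xy := unchart_dom xe.
  have [u Cu uE] := section_extension fr xy sc.
  exists (fun y => J y (u y)).
    by apply: gsection_coefs; case: bJ => _ _; apply.
  rewrite -{1}(unchartK xe).
  have : \forall y \near unchart x e, J y (u y) = J y (tau x y c).
    by apply: filterS uE => y ->.
  exact: near_unchart.
split=> [|w]; apply: smooth_on_near => e xe; have [u [Cu1 Cu2] uE] := key e xe;
  exists (chart_cod x).
- exists ((fun y => components x y (u y).1) \o unchart x).
  split=> //; first exact: open_chart_cod.
  by apply: filterS uE => e' /= ->.
- exists ((fun y => (u y).2 (coord_field x w y)) \o unchart x).
  split=> //; first exact: open_chart_cod.
  by apply: filterS uE => e' /= ->.
Qed.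

End Endo.
End Coefficients.

(** * First-order jets *)

Section FrameDerivatives.
Context {R : realType} {E W : normedModType R} (fr : frame W).
Implicit Types (f : E -> R) (g : E -> W) (e w : E).

Lemma frame_eq (u v : W) : (forall i, fcoord fr i u = fcoord fr i v) -> u = v.
Proof.
by move=> uv; rewrite (fcoordE fr u) (fcoordE fr v); apply: eq_bigr => i _;
  rewrite uv.
Qed.

Lemma fcoord_linear_diff i (u : W) : differentiable (fcoord fr i) u.
Proof.
exact: (linear_differentiable (f := scalar_lin (fcoord_scalar fr i)) u
  (fcoord_continuous fr i)).
Qed.

Lemma derive_fcoord i g e w : differentiable g e ->
  'D_w (fun x => fcoord fr i (g x)) e = fcoord fr i ('D_w g e).
Proof.
move=> dg; rewrite derive_comp //; last exact: fcoord_linear_diff.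
have dL := fcoord_linear_diff i (g e); rewrite deriveE //.
have := diff_lin (f := scalar_lin (fcoord_scalar fr i)) (g e)
  (fcoord_continuous fr i).
by move=> /(congr1 (fun h => h ('D_w g e))).
Qed.

Lemma differentiable_fcoord i g e : differentiable g e ->
  differentiable (fun x => fcoord fr i (g x)) e.
Proof.
by move=> dg; apply: differentiable_comp => //; exact: fcoord_linear_diff.
Qed.

Lemma differentiable_coords g e :
  (forall i, differentiable (fun x => fcoord fr i (g x)) e) ->
  differentiable g e.
Proof.
move=> dg; have -> : g = \sum_i (fun x => fcoord fr i (g x) *: fvec fr i).
  by apply/funext => x; rewrite fct_sumE -fcoordE.
by apply: differentiable_sum => i; exact: differentiableZl.
Qed.

Lemma differentiable_scale f g e : differentiable f e -> differentiable g e ->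
  differentiable (fun x => f x *: g x) e.
Proof.
move=> df dg; apply: differentiable_coords => i.
have -> : (fun x => fcoord fr i (f x *: g x)) =
    f * (fun x => fcoord fr i (g x)).
  by apply/funext => x; rewrite scalar_scaler //; exact: fcoord_scalar.
by apply: differentiableM => //; exact: differentiable_fcoord.
Qed.

(** Reduced to real functions through the frame coordinates, which commute with derivatives. *)
Lemma derive_scale f g e w : differentiable f e -> differentiable g e ->
  'D_w (fun x => f x *: g x) e = 'D_w f e *: g e + f e *: 'D_w g e.
Proof.
move=> df dg; apply: frame_eq => i.
rewrite -derive_fcoord; last exact: differentiable_scale.
have -> : (fun x => fcoord fr i (f x *: g x)) =
    f * (fun x => fcoord fr i (g x)).
  by apply/funext => x; rewrite scalar_scaler //; exact: fcoord_scalar.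
rewrite deriveM; last 2 first.
- exact: diff_derivable.
- exact/diff_derivable/differentiable_fcoord.
have sc := fcoord_scalar fr i.
rewrite derive_fcoord // (scalarD _ _ sc) !(scalar_scaler _ _ sc) [LHS]addrC.
by rewrite -[LHS]/(fcoord fr i (g e) * 'D_w f e + f e * fcoord fr i ('D_w g e)) mulrC.
Qed.

End FrameDerivatives.

Section Jets.
Context {R : realType} {E : normedModType R} (fr : frame E).
Variable N : smooth_manifold E.
Implicit Types (x y p : N) (w : E) (X Y : vfield N) (a b : form1 N)
  (u : gsection N) (c : E * (E -> R)).

Definition tdiff (W : normedModType R) (f : N -> W) p :=
  differentiable (f \o unchart p) (chart p p).

(* Derivatives at [p], along [w], of the components in the chart at [p]. *)
Definition jetv p X w : E := tderive (fun y => components p y (X y)) p w.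
Definition jetf p a w : E -> R :=
  fun v => tderive (fun y => a y (coord_field p v y)) p w.
Definition jet p u w : E * (E -> R) :=
  (jetv p (fun y => (u y).1) w, jetf p (fun y => (u y).2) w).

Definition vdiff p X := tdiff (fun y => components p y (X y)) p.
(** Linearity is asked only near [p], as the constant-component sections [tau p y c] are linear only
    in the chart domain of [p]. *)
Definition fdiff p a := (\forall y \near p, scalar (a y)) /\
  forall v, tdiff (fun y => a y (coord_field p v y)) p.
Definition gdiff p u := vdiff p (fun y => (u y).1) /\ fdiff p (fun y => (u y).2).

Lemma near_chart p (P : N -> Prop) : (\forall y \near p, P y) ->
  \forall e \near chart p p, P (unchart p e).
Proof. by apply: near_unchart; exact: mem_chart_dom. Qed.

Lemma tdiff_eq (W : normedModType R) (f g : N -> W) p :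
  (\forall y \near p, f y = g y) -> tdiff f p -> tdiff g p.
Proof. by move=> /near_chart fg df; have [] := near_diff fg df. Qed.

Lemma tderive_eq (W : normedModType R) (f g : N -> W) p w :
  (\forall y \near p, f y = g y) -> tderive f p w = tderive g p w.
Proof. by move=> /near_chart; exact: near_eq_derive. Qed.

Lemma tderive_cst (W : normedModType R) (c : W) p w :
  tderive (fun=> c) p w = 0.
Proof. exact: derive_cst. Qed.

Lemma tdiff_cst (W : normedModType R) (c : W) p : tdiff (fun=> c) p.
Proof. exact: differentiable_cst. Qed.

Lemma tderiveP (W : normedModType R) (f : N -> W) p k w w' : tdiff f p ->
  tderive f p (k *: w + w') = k *: tderive f p w + tderive f p w'.
Proof. exact: deriveP. Qed.

Lemma tderiveD (W : normedModType R) (f g : N -> W) p w :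
  tdiff f p -> tdiff g p ->
  tderive (fun y => f y + g y) p w = tderive f p w + tderive g p w.
Proof.
by move=> df dg; apply: (deriveD (f := f \o unchart p) (g := g \o unchart p));
  exact: diff_derivable.
Qed.

Lemma tdiffD (W : normedModType R) (f g : N -> W) p :
  tdiff f p -> tdiff g p -> tdiff (fun y => f y + g y) p.
Proof. by move=> df dg; exact: (differentiableD df dg). Qed.

Lemma tderiveZ (W : normedModType R) (frW : frame W) (f : N -> R) (g : N -> W)
    p w : tdiff f p -> tdiff g p ->
  tderive (fun y => f y *: g y) p w = tderive f p w *: g p + f p *: tderive g p w.
Proof.
move=> df dg; have pp := mem_chart_dom p.
by have := derive_scale frW w df dg; rewrite /= chartK.
Qed.

Lemma tdiffZ (W : normedModType R) (frW : frame W) (f : N -> R) (g : N -> W) p :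
  tdiff f p -> tdiff g p -> tdiff (fun y => f y *: g y) p.
Proof.
by move=> df dg; exact: (differentiable_scale frW df dg).
Qed.

Lemma tderiveM (f g : N -> R) p w : tdiff f p -> tdiff g p ->
  tderive (fun y => f y * g y) p w = tderive f p w * g p + f p * tderive g p w.
Proof. exact: (tderiveZ real_frame). Qed.

Lemma tdiffM (f g : N -> R) p : tdiff f p -> tdiff g p ->
  tdiff (fun y => f y * g y) p.
Proof. exact: (tdiffZ real_frame). Qed.

Lemma tdiff_sum (W : normedModType R) (I : Type) (r : seq I)
    (f : I -> N -> W) p : (forall i, tdiff (f i) p) ->
  tdiff (fun y => \sum_(i <- r) f i y) p.
Proof.
move=> df; elim: r => [|i r IHr].
  by apply: tdiff_eq (tdiff_cst 0 p); apply: nearW => y; rewrite big_nil.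
by apply: tdiff_eq (tdiffD (df i) IHr); apply: nearW => y; rewrite big_cons.
Qed.

Lemma tderive_sum (W : normedModType R) (I : Type) (r : seq I)
    (f : I -> N -> W) p w : (forall i, tdiff (f i) p) ->
  tderive (fun y => \sum_(i <- r) f i y) p w = \sum_(i <- r) tderive (f i) p w.
Proof.
move=> df; elim: r => [|i r IHr].
  rewrite big_nil -[RHS](tderive_cst (0 : W) p w); apply: tderive_eq.
  by apply: nearW => y; rewrite big_nil.
rewrite big_cons -IHr -tderiveD //; last exact: tdiff_sum.
by apply: tderive_eq; apply: nearW => y; rewrite big_cons.
Qed.

Lemma near_dom_self p : \forall y \near p, chart_dom p y.
Proof. exact: near_dom (mem_chart_dom p). Qed.

Lemma jetf_scalar p a w : fdiff p a -> scalar (jetf p a w).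
Proof.
move=> [sa da] k u v; rewrite /jetf.
have dk := tdiff_cst (k : R) p.
have := tderiveM w dk (da u); rewrite tderive_cst mul0r add0r => <-.
rewrite -tderiveD //; last exact: tdiffM.
apply: tderive_eq; near=> y.
rewrite coord_field_linear; last by near: y; exact: near_dom_self.
suff sy : scalar (a y) by rewrite sy.
by near: y.
Unshelve. all: by end_near. Qed.

Lemma jet_scalar p u w : gdiff p u -> gscalar (jet p u w).
Proof. by move=> [_ du]; exact: jetf_scalar. Qed.

Lemma jetvP p X k w w' : vdiff p X ->
  jetv p X (k *: w + w') = k *: jetv p X w + jetv p X w'.
Proof. exact: tderiveP. Qed.

Lemma jetfP p a k w w' : fdiff p a ->
  jetf p a (k *: w + w') = k *: jetf p a w + jetf p a w'.
Proof. by move=> [_ da]; apply/funext => v; exact: tderiveP. Qed.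

Lemma jetP p u k w w' : gdiff p u ->
  jet p u (k *: w + w') = k *: jet p u w + jet p u w'.
Proof. by move=> [du1 du2]; rewrite /jet jetvP // jetfP. Qed.

Lemma jetv_eq p X Y w : (\forall y \near p, X y = Y y) ->
  jetv p X w = jetv p Y w.
Proof.
move=> XY; apply: (@tderive_eq E (fun y => components p y (X y))).
by apply: filterS XY => y ->.
Qed.

Lemma jetf_eq p a b w : (\forall y \near p, a y = b y) ->
  jetf p a w = jetf p b w.
Proof.
move=> ab; apply/funext => v.
apply: (@tderive_eq R (fun y => a y (coord_field p v y))).
by apply: filterS ab => y ->.
Qed.

Lemma jet_eq p u u' w : (\forall y \near p, u y = u' y) ->
  jet p u w = jet p u' w.
Proof.
move=> uu; rewrite /jet.
have uu1 : \forall y \near p, (u y).1 = (u' y).1 by apply: filterS uu => y ->.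
have uu2 : \forall y \near p, (u y).2 = (u' y).2 by apply: filterS uu => y ->.
by rewrite (jetv_eq w uu1) (jetf_eq w uu2).
Qed.

Lemma gdiff_eq p u u' : (\forall y \near p, u y = u' y) ->
  gdiff p u -> gdiff p u'.
Proof.
move=> uu [du [su du2]]; split; first by apply: tdiff_eq du; apply: filterS uu => y ->.
split; first by apply: filterS2 uu su => y ->.
by move=> v; apply: tdiff_eq (du2 v); apply: filterS uu => y ->.
Qed.

Lemma smooth_tdiff (W : normedModType R) (f : N -> W) p :
  smooth_on (chart_cod p) (f \o unchart p) -> tdiff f p.
Proof.
move=> Cf; apply: (smooth_differentiable Cf).
by apply: chart_codP; exact: mem_chart_dom.
Qed.

Lemma smooth_vdiff p X : smooth_vfield X -> vdiff p X.
Proof. by move=> CX; exact: (smooth_tdiff (CX p)). Qed.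

Lemma smooth_fdiff p a : smooth_form1 a -> fdiff p a.
Proof.
move=> Ca; split=> [|v]; first by apply: nearW; case: Ca.
by apply: smooth_tdiff; exact: smooth_form1_coef.
Qed.

Lemma smooth_gdiff p u : smooth_gsection u -> gdiff p u.
Proof. by move=> [Cu1 Cu2]; split; [exact: smooth_vdiff|exact: smooth_fdiff]. Qed.

Lemma tdiff_pair p a X : fdiff p a -> vdiff p X -> tdiff (fun y => a y (X y)) p.
Proof.
move=> [sa da] dX.
have d i : tdiff (fun y => fcoord fr i (components p y (X y)) *
    a y (coord_field p (fvec fr i) y)) p.
  by apply: tdiffM => //; exact: differentiable_fcoord dX.
apply: tdiff_eq (tdiff_sum (index_enum 'I_(fdim fr)) d).
near=> y; have yp : chart_dom p y by near: y; exact: near_dom_self.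
have say : scalar (a y) by near: y.
have sc : scalar (fun w => a y (coord_field p w y)).
  by move=> k v w; rewrite coord_field_linear // say.
by rewrite -(scalar_frameE fr sc) componentsK.
Unshelve. all: by end_near. Qed.

(** The Leibniz rule for evaluation, from the product rule applied to each term of the frame
    expansion of a(X). *)
Lemma tderive_pair p a X w : fdiff p a -> vdiff p X ->
  tderive (fun y => a y (X y)) p w = jetf p a w (X p) + a p (jetv p X w).
Proof.
move=> fa dX; have [sa da] := fa.
have dc i : tdiff (fun y => fcoord fr i (components p y (X y))) p.
  exact: differentiable_fcoord dX.
have d i : tdiff (fun y => fcoord fr i (components p y (X y)) *
    a y (coord_field p (fvec fr i) y)) p by exact: tdiffM.
transitivity (tderive (fun y => \sum_i fcoord fr i (components p y (X y)) *
    a y (coord_field p (fvec fr i) y)) p w).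
  apply: tderive_eq; near=> y.
  have yp : chart_dom p y by near: y; exact: near_dom_self.
  have say : scalar (a y) by near: y.
  have sc : scalar (fun w => a y (coord_field p w y)).
    by move=> k v w'; rewrite coord_field_linear // say.
  by rewrite -(scalar_frameE fr sc) componentsK.
rewrite tderive_sum // (eq_bigr _ (fun i _ => tderiveM w (dc i) (da _))).
rewrite big_split /= addrC; congr (_ + _).
  rewrite (scalar_frameE fr (jetf_scalar w fa)).
  by under eq_bigr do rewrite components_self.
have sp : scalar (a p) by exact: nbhs_singleton sa.
rewrite (scalar_frameE fr sp); apply: eq_bigr => i _.
rewrite coord_field_self; congr (_ * _).
exact: (derive_fcoord i w dX).
Unshelve. all: by end_near. Qed.

Lemma gdiffD p u u' : gdiff p u -> gdiff p u' -> gdiff p (fun y => u y + u' y).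
Proof.
move=> [du1 [su du2]] [dv1 [sv dv2]]; split.
  apply: tdiff_eq (tdiffD du1 dv1); near=> y.
  have yp : chart_dom p y by near: y; exact: near_dom_self.
  by have := components_linear 1 (u y).1 (u' y).1 yp; rewrite !scale1r.
split=> [|v]; last exact: (tdiffD (du2 v) (dv2 v)).
near=> y; have sy : gscalar (u y) by near: y.
have sy' : gscalar (u' y) by near: y.
exact: gscalarD.
Unshelve. all: by end_near. Qed.

Lemma jetD p u u' w : gdiff p u -> gdiff p u' ->
  jet p (fun y => u y + u' y) w = jet p u w + jet p u' w.
Proof.
move=> [du1 [su du2]] [dv1 [sv dv2]]; congr (_, _); last first.
  by apply/funext => v; exact: (tderiveD w (du2 v) (dv2 v)).
rewrite -[RHS](tderiveD w du1 dv1); apply: tderive_eq; near=> y.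
have yp : chart_dom p y by near: y; exact: near_dom_self.
by have := components_linear 1 (u y).1 (u' y).1 yp; rewrite !scale1r.
Unshelve. all: by end_near. Qed.

Lemma gdiffZ p (f : N -> R) u : tdiff f p -> gdiff p u ->
  gdiff p (fun y => f y *: u y).
Proof.
move=> df [du1 [su du2]]; split.
  apply: tdiff_eq (tdiffZ fr df du1); near=> y.
  by rewrite componentsZ //; near: y; exact: near_dom_self.
split=> [|v]; last exact: (tdiffM df (du2 v)).
near=> y; have sy : gscalar (u y) by near: y.
exact: gscalarZ.
Unshelve. all: by end_near. Qed.

Lemma jetZ p (f : N -> R) u w : tdiff f p -> gdiff p u ->
  jet p (fun y => f y *: u y) w = tderive f p w *: u p + f p *: jet p u w.
Proof.
move=> df [du1 [su du2]]; congr (_, _).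
  have := tderiveZ fr w df du1; rewrite components_self => H.
  rewrite -[RHS]H; apply: tderive_eq; near=> y.
  by rewrite componentsZ //; near: y; exact: near_dom_self.
apply/funext => v.
by have := tderiveM w df (du2 v); rewrite coord_field_self.
Unshelve. all: by end_near. Qed.

Lemma gdiff0 p : gdiff p (fun=> 0).
Proof.
split; first by apply: tdiff_eq (tdiff_cst 0 p); apply: nearW => y; rewrite components0.
by split=> [|v]; [apply: nearW => y; exact: gscalar0|exact: tdiff_cst].
Qed.

Lemma jet0 p w : jet p (fun=> 0) w = 0.
Proof.
congr (_, _); last by apply/funext => v; exact: tderive_cst.
rewrite -[RHS](tderive_cst (0 : E) p w); apply: tderive_eq.
by apply: nearW => y; rewrite components0.
Qed.

Lemma gdiff_sum p (I : Type) (r : seq I) (u : I -> gsection N) :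
  (forall i, gdiff p (u i)) -> gdiff p (fun y => \sum_(i <- r) u i y).
Proof.
move=> du; elim: r => [|i r IHr].
  by apply: gdiff_eq (gdiff0 p); apply: nearW => y; rewrite big_nil.
by apply: gdiff_eq (gdiffD (du i) IHr); apply: nearW => y; rewrite big_cons.
Qed.

Lemma jet_sum p (I : Type) (r : seq I) (u : I -> gsection N) w :
  (forall i, gdiff p (u i)) ->
  jet p (fun y => \sum_(i <- r) u i y) w = \sum_(i <- r) jet p (u i) w.
Proof.
move=> du; elim: r => [|i r IHr].
  rewrite big_nil -[RHS](jet0 p w); apply: jet_eq.
  by apply: nearW => y; rewrite big_nil.
rewrite big_cons -IHr -jetD //; last exact: gdiff_sum.
by apply: jet_eq; apply: nearW => y; rewrite big_cons.
Qed.

Lemma gdiff_tau p c : gscalar c -> gdiff p (fun y => tau p y c).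
Proof.
move=> sc; split.
  apply: tdiff_eq (tdiff_cst c.1 p); near=> y.
  by rewrite coord_fieldK //; near: y; exact: near_dom_self.
split=> [|v].
  by apply: filterS (near_dom_self p) => y yp; exact: tau_scalar.
apply: tdiff_eq (tdiff_cst (c.2 v) p); near=> y.
by rewrite /= coord_fieldK //; near: y; exact: near_dom_self.
Unshelve. all: by end_near. Qed.

(** These sections are the parallel ones for the flat connection of the chart; differentiating an
    algebraic identity evaluated on them isolates the derivative of the tensor. *)
Lemma jet_tau p c w : gscalar c -> jet p (fun y => tau p y c) w = 0.
Proof.
move=> sc; congr (_, _).
  rewrite -[RHS](tderive_cst (c.1 : E) p w); apply: tderive_eq; near=> y.
  by rewrite coord_fieldK //; near: y; exact: near_dom_self.
apply/funext => v; rewrite -[RHS](tderive_cst (c.2 v : R) p w).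
apply: tderive_eq; near=> y.
by rewrite /= coord_fieldK //; near: y; exact: near_dom_self.
Unshelve. all: by end_near. Qed.

End Jets.

(** * The symmetric pairing *)

Section Pairing.
Context {R : realType} {E : normedModType R}.
Implicit Types (u v c : E * (E -> R)).

(** Twice [gpairing]; dropping the factor 1/2 keeps the later identities polynomial with integer
    coefficients. *)
Definition bpair u v : R := v.2 u.1 + u.2 v.1.

Lemma bpairC u v : bpair u v = bpair v u.
Proof. exact: addrC. Qed.

Lemma bpairDl u v c : gscalar c -> bpair (u + v) c = bpair u c + bpair v c.
Proof.
move=> sc; rewrite /bpair -[(u + v).1]/(u.1 + v.1) (scalarD _ _ sc).
by rewrite -[(u + v).2 _]/(u.2 c.1 + v.2 c.1) addrACA.
Qed.

Lemma bpairZl k u c : gscalar c -> bpair (k *: u) c = k * bpair u c.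
Proof.
move=> sc; rewrite /bpair -[(k *: u).1]/(k *: u.1) (scalar_scaler _ _ sc).
by rewrite -[(k *: u).2 _]/(k * u.2 c.1) mulrDr.
Qed.

Lemma bpairNl u c : gscalar c -> bpair (- u) c = - bpair u c.
Proof. by move=> sc; rewrite -scaleN1r bpairZl // mulN1r. Qed.

Lemma bpairBl u v c : gscalar c -> bpair (u - v) c = bpair u c - bpair v c.
Proof. by move=> sc; rewrite bpairDl // bpairNl. Qed.

Lemma bpairDr u v c : gscalar c -> bpair c (u + v) = bpair c u + bpair c v.
Proof. by move=> sc; rewrite bpairC bpairDl // !(bpairC _ c). Qed.

Lemma bpairZr k u c : gscalar c -> bpair c (k *: u) = k * bpair c u.
Proof. by move=> sc; rewrite bpairC bpairZl // bpairC. Qed.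

Lemma bpairNr u c : gscalar c -> bpair c (- u) = - bpair c u.
Proof. by move=> sc; rewrite bpairC bpairNl // bpairC. Qed.

Lemma bpairBr u v c : gscalar c -> bpair c (u - v) = bpair c u - bpair c v.
Proof. by move=> sc; rewrite bpairDr // bpairNr. Qed.

Lemma bpair_eq0 (fr : frame E) u :
  (forall c, gscalar c -> bpair u c = 0) -> u = 0.
Proof.
move=> u0; have u2 w : u.2 w = 0.
  by have := u0 (w, 0) (gscalar_vec w); rewrite /bpair /= add0r.
case: u u0 u2 => X a /= u0 a0; congr (_, _); last exact/funext.
apply: (frame_eq (fr := fr)) => i.
have := u0 (0, fcoord fr i) (fcoord_scalar fr i).
by rewrite /bpair /= a0 addr0 => ->; rewrite (scalar0 (fcoord_scalar fr i)).
Qed.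

End Pairing.

(** * Derivative of a bundle endomorphism *)

Section EndoJets.
Context {R : realType} {E : normedModType R} (fr : frame E).
Variable N : smooth_manifold E.
Implicit Types (x y p : N) (w : E) (X Y : vfield N) (a b : form1 N)
  (u v : gsection N) (c : E * (E -> R)).

Lemma smooth_coefs_gdiff p u : (\forall y \near p, gscalar (u y)) ->
  smooth_coefs p u -> gdiff p u.
Proof.
move=> su [Cu1 Cu2]; split; first exact: (smooth_tdiff Cu1).
by split=> // v; exact: (smooth_tdiff (Cu2 v)).
Qed.

Lemma tdiff_gcoef p u j : gdiff p u ->
  tdiff (fun y => gcoef fr j (tauinv p y (u y))) p.
Proof.
move=> [du1 [_ du2]]; case: j => i; last exact: (du2 (fvec fr i)).
exact: (differentiable_fcoord (fr := fr) i du1).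
Qed.

Lemma tderive_gcoef p u j w : gdiff p u ->
  tderive (fun y => gcoef fr j (tauinv p y (u y))) p w = gcoef fr j (jet p u w).
Proof. by move=> [du1 _]; case: j => i //; exact: (derive_fcoord i w du1). Qed.

Lemma tderive_bpair p u v w : gdiff p u -> gdiff p v ->
  tderive (fun y => bpair (u y) (v y)) p w =
  bpair (jet p u w) (v p) + bpair (u p) (jet p v w).
Proof.
move=> [du1 du2] [dv1 dv2]; rewrite /bpair tderiveD; last 2 first.
- exact: (tdiff_pair fr dv2 du1).
- exact: (tdiff_pair fr du2 dv1).
rewrite (tderive_pair fr w dv2 du1) (tderive_pair fr w du2 dv1).
by rewrite [X in X + _]addrC addrACA.
Qed.

(** The derivative of [J] along [w] for the flat connection of the chart at [p]: as [tau p y c] is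
    parallel, all of the derivative falls on [J]. *)
Definition Sjet (J : gendo N) p w c := jet p (fun y => J y (tau p y c)) w.

Variable J : gendo N.
Hypothesis bJ : bundle_endo J.

Lemma gdiff_endo_tau p c : gscalar c -> gdiff p (fun y => J y (tau p y c)).
Proof.
move=> sc; apply: smooth_coefs_gdiff; last exact: endo_coefs.
apply: filterS (near_dom_self p) => y yp.
by apply: (endo_gscalar bJ); exact: tau_scalar.
Qed.

Lemma Sjet_scalar p w c : gscalar c -> gscalar (Sjet J p w c).
Proof. by move=> sc; apply: jet_scalar; exact: gdiff_endo_tau. Qed.

Lemma SjetPl p k w w' c : gscalar c ->
  Sjet J p (k *: w + w') c = k *: Sjet J p w c + Sjet J p w' c.
Proof. by move=> sc; apply: jetP; exact: gdiff_endo_tau. Qed.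

Lemma SjetPr p k w c c' : gscalar c -> gscalar c' ->
  Sjet J p w (k *: c + c') = k *: Sjet J p w c + Sjet J p w c'.
Proof.
move=> sc sc'; rewrite /Sjet.
have dc := gdiff_endo_tau p sc; have dc' := gdiff_endo_tau p sc'.
have := jetZ fr w (tdiff_cst (k : R) p) dc; rewrite tderive_cst scale0r add0r.
have dk := gdiffZ fr (tdiff_cst (k : R) p) dc.
move=> <-; rewrite -(jetD w dk dc'); apply: jet_eq.
apply: filterS (near_dom_self p) => y yp.
by rewrite tau_linear // (endoP bJ) //; exact: tau_scalar.
Qed.

Lemma Sjet0r p w : Sjet J p w 0 = 0.
Proof.
have := SjetPr p (-1) w (@gscalar0 R E) (@gscalar0 R E).
by rewrite !scaleN1r addrC subrr addrC subrr.
Qed.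

Lemma SjetDr p w c c' : gscalar c -> gscalar c' ->
  Sjet J p w (c + c') = Sjet J p w c + Sjet J p w c'.
Proof. by move=> sc sc'; have := SjetPr p 1 w sc sc'; rewrite !scale1r. Qed.

Lemma SjetZr p w k c : gscalar c -> Sjet J p w (k *: c) = k *: Sjet J p w c.
Proof.
by move=> sc; have := SjetPr p k w sc (@gscalar0 R E); rewrite Sjet0r !addr0.
Qed.

Lemma Sjet_sum p w (I : Type) (r : seq I) (f : I -> E * (E -> R)) :
  (forall i, gscalar (f i)) ->
  Sjet J p w (\sum_(i <- r) f i) = \sum_(i <- r) Sjet J p w (f i).
Proof.
move=> sf; elim: r => [|i r IHr]; first by rewrite !big_nil Sjet0r.
by rewrite !big_cons SjetDr ?IHr //; exact: gscalar_sum.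
Qed.

Lemma near_gscalar p u : gdiff p u -> \forall y \near p, gscalar (u y).
Proof. by case=> _ []. Qed.

Lemma endo_near_frame p u : gdiff p u -> \forall y \near p,
  \sum_j gcoef fr j (tauinv p y (u y)) *: J y (tau p y (gbasis fr j)) =
  J y (u y).
Proof.
move=> du; apply: filterS2 (near_dom_self p) (near_gscalar du) => y yp su.
by rewrite -endo_frameE.
Qed.

Lemma gdiff_endo_terms p u j : gdiff p u -> gdiff p (fun y =>
  gcoef fr j (tauinv p y (u y)) *: J y (tau p y (gbasis fr j))).
Proof.
move=> du; apply: gdiffZ => //; first exact: tdiff_gcoef.
by apply: gdiff_endo_tau; exact: gbasis_scalar.
Qed.

Lemma gdiff_endo p u : gdiff p u -> gdiff p (fun y => J y (u y)).
Proof.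
move=> du; apply: gdiff_eq (endo_near_frame du) _.
by apply: gdiff_sum => j; exact: gdiff_endo_terms.
Qed.

(** The Leibniz rule D(Ju) = J(Du) + (DJ)u, by differentiating the local frame expansion term by
    term. *)
Lemma jet_endo p u w : gdiff p u ->
  jet p (fun y => J y (u y)) w = J p (jet p u w) + Sjet J p w (u p).
Proof.
move=> du; rewrite -(jet_eq w (endo_near_frame du)).
rewrite jet_sum => [|j]; last exact: gdiff_endo_terms.
have db j := gdiff_endo_tau p (gbasis_scalar (fr := fr) j).
rewrite (eq_bigr _ (fun j _ => jetZ fr w (tdiff_gcoef j du) (db j))).
rewrite big_split /=; congr (_ + _).
  rewrite [in RHS](gvectorE fr (jet_scalar w du)) (endo_sum bJ) => [|j]; last first.
    by apply: gscalarZ; exact: gbasis_scalar.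
  apply: eq_bigr => j _; rewrite tderive_gcoef // tau_self (endoZ bJ) //.
  exact: gbasis_scalar.
have sp : gscalar (u p) by exact: nbhs_singleton (near_gscalar du).
rewrite [in RHS](gvectorE fr sp) Sjet_sum => [|j].
  by apply: eq_bigr => j _; rewrite tauinv_self SjetZr //; exact: gbasis_scalar.
by apply: gscalarZ; exact: gbasis_scalar.
Qed.

Lemma bpair_endo p c c' : gskew J -> gscalar c -> gscalar c' ->
  bpair (J p c) c' = - bpair c (J p c').
Proof.
move=> kJ sc sc'; have := kJ p c c' sc sc'.
rewrite /gpairing -!/(bpair _ _) -mulrDr => /eqP.
by rewrite mulf_eq0 invr_eq0 pnatr_eq0 /= addr_eq0 => /eqP.
Qed.

(** Differentiate the skewness identity of [J] on two parallel sections. *)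
Lemma Sjet_skew p w c c' : gskew J -> gscalar c -> gscalar c' ->
  bpair (Sjet J p w c) c' = - bpair c (Sjet J p w c').
Proof.
move=> kJ sc sc'; apply/eqP; rewrite -addr_eq0; apply/eqP.
have dc := gdiff_endo_tau p sc; have dc' := gdiff_endo_tau p sc'.
have tc := gdiff_tau p sc; have tc' := gdiff_tau p sc'.
have sJ : forall d, gscalar d -> gscalar (J p d) by exact: endo_gscalar.
have e1 := tderive_bpair w dc tc'.
have e2 := tderive_bpair w tc dc'.
have : tderive (fun y => bpair (J y (tau p y c)) (tau p y c') +
    bpair (tau p y c) (J y (tau p y c'))) p w = 0.
  rewrite -[RHS](tderive_cst (0 : R) p w); apply: tderive_eq.
  apply: filterS (near_dom_self p) => y yp.
  by rewrite bpair_endo ?addNr //; exact: tau_scalar.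
rewrite tderiveD; last 2 first.
- by apply: tdiffD; [exact: tdiff_pair tc'.2 dc.1|exact: tdiff_pair dc.2 tc'.1].
- by apply: tdiffD; [exact: tdiff_pair dc'.2 tc.1|exact: tdiff_pair tc.2 dc'.1].
rewrite e1 e2 !jet_tau // !tau_self /bpair /=.
rewrite (scalar0 (sJ c sc)) (scalar0 (sJ c' sc')) !addr0 !add0r => <-.
by congr (_ + _); rewrite ?addr0 ?add0r.
Qed.

End EndoJets.

(** * The torsion of a skew involution *)

Section Torsion.
Context {R : realType} {E : normedModType R} (fr : frame E).
Variable N : smooth_manifold E.
Implicit Types (x y p : N) (w : E) (X Y : vfield N) (a b : form1 N)
  (u v : gsection N) (c e : E * (E -> R)).

Lemma lie_bracketE X Y p :
  lie_bracket X Y p = jetv p Y (X p) - jetv p X (Y p).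
Proof. by []. Qed.

Lemma lie_bracket_coord X p w : lie_bracket X (coord_field p w) p = - jetv p X w.
Proof.
rewrite lie_bracketE coord_field_self -[RHS]add0r; congr (_ - _).
rewrite -[RHS](tderive_cst (w : E) p (X p)); apply: tderive_eq.
by apply: filterS (near_dom_self p) => y yp; rewrite coord_fieldK.
Qed.

(** The coordinate field extending [w] is parallel, so its bracket with [X] is minus the derivative
    of [X] along [w]. *)
Lemma lieD_form1E X a p w : fdiff p a ->
  lieD_form1 X a p w = jetf p a (X p) w + a p (jetv p X w).
Proof.
move=> [sa _]; rewrite /lieD_form1 lie_bracket_coord.
have sp : scalar (a p) by exact: nbhs_singleton sa.
by rewrite (scalarN _ sp) opprK.
Qed.

(** The Courant bracket in terms of the flat connection: the commutator D_u v - D_v u plus a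
    covector that antisymmetrizes the pairing of derivatives with values. The factor 1/2 on this
    covector absorbs the exact term of the definition. *)
Lemma courantE p u v : gdiff p u -> gdiff p v ->
  courant u v p = jet p v (u p).1 - jet p u (v p).1 +
    (0, fun w => 2^-1 * (bpair (jet p u w) (v p) - bpair (u p) (jet p v w))).
Proof.
move=> du dv; have [du1 du2] := du; have [dv1 dv2] := dv.
rewrite /courant; congr (_, _); first by rewrite /= addr0.
apply/funext => w; rewrite !lieD_form1E //.
have d1 := tdiff_pair fr dv2 du1; have d2 := tdiff_pair fr du2 dv1.
have -> : dfun (fun y => (v y).2 (u y).1 - (u y).2 (v y).1) p w =
    tderive (fun y => (v y).2 (u y).1) p w - tderive (fun y => (u y).2 (v y).1) p w.
  rewrite -mulN1r -[X in _ = _ + X]add0r.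
  rewrite -{1}(mul0r ((u p).2 (v p).1)) -(tderive_cst (-1 : R) p w).
  have dm := tdiff_cst (-1 : R) p.
  rewrite -tderiveM // -tderiveD //; last exact: tdiffM.
  by apply: tderive_eq; apply: nearW => y; rewrite mulN1r.
rewrite (tderive_pair fr w dv2 du1) (tderive_pair fr w du2 dv1).
rewrite -[RHS]/((jetf p (fun y => (v y).2) (u p).1 w -
  jetf p (fun y => (u y).2) (v p).1 w) +
  2^-1 * (bpair (jet p u w) (v p) - bpair (u p) (jet p v w))).
rewrite /bpair [(jet p u w).1]/= [(jet p u w).2]/= [(jet p v w).1]/= [(jet p v w).2]/=.
move: (jetf p _ (u p).1 w) (jetf p _ (v p).1 w) ((v p).2 _)
  (jetf p _ w _) ((u p).2 _) (jetf p _ w _).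
by move=> t1 t2 t3 t4 t5 t6; lra.
Qed.

Variable J : gendo N.
Hypothesis bJ : bundle_endo J.

Definition torsion1 p c1 c2 c3 : R :=
  bpair (Sjet J p (J p c1).1 c2) c3 + bpair (Sjet J p c1.1 c2) (J p c3).

Definition torsion p c1 c2 c3 : R :=
  torsion1 p c1 c2 c3 + torsion1 p c2 c3 c1 + torsion1 p c3 c1 c2.

Lemma bpair_courant p u v c : gdiff p u -> gdiff p v -> gscalar c ->
  bpair (courant u v p) c = bpair (jet p v (u p).1) c - bpair (jet p u (v p).1) c
    + 2^-1 * (bpair (jet p u c.1) (v p) - bpair (u p) (jet p v c.1)).
Proof.
move=> du dv sc; rewrite courantE // bpairDl // bpairBl //; congr (_ + _).
by rewrite /bpair /= (scalar0 sc) add0r.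
Qed.

Hypothesis kJ : gskew J.
Hypothesis J2 : forall x c, gscalar c -> J x (J x c) = c.

(** Differentiate [J^2 = I]: the derivative of an involution anticommutes with it. *)
Lemma Sjet_anti p w c : gscalar c -> Sjet J p w (J p c) = - J p (Sjet J p w c).
Proof.
move=> sc; have dc := gdiff_endo_tau fr bJ p sc.
have := jet_endo fr bJ w dc; rewrite tau_self.
suff -> : jet p (fun y => J y (J y (tau p y c))) w = 0.
  by move=> /esym/eqP; rewrite addr_eq0 => /eqP ->; rewrite opprK.
rewrite -(jet_tau p w sc); apply: jet_eq.
apply: filterS (near_dom_self p) => y yp.
by rewrite J2 //; exact: tau_scalar.
Qed.

(** Skewness moves the outer [J] onto [c], and the Leibniz rule expands every bracket. The terms in
    the jets of [u] and [v] cancel in pairs through [J^2 = I]; the terms differentiating [J]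
    remain. *)
Lemma nijenhuis_courant p u v c : gdiff p u -> gdiff p v -> gscalar c ->
  bpair (courant (fun x => J x (u x)) (fun x => J x (v x)) p -
    J p (courant (fun x => J x (u x)) v p + courant u (fun x => J x (v x)) p) +
    courant u v p) c = torsion p (u p) (v p) c.
Proof.
move=> du dv sc.
have dJu := gdiff_endo fr bJ du; have dJv := gdiff_endo fr bJ dv.
have su : gscalar (u p) by exact: nbhs_singleton (near_gscalar du).
have sv : gscalar (v p) by exact: nbhs_singleton (near_gscalar dv).
have sJ e : gscalar e -> gscalar (J p e) by exact: endo_gscalar.
have sDu w : gscalar (jet p u w) by exact: jet_scalar.
have sDv w : gscalar (jet p v w) by exact: jet_scalar.
have sS w e : gscalar e -> gscalar (Sjet J p w e) by exact: Sjet_scalar.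
have scour u' v' : gdiff p u' -> gdiff p v' -> gscalar (courant u' v' p).
  move=> du' dv'; rewrite courantE //.
  apply: gscalarD; first by apply: gscalarD; last apply: gscalarN; exact: jet_scalar.
  have su' : gscalar (u' p) by exact: nbhs_singleton (near_gscalar du').
  have sv' : gscalar (v' p) by exact: nbhs_singleton (near_gscalar dv').
  move=> k w w' /=; rewrite !jetP //.
  have s1 w1 : gscalar (jet p u' w1) by exact: jet_scalar.
  have s2 w1 : gscalar (jet p v' w1) by exact: jet_scalar.
  move: (jet p u') (jet p v') s1 s2 => Du Dv s1 s2.
  by rewrite bpairDl // bpairZl // bpairDr // bpairZr //; ring.
rewrite bpairDl // bpairBl // bpair_endo //; last by apply: gscalarD; apply: scour.
rewrite opprK bpairDl; last exact: sJ.
have sJc := sJ _ sc; have sJu := sJ _ su; have sJv := sJ _ sv.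
rewrite (bpair_courant dJu dJv sc) (bpair_courant dJu dv sJc).
rewrite (bpair_courant du dJv sJc) (bpair_courant du dv sc).
rewrite /torsion /torsion1 !(jet_endo fr bJ _ du) !(jet_endo fr bJ _ dv).
have skJ e e' : gscalar e -> gscalar e' ->
  bpair (J p e) e' = - bpair e (J p e') by move=> *; exact: bpair_endo.
have skS w e e' : gscalar e -> gscalar e' ->
    bpair (Sjet J p w e) e' = - bpair e (Sjet J p w e').
  by move=> *; exact: Sjet_skew.
have aS w e : gscalar e -> Sjet J p w (J p e) = - J p (Sjet J p w e).
  exact: Sjet_anti.
have JJ e : gscalar e -> J p (J p e) = e by exact: J2.
(* From here on only algebra is left, so all geometric objects become variables. *)
move: (jet p u) (jet p v) (Sjet J p) (J p) (u p) (v p) su sv sJ sDu sDv sS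
  sJc sJu sJv skJ skS aS JJ
  => DU DV S K U V sU sV sK sDU sDV sS sKc sKU sKV skK skS aS KK.
rewrite !(bpairDl _ _ sc) !(bpairDl _ _ sKc) !(bpairDl _ _ sKV)
  !(bpairDl _ _ sV) !(bpairDr _ _ sKU) !(bpairDr _ _ sU).
rewrite !(skK (DU _)) // !(skK (DV _)) // !(skK U) //; [|exact: sS|exact: sK].
rewrite !KK //.
(* Skewness and anticommutation of the derivative with [J] bring all remaining terms to common
   atoms; the two halves from the Courant brackets then add up to the whole terms of [torsion]. *)
have f1 : bpair (S (K V).1 c) U = - bpair (S (K V).1 U) c.
  by rewrite skS // bpairC.
have f2 : bpair (S V.1 c) (K U) = - bpair (S V.1 U) (K c).
  rewrite skS // aS // bpairNr // opprK bpairC.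
  by rewrite skK //; exact: sS.
have f3 : bpair U (K (S c.1 V)) = bpair (S c.1 U) (K V).
  by rewrite skS // aS // bpairNr // opprK.
have f4 : bpair U (S (K c).1 V) = - bpair (S (K c).1 U) V.
  by rewrite skS // opprK.
rewrite f1 f2 f3 f4.
by lra.
Qed.

(** Nondegeneracy of the pairing allows testing against an arbitrary [c]; global extensions of [c1]
    and [c2] realize arbitrary values at a point. *)
Lemma integrable_torsion : integrable_paracomplex J <->
  forall p c1 c2 c3, gscalar c1 -> gscalar c2 -> gscalar c3 ->
    torsion p c1 c2 c3 = 0.
Proof.
split=> [iJ p c1 c2 c3 s1 s2 s3|T0 u v Cu Cv /= p].
  have pp := mem_chart_dom p.
  have [u Cu uE] := section_extension fr pp s1.
  have [v Cv vE] := section_extension fr pp s2.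
  have du := smooth_gdiff fr p Cu; have dv := smooth_gdiff fr p Cv.
  have := nijenhuis_courant du dv s3; have /= -> := iJ u v Cu Cv p.
  rewrite (nbhs_singleton uE) (nbhs_singleton vE) !tau_self => <-.
  by rewrite /bpair /= (scalar0 s3) addr0.
have du := smooth_gdiff fr p Cu; have dv := smooth_gdiff fr p Cv.
apply: (bpair_eq0 fr) => c sc; rewrite nijenhuis_courant //; apply: T0 => //.
  exact: nbhs_singleton (near_gscalar du).
exact: nbhs_singleton (near_gscalar dv).
Qed.

End Torsion.

(** * The adapted structure on the product with the line *)

Section LineFrame.
Context {R : realType} {E : normedModType R} (fr : frame E).

Definition line_fvec (j : 'I_(fdim fr + 1)) : E * R :=
  match fintype.split j with inl i => (fvec fr i, 0) | inr _ => (0, 1) end.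

Definition line_fcoord (j : 'I_(fdim fr + 1)) (v : E * R) : R :=
  match fintype.split j with inl i => fcoord fr i v.1 | inr _ => v.2 end.

Lemma line_fcoord_scalar j : scalar (line_fcoord j).
Proof.
by move=> k u v; rewrite /line_fcoord; case: (fintype.split j) => i //;
  exact: (fcoord_scalar fr i).
Qed.

Lemma line_fcoord_continuous j : continuous (line_fcoord j).
Proof.
move=> v; rewrite /line_fcoord; case: (fintype.split j) => i; last exact: cvg_snd.
apply: (@cvg_comp _ _ _ fst (fcoord fr i) _ _ _ cvg_fst).
exact: fcoord_continuous.
Qed.

Lemma line_fcoordE v : v = \sum_j line_fcoord j v *: line_fvec j.
Proof.
rewrite big_split_ord big_ord1 /=.
have -> : line_fcoord (rshift (fdim fr) ord0) v *:
    line_fvec (rshift (fdim fr) ord0) = (0, v.2).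
  rewrite /line_fcoord /line_fvec -[rshift _ _]/(unsplit (inr ord0)) unsplitK.
  by congr (_, _); rewrite /= ?scaler0 //; exact: mulr1.
have -> : \sum_(i < fdim fr) line_fcoord (lshift 1 i) v *:
    line_fvec (lshift 1 i) = (v.1, 0).
  rewrite [in RHS](fcoordE fr v.1).
  elim/big_ind2: _ => [//|x1 x2 y1 y2 -> ->|i _].
    by congr (_, _); rewrite /= addr0.
  rewrite /line_fcoord /line_fvec -[lshift _ _]/(unsplit (inl i)) unsplitK.
  by congr (_, _); rewrite /= scaler0.
by case: v => v r; congr (_, _); rewrite /= ?addr0 ?add0r.
Qed.

Definition line_frame : frame (E * R)%type :=
  Frame line_fcoord_scalar line_fcoord_continuous line_fcoordE.

Lemma derive_line (f : E -> E) (e v : E * R) : differentiable f e.1 ->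
  'D_v (fun e : E * R => (f e.1, e.2)) e = ('D_(v.1) f e.1, v.2).
Proof.
move=> df.
have isd : is_diff e (fun e : E * R => (f e.1, e.2))
    (fun v : E * R => ('d f (e.1) v.1, v.2)).
  apply: is_diff_pair; last exact: is_diff_snd.
  have ? := is_diff_fst e; have /differentiableP ? := df.
  exact: (is_diff_comp (f := fst)).
have [dx xE] := isd; rewrite deriveE // xE.
by rewrite -deriveE.
Qed.

Lemma derive_pair (W W' : normedModType R) (f : E -> W) (g : E -> W') e v :
  differentiable f e -> differentiable g e ->
  'D_v (fun e => (f e, g e)) e = ('D_v f e, 'D_v g e).
Proof.
move=> df dg; rewrite !deriveE //; last exact: differentiable_pair.
by rewrite diff_pair.
Qed.

Lemma Cn_on_line n (U : set (E * R)) (f : E * R -> E) (g : E * R -> R) :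
  open U -> Cn_on n U f -> Cn_on n U g -> Cn_on n U (fun e => (f e, g e)).
Proof.
move=> oU Cf Cg; apply: (Cn_on_coord (fr := line_frame)) => // j.
rewrite /= /line_fcoord; case: (fintype.split j) => i //.
exact: Cn_on_fcoord.
Qed.

End LineFrame.

(** * Charts, components and jets on the product with the line *)

Section LineManifold.
Context {R : realType} {E : normedModType R} (fr : frame E).
Variable M : smooth_manifold E.
Implicit Types (x y p : M) (t s : R) (w : E) (c : E * (E -> R)).

Lemma line_cod x t : @chart_cod R _ (times_line M) (x, t) =
  chart_cod x `*` [set: R].
Proof. exact: (@line_image R E M (x, t) (chart_dom x)). Qed.

Lemma line_components x t y s (v : E * R) : chart_dom x y ->
  @components R _ (times_line M) (x, t) (y, s) v = (components x y v.1, v.2).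
Proof.
move=> xy; apply: (derive_line (f := chart x \o unchart y) (e := (chart y y, s))).
by apply: transition_differentiable => //; exact: mem_chart_dom.
Qed.

Lemma line_coord_field x t y s (v : E * R) : chart_dom x y ->
  @coord_field R _ (times_line M) (x, t) v (y, s) = (coord_field x v.1 y, v.2).
Proof.
move=> xy; apply: (derive_line (f := chart y \o unchart x) (e := (chart x y, s))).
by apply: transition_differentiable => //; exact: mem_chart_dom.
Qed.

(* c + f d/dt + g dt. *)
Definition lc c (f g : R) : (E * R) * (E * R -> R) :=
  ((c.1, f), fun v => c.2 v.1 + g * v.2).

Definition lc_part (u : (E * R) * (E * R -> R)) : E * (E -> R) :=
  (u.1.1, fun v => u.2 (v, 0)).

Lemma lcE u : gscalar u -> u = lc (lc_part u) u.1.2 (u.2 (0, 1)).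
Proof.
case: u => [[X f] a] sa; congr (_, _); apply/funext => -[v r] /=.
have {}sa : scalar a := sa.
rewrite mulrC -(scalar_scaler _ _ sa) -(scalarD _ _ sa); congr a.
by congr (_, _); rewrite /= ?scaler0 ?addr0 ?add0r //; exact/esym/mulr1.
Qed.

Lemma lc_part_scalar u : gscalar u -> gscalar (lc_part u).
Proof.
move=> su k v w /=; rewrite -[RHS]su; congr (u.2 (_, _)).
by rewrite -[RHS]/(k * 0 + 0) mulr0 addr0.
Qed.

Lemma lc_partK c f g : lc_part (lc c f g) = c.
Proof.
by case: c => X a; congr (_, _); apply/funext => v /=; rewrite mulr0 addr0.
Qed.

Lemma lc_scalar c f g : gscalar c -> gscalar (lc c f g).
Proof.
move=> sc k v w /=; rewrite sc -[(k *: v.2)]/(k * v.2).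
by rewrite !mulrDr addrACA mulrCA.
Qed.

Lemma lc_t c f g : gscalar c -> (lc c f g).2 (0, 1) = g.
Proof. by move=> sc; rewrite /= (scalar0 sc) add0r mulr1. Qed.

Lemma bpair_lc c f g c' f' g' :
  bpair (lc c f g) (lc c' f' g') = bpair c c' + f * g' + g * f'.
Proof. by rewrite /bpair /=; ring. Qed.

(** The product charts are the identity on R, so the fields d/dt and dt are parallel. *)
Lemma tau_lc x t y s c f g : chart_dom x y ->
  @tau R _ (times_line M) (x, t) (y, s) (lc c f g) = lc (tau x y c) f g.
Proof.
move=> xy; rewrite /tau line_coord_field //; congr (_, _).
by apply/funext => v; rewrite line_components.
Qed.

Lemma near_line x t (P : M -> Prop) : (\forall y \near x, P y) ->
  \forall q \near ((x, t) : times_line M), P q.1.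
Proof. by move=> nP; exact: (@cvg_fst _ _ (nbhs x) (nbhs t) _ P nP). Qed.

Lemma tderive_line (W : normedModType R) (h : M -> W) x t (v : E * R) :
  @tderive R _ (times_line M) W (fun q => h q.1) (x, t) v = tderive h x v.1.
Proof.
exact: (derive_fst (h \o unchart x) ((chart x x, t) : E * R) v).
Qed.

Lemma jet_lc (u : gsection M) (f g : M -> R) x t (v : E * R) :
  gdiff x u -> tdiff f x -> tdiff g x ->
  @jet R _ (times_line M) (x, t) (fun q => lc (u q.1) (f q.1) (g q.1)) v =
  lc (jet x u v.1) (tderive f x v.1) (tderive g x v.1).
Proof.
move=> [du1 [_ du2]] df dg; rewrite /jet /lc; congr (_, _).
  transitivity (@tderive R _ (times_line M) (E * R)%type
      (fun q => (components x q.1 (u q.1).1, f q.1)) (x, t) v).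
    apply: (@tderive_eq R _ (times_line M)).
    apply: filterS (near_line t (near_dom_self x)) => -[y s] xy.
    by rewrite line_components.
  rewrite (tderive_line (fun y => (components x y (u y).1, f y))).
  exact: (derive_pair v.1 du1 df).
apply/funext => v'.
transitivity (@tderive R _ (times_line M) R
    (fun q => (u q.1).2 (coord_field x v'.1 q.1) + g q.1 * v'.2) (x, t) v).
  apply: (@tderive_eq R _ (times_line M)).
  apply: filterS (near_line t (near_dom_self x)) => -[y s] xy.
  by rewrite line_coord_field.
rewrite (tderive_line (fun y => (u y).2 (coord_field x v'.1 y) + g y * v'.2)).
have dc := tdiff_cst (v'.2 : R) x.
rewrite tderiveD //; last exact: tdiffM.
by rewrite tderiveM // tderive_cst mulr0 addr0.
Qed.

End LineManifold.

Section LineEndo.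
Context {R : realType} {E : normedModType R} (fr : frame E).
Variables (M : smooth_manifold E) (FF : gendo M) (Z : vfield M) (xi : form1 M).
Implicit Types (x y p : M) (t s : R) (w : E) (c : E * (E -> R)).

Definition gvec : gsection M := fun y => (Z y, 0).
Definition gcov : gsection M := fun y => (0, xi y).

(** The action is c |-> FF c + 2<c, Z> d/dt - 2<c, xi> dt on the part along M, d/dt |-> xi and dt
    |-> -Z. Thus it exchanges xi with d/dt and Z with -dt. *)
Definition line_endo : gendo (times_line M) := fun q u =>
  lc (FF q.1 (lc_part u) + u.1.2 *: gcov q.1 - u.2 (0, 1) *: gvec q.1)
    (bpair (lc_part u) (gvec q.1)) (- bpair (lc_part u) (gcov q.1)).

Hypothesis bF : bundle_endo FF.
Hypothesis CZ : smooth_vfield Z.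
Hypothesis Cxi : smooth_form1 xi.
Hypothesis kF : gskew FF.
Hypothesis xiZ : forall x, xi x (Z x) = 1.
Hypothesis FFxi : forall x, FF x (gcov x) = 0.
Hypothesis FFZ : forall x, FF x (gvec x) = 0.
Hypothesis FF2 : forall x c, gscalar c ->
  FF x (FF x c) = c - (bpair c (gcov x) *: gvec x + bpair c (gvec x) *: gcov x).

Lemma gvec_scalar y : gscalar (gvec y). Proof. exact: gscalar_vec. Qed.
Lemma gcov_scalar y : gscalar (gcov y). Proof. by case: Cxi => + _; apply. Qed.
Let FF_scalar y c : gscalar c -> gscalar (FF y c) := @endo_gscalar _ _ _ _ bF y c.
Hint Resolve gvec_scalar gcov_scalar : core.

Lemma smooth_gvec : smooth_gsection gvec.
Proof.
split; first exact: CZ.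
split=> [y|X CX x]; first exact: gscalar_vec.
by move=> n; exact: Cn_on_cst.
Qed.

Lemma smooth_gcov : smooth_gsection gcov.
Proof.
split; last exact: Cxi.
move=> x n; apply: (eq_Cn_on (f := fun=> 0)) (Cn_on_cst _ _ _).
  exact: open_chart_cod.
by move=> e _ /=; rewrite components0.
Qed.

Lemma gdiff_gvec p : gdiff p gvec. Proof. exact: (smooth_gdiff fr p smooth_gvec). Qed.
Lemma gdiff_gcov p : gdiff p gcov. Proof. exact: (smooth_gdiff fr p smooth_gcov). Qed.

Lemma bpair_gvec_gvec y : bpair (gvec y) (gvec y) = 0.
Proof. by rewrite /bpair /= addr0. Qed.

Lemma bpair_gcov_gcov y : bpair (gcov y) (gcov y) = 0.
Proof.
by have := scalar0 (gcov_scalar y); rewrite /bpair /= => ->; rewrite addr0.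
Qed.

Lemma bpair_gcov_gvec y : bpair (gcov y) (gvec y) = 1.
Proof. by rewrite /bpair /= xiZ add0r. Qed.

Lemma line_endo_lc (q : M * R) c f g : gscalar c -> line_endo q (lc c f g) =
  lc (FF q.1 c + f *: gcov q.1 - g *: gvec q.1) (bpair c (gvec q.1))
    (- bpair c (gcov q.1)).
Proof. by move=> sc; rewrite /line_endo lc_partK lc_t. Qed.

Lemma FFpart_scalar y c f g : gscalar c ->
  gscalar (FF y c + f *: gcov y - g *: gvec y).
Proof.
move=> sc; apply: gscalarD; last exact/gscalarN/gscalarZ.
by apply: gscalarD; [exact: FF_scalar|exact: gscalarZ].
Qed.

Lemma line_endo_skew : gskew line_endo.
Proof.
move=> q u v su sv; rewrite /gpairing -!/(bpair _ _) -mulrDr.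
rewrite (lcE su) (lcE sv).
have sc := lc_part_scalar su; have sc' := lc_part_scalar sv.
move: (lc_part u) (lc_part v) (u.1.2) (v.1.2) (u.2 _) (v.2 _) sc sc'
  => c c' f f' g g' sc sc'.
rewrite !line_endo_lc // !bpair_lc !(bpairDl, bpairDr) //.
rewrite !(bpairNl, bpairNr) // !(bpairZl, bpairZr) //.
rewrite (bpair_endo q.1 kF sc sc') (bpairC (gcov _) c') (bpairC (gvec _) c').
by rewrite [X in _ * X](_ : _ = 0) ?mulr0 //; ring.
Qed.

Lemma lc_add c f g c' f' g' : lc c f g + lc c' f' g' = lc (c + c') (f + f') (g + g').
Proof.
congr (_, _); apply/funext => v.
by rewrite -[LHS]/(c.2 v.1 + g * v.2 + (c'.2 v.1 + g' * v.2)) /= mulrDl addrACA.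
Qed.

Lemma lc_scale k c f g : k *: lc c f g = lc (k *: c) (k * f) (k * g).
Proof.
congr (_, _); apply/funext => v.
by rewrite -[LHS]/(k * (c.2 v.1 + g * v.2)) /= mulrDr mulrA.
Qed.

(** [FF] squared misses the Z (.) xi part of [c]; the d/dt- and dt-components of the first image
    carry exactly this part, and the second application returns it. *)
Lemma line_endo_sqr (q : M * R) u : gscalar u -> line_endo q (line_endo q u) = u.
Proof.
move=> su; rewrite {1}(lcE su) [RHS](lcE su).
have sc := lc_part_scalar su.
move: (lc_part u) (u.1.2) (u.2 _) sc => c f g sc.
rewrite !line_endo_lc //; last exact: FFpart_scalar.
have sFc : gscalar (FF q.1 c) by exact: FF_scalar.
have sfx : gscalar (f *: gcov q.1) by exact: gscalarZ.
have sgz : gscalar (- (g *: gvec q.1)) by exact/gscalarN/gscalarZ.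
have sD : gscalar (FF q.1 c + f *: gcov q.1) by exact: gscalarD.
congr lc.
- rewrite (endoD bF) // (endoD bF) // (endoN bF) ?(endoZ bF) //; last exact: gscalarZ.
  rewrite FFxi FFZ !scaler0 subr0 addr0 FF2 // scaleNr opprK.
  by rewrite -addrA (addrC (_ *: gcov _)) subrK.
- rewrite !bpairDl // bpairNl // !bpairZl // (bpair_endo _ kF) // FFZ.
  by rewrite bpair_gvec_gvec bpair_gcov_gvec mulr0 mulr1 subr0 {1}/bpair /=
    (scalar0 sc) addr0 oppr0 add0r.
- rewrite !bpairDl // bpairNl // !bpairZl // (bpair_endo _ kF) // FFxi.
  by rewrite bpair_gcov_gcov (bpairC (gvec _)) bpair_gcov_gvec mulr0 mulr1
    addr0 {1}/bpair /=
    (scalar0 sc) addr0 oppr0 add0r opprK.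
Qed.

Lemma line_endo_gscalar (q : M * R) u : gscalar u -> gscalar (line_endo q u).
Proof.
move=> su; rewrite (lcE su) line_endo_lc; last exact: lc_part_scalar.
apply: lc_scalar; apply: FFpart_scalar; exact: lc_part_scalar.
Qed.

Lemma line_endo_linear (q : M * R) k u v : gscalar u -> gscalar v ->
  line_endo q (k *: u + v) = k *: line_endo q u + line_endo q v.
Proof.
move=> su sv; rewrite {1 2}(lcE su) {1 2}(lcE sv).
have sc := lc_part_scalar su; have sc' := lc_part_scalar sv.
move: (lc_part u) (lc_part v) (u.1.2) (v.1.2) (u.2 _) (v.2 _) sc sc'
  => c c' f f' g g' sc sc'.
have skc : gscalar (k *: c) by exact: gscalarZ.
rewrite lc_scale lc_add !line_endo_lc //; last exact: gscalarD.
rewrite lc_scale lc_add; congr lc.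
- rewrite (endoD bF) // (endoZ bF) // !scalerDl !scalerDr scalerN !scalerA opprD.
  by rewrite [RHS]addrACA [X in _ = X + _]addrACA.
- by rewrite bpairDl // bpairZl.
- by rewrite bpairDl // bpairZl // opprD mulrN.
Qed.

Section Smoothness.
Variables (u : gsection (times_line M)) (x : M) (t : R).
Hypothesis Cu : smooth_gsection u.
Let q0 : times_line M := (x, t).
Let U := chart_cod q0.
Let sm (W : normedModType R) (h : times_line M -> W) :=
  smooth_on U (h \o unchart q0).

Let oU : open U. Proof. exact: open_chart_cod. Qed.

Let U_dom e : U e -> chart_dom x (unchart x e.1).
Proof. by move=> /(@unchart_dom _ _ (times_line M))[]. Qed.

Let sm_eq (W : normedModType R) (h h' : times_line M -> W) :
  (forall y s, chart_dom x y -> h (y, s) = h' (y, s)) -> sm h -> sm h'.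
Proof.
move=> hh; apply: eq_smooth_on => // -[e s] Ue.
by apply: hh; exact: (U_dom Ue).
Qed.

Let sm_pull (W : normedModType R) (h : M -> W) :
  smooth_on (chart_cod x) (h \o unchart x) -> sm (fun q => h q.1).
Proof.
move=> Ch n; rewrite /U line_cod.
exact: (Cn_on_fst R (open_chart_cod x) (Ch n)).
Qed.

Let sm_coef j : sm (fun q => gcoef fr j (tauinv x q.1 (lc_part (u q)))).
Proof.
have [C1 C2] := gsection_coefs (line_frame fr) Cu q0.
case: j => i.
  have : sm (fun q => fcoord (line_frame fr) (lshift 1 i) (components q0 q (u q).1)).
    by move=> n; apply: Cn_on_fcoord => //; exact: (C1 n).
  apply: sm_eq => y s xy; rewrite line_components //.
  by rewrite /= /line_fcoord -[lshift _ _]/(unsplit (inl i)) unsplitK.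
by apply: sm_eq (C2 (fvec fr i, 0)) => y s xy; rewrite line_coord_field.
Qed.

Let sm_f : sm (fun q => (u q).1.2).
Proof.
have [C1 _] := gsection_coefs (line_frame fr) Cu q0.
have : sm (fun q => fcoord (line_frame fr) (rshift (fdim fr) ord0)
    (components q0 q (u q).1)).
  by move=> n; apply: Cn_on_fcoord => //; exact: (C1 n).
apply: sm_eq => y s xy; rewrite line_components //.
by rewrite /= /line_fcoord -[rshift _ _]/(unsplit (inr ord0)) unsplitK.
Qed.

Let sm_g : sm (fun q => (u q).2 (0, 1)).
Proof.
have [_ C2] := gsection_coefs (line_frame fr) Cu q0.
apply: sm_eq (C2 (0, 1)) => y s xy; rewrite line_coord_field //=.
by congr ((u (y, s)).2 (_, _)); exact: derive0.
Qed.

Let su q : gscalar (u q). Proof. by case: Cu => _ [+ _]; apply. Qed.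

(** The M-part of [u] depends on t, so smoothness of [FF] on sections over M does not apply to it
    directly. Expanded in a local family on M, it becomes a sum of smooth coefficients on M x R
    times functions pulled back from M. *)
Lemma smooth_coefs_line_endo : smooth_coefs q0 (fun q => line_endo q (u q)).
Proof.
have [CZ1 _] := gsection_coefs fr smooth_gvec x.
have [_ Cxi2] := gsection_coefs fr smooth_gcov x.
have CF j := endo_coefs fr bF x (gbasis_scalar (fr := fr) j).
have FE y s : chart_dom x y -> FF y (lc_part (u (y, s))) =
    \sum_j gcoef fr j (tauinv x y (lc_part (u (y, s)))) *:
      FF y (tau x y (gbasis fr j)).
  by move=> xy; rewrite -endo_frameE //; exact: lc_part_scalar.
have dt : sm (fun q => bpair (lc_part (u q)) (gvec q.1)).
  have : sm (fun q => \sum_i fcoord fr i (components x q.1 (Z q.1)) *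
      gcoef fr (inr i) (tauinv x q.1 (lc_part (u q)))).
    move=> n; apply: (Cn_on_sum _ oU) => i; apply: (Cn_onM oU).
      apply: (Cn_on_fcoord fr i oU
        (f := fun e => components x (unchart x e.1) (Z (unchart x e.1)))).
      exact: (sm_pull CZ1 n).
    exact: (sm_coef (inr i) n).
  apply: sm_eq => y s xy.
  have sp := tauinv_scalar xy (lc_part_scalar (su (y, s))).
  rewrite -(scalar_frameE fr sp) /bpair /= add0r.
  by congr ((u (y, s)).2 (_, _)); rewrite componentsK.
have dxi : sm (fun q => bpair (lc_part (u q)) (gcov q.1)).
  have : sm (fun q => \sum_i gcoef fr (inl i) (tauinv x q.1 (lc_part (u q))) *
      xi q.1 (coord_field x (fvec fr i) q.1)).
    move=> n; apply: (Cn_on_sum _ oU) => i; apply: (Cn_onM oU).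
      exact: (sm_coef (inl i) n).
    exact: (sm_pull (Cxi2 (fvec fr i)) n).
  apply: sm_eq => y s xy.
  have sx : scalar (fun w => xi y (coord_field x w y)).
    have sxi : scalar (xi y) := gcov_scalar y.
    by move=> k v w; rewrite coord_field_linear // sxi.
  rewrite -(scalar_frameE fr sx) componentsK // /bpair /=.
  have := scalar0 (lc_part_scalar (su (y, s))); rewrite /lc_part /= => ->.
  by rewrite addr0.
(* The term in xi is a covector, so the vector part receives contributions from [FF] and Z only. *)
have dX i : sm (fun q => fcoord fr i (components x q.1 (FF q.1 (lc_part (u q)) +
    (u q).1.2 *: gcov q.1 - (u q).2 (0, 1) *: gvec q.1).1)).
  have : sm (fun q => \sum_j gcoef fr j (tauinv x q.1 (lc_part (u q))) *
      fcoord fr i (components x q.1 (FF q.1 (tau x q.1 (gbasis fr j))).1) +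
      -1 * ((u q).2 (0, 1) * fcoord fr i (components x q.1 (Z q.1)))).
    move=> m; apply: (Cn_onD oU).
      apply: (Cn_on_sum _ oU) => j; apply: (Cn_onM oU).
        exact: (sm_coef j m).
      apply: (Cn_on_fcoord fr i oU (f := fun e => components x (unchart x e.1)
        (FF (unchart x e.1) (tau x (unchart x e.1) (gbasis fr j))).1)).
      exact: (sm_pull (CF j).1 m).
    apply: (Cn_onM oU); first exact: Cn_on_cst.
    apply: (Cn_onM oU); first exact: (sm_g m).
    apply: (Cn_on_fcoord fr i oU (f := fun e => components x (unchart x e.1)
      (Z (unchart x e.1)))).
    exact: (sm_pull CZ1 m).
  apply: sm_eq => y s xy.
  have sF := fcoord_scalar fr i.
  have sC : scalar (fun v => fcoord fr i (components x y v)).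
    by move=> k v v'; rewrite components_linear // sF.
  have sCZ k v : fcoord fr i (components x y (k *: v)) =
    k * fcoord fr i (components x y v) := scalar_scaler k v sC.
  have sCB v v' : fcoord fr i (components x y (v - v')) =
    fcoord fr i (components x y v) - fcoord fr i (components x y v') :=
    scalarB v v' sC.
  have -> : (FF y (lc_part (u (y, s))) + (u (y, s)).1.2 *: gcov y -
      (u (y, s)).2 (0, 1) *: gvec y).1 = (FF y (lc_part (u (y, s)))).1 -
      (u (y, s)).2 (0, 1) *: Z y.
    rewrite -[LHS]/((FF y (lc_part (u (y, s)))).1 +
      (u (y, s)).1.2 *: 0 - (u (y, s)).2 (0, 1) *: Z y).
    by rewrite scaler0 addr0.
  have -> := sCB (FF y (lc_part (u (y, s)))).1 ((u (y, s)).2 (0, 1) *: Z y).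
  have -> := sCZ ((u (y, s)).2 (0, 1)) (Z y).
  rewrite mulN1r.
  congr (_ - _).
  rewrite (FE _ _ xy).
  have -> : (\sum_j gcoef fr j (tauinv x y (lc_part (u (y, s)))) *:
    FF y (tau x y (gbasis fr j))).1 =
    \sum_j gcoef fr j (tauinv x y (lc_part (u (y, s)))) *:
    (FF y (tau x y (gbasis fr j))).1.
    by elim/big_ind2: _ => // u1 v1 u2 v2 <- <-.
  have sCS := scalar_sum (index_enum _) (fun j => gcoef fr j
    (tauinv x y (lc_part (u (y, s)))) *: (FF y (tau x y (gbasis fr j))).1) sC.
  apply: etrans (esym sCS); apply: eq_bigr => j _.
  exact: (esym (sCZ _ _)).
split=> [|[w r]].
  have : sm (fun q => (components x q.1 (FF q.1 (lc_part (u q)) +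
      (u q).1.2 *: gcov q.1 - (u q).2 (0, 1) *: gvec q.1).1,
      bpair (lc_part (u q)) (gvec q.1))).
    move=> n; apply: (Cn_on_line fr oU); last exact: (dt n).
    by apply: (Cn_on_coord (fr := fr) oU) => i; exact: (dX i n).
  by apply: sm_eq => y s xy; rewrite line_components.
have : sm (fun q => \sum_j gcoef fr j (tauinv x q.1 (lc_part (u q))) *
    (FF q.1 (tau x q.1 (gbasis fr j))).2 (coord_field x w q.1) +
    (u q).1.2 * xi q.1 (coord_field x w q.1) +
    (- r) * bpair (lc_part (u q)) (gcov q.1)).
  move=> n; apply: (Cn_onD oU); last first.
    by apply: (Cn_onM oU); [exact: Cn_on_cst|exact: (dxi n)].
  apply: (Cn_onD oU); last first.
    apply: (Cn_onM oU); first exact: (sm_f n).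
    exact: (sm_pull (Cxi2 w) n).
  apply: (Cn_on_sum _ oU) => j; apply: (Cn_onM oU).
    exact: (sm_coef j n).
  exact: (sm_pull ((CF j).2 w) n).
apply: sm_eq => y s xy; rewrite line_coord_field //.
rewrite -[RHS]/((FF y (lc_part (u (y, s)))).2 (coord_field x w y) +
  (u (y, s)).1.2 * xi y (coord_field x w y) - (u (y, s)).2 (0, 1) * 0 +
  - bpair (lc_part (u (y, s))) (gcov y) * r) mulr0 subr0.
rewrite mulNr mulNr (mulrC r); congr (_ + _ + _).
rewrite FE //.
by elim/big_rec2: _ => [//|j v1 v2 _ ->].
Qed.

End Smoothness.

Lemma line_endo_bundle : bundle_endo line_endo.
Proof.
split=> [q u su|q k u v su sv|u Cu].
- exact: line_endo_gscalar.
- exact: line_endo_linear.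
- apply: (gsection_of_coefs (line_frame fr)) => [q|[x t]].
    by apply: line_endo_gscalar; case: Cu => _ [+ _]; apply.
  exact: smooth_coefs_line_endo.
Qed.

End LineEndo.

(** * The torsion on M x R as a polynomial over tensors on M *)

Section Paracontact.
Context {R : realType} {E : normedModType R} (fr : frame E).
Variables (M : smooth_manifold E) (FF : gendo M) (Z : vfield M) (xi : form1 M).
Hypothesis HFF : gen_almost_paracontact FF Z xi.
Implicit Types (x y p : M) (t s : R) (w : E) (c : E * (E -> R)).

Local Notation gvec := (gvec Z).
Local Notation gcov := (gcov xi).
Local Notation S := (Sjet FF).

Lemma pc_bundle : bundle_endo FF. Proof. by case: HFF. Qed.
Lemma pc_Z : smooth_vfield Z. Proof. by case: HFF => _ []. Qed.
Lemma pc_xi : smooth_form1 xi. Proof. by case: HFF => _ []. Qed.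
Lemma pc_skew : gskew FF. Proof. by case: HFF. Qed.
Lemma pc_xiZ x : xi x (Z x) = 1.
Proof. by case: HFF => _ _ _ + _ => /(_ x)[]. Qed.
Lemma pc_FFxi x : FF x (gcov x) = 0.
Proof. by case: HFF => _ _ _ + _ => /(_ x)[]. Qed.
Lemma pc_FFZ x : FF x (gvec x) = 0.
Proof. by case: HFF => _ _ _ + _ => /(_ x)[]. Qed.

Lemma pc_gcov_scalar x : gscalar (gcov x).
Proof. exact: gcov_scalar pc_xi x. Qed.
Lemma pc_gvec_scalar x : gscalar (gvec x).
Proof. exact: gscalar_vec. Qed.
Hint Resolve pc_gcov_scalar pc_gvec_scalar : core.

Lemma bpair_gvec c y : bpair c (gvec y) = c.2 (Z y).
Proof. by rewrite /bpair add0r. Qed.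

Lemma bpair_gcov c y : gscalar c -> bpair c (gcov y) = xi y c.1.
Proof. by move=> sc; rewrite /bpair /= (scalar0 sc) addr0. Qed.

Lemma pc_FF2 x c : gscalar c ->
  FF x (FF x c) = c - (bpair c (gcov x) *: gvec x + bpair c (gvec x) *: gcov x).
Proof.
move=> sc; case: HFF => _ _ _ _ /(_ x c sc) ->; rewrite bpair_gvec bpair_gcov //.
congr (_ - _); rewrite /gvec /gcov; congr (_, _).
  by rewrite /= scaler0 addr0.
by apply/funext => w; rewrite -[RHS]/(xi x c.1 * 0 + c.2 (Z x) * xi x w) mulr0 add0r.
Qed.

Lemma gdiff_FF_tau x c : gscalar c -> gdiff x (fun y => FF y (tau x y c)).
Proof. by move=> sc; exact: (gdiff_endo_tau fr pc_bundle). Qed.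

Definition DZ x w := jet x gvec w.
Definition Dxi x w := jet x gcov w.

Lemma pc_gdiff_gvec x : gdiff x gvec.
Proof. exact: (gdiff_gvec fr pc_Z). Qed.
Lemma pc_gdiff_gcov x : gdiff x gcov.
Proof. exact: (gdiff_gcov fr pc_xi). Qed.
Lemma DZ_scalar x w : gscalar (DZ x w).
Proof. exact: jet_scalar (pc_gdiff_gvec x). Qed.
Lemma Dxi_scalar x w : gscalar (Dxi x w).
Proof. exact: jet_scalar (pc_gdiff_gcov x). Qed.
Hint Resolve DZ_scalar Dxi_scalar : core.

Lemma tdiff_bpair x (u v : gsection M) : gdiff x u -> gdiff x v ->
  tdiff (fun y => bpair (u y) (v y)) x.
Proof.
move=> [du1 du2] [dv1 dv2].
by apply: tdiffD; [exact: (tdiff_pair fr dv2 du1)|exact: (tdiff_pair fr du2 dv1)].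
Qed.

Lemma tderive_bpair_tau x (u : gsection M) c w : gdiff x u -> gscalar c ->
  gscalar (u x) ->
  tderive (fun y => bpair (tau x y c) (u y)) x w = bpair c (jet x u w).
Proof.
move=> du sc su; rewrite (tderive_bpair fr w (gdiff_tau x sc) du).
rewrite jet_tau // tau_self; rewrite [X in X + _](_ : _ = 0) ?add0r //.
by rewrite /bpair /= (scalar0 su) add0r.
Qed.

(** All tensors are pulled back from M, so the R-component of [v] contributes nothing; with parallel
    [c] and constant [f], [g] the derivative falls on [FF], Z and xi alone. *)
Lemma Sjet_line_endo x t (v : E * R) c f g : gscalar c ->
  @Sjet R _ (times_line M) (line_endo FF Z xi) (x, t) v (lc c f g) =
  lc (S x v.1 c + f *: Dxi x v.1 - g *: DZ x v.1) (bpair c (DZ x v.1))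
    (- bpair c (Dxi x v.1)).
Proof.
move=> sc.
pose u y := FF y (tau x y c) + (f *: gcov y + (- g) *: gvec y).
pose ft y := bpair (tau x y c) (gvec y).
pose gt y := -1 * bpair (tau x y c) (gcov y).
have dk k : tdiff (fun=> k : R) x by exact: tdiff_cst.
have dt := gdiff_tau x sc.
have dx := gdiffZ fr (dk f) (pc_gdiff_gcov x).
have dz := gdiffZ fr (dk (- g)) (pc_gdiff_gvec x).
have dxz := gdiffD dx dz.
have dF := gdiff_FF_tau x sc.
have du : gdiff x u := gdiffD dF dxz.
have dft : tdiff ft x := tdiff_bpair dt (pc_gdiff_gvec x).
have dgt0 := tdiff_bpair dt (pc_gdiff_gcov x).
have dgt : tdiff gt x := tdiffM (dk (-1)) dgt0.
transitivity (@jet R _ (times_line M) (x, t)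
    (fun q => lc (u q.1) (ft q.1) (gt q.1)) v).
  apply: (@jet_eq R _ (times_line M)).
  apply: filterS (near_line t (near_dom_self x)) => -[y s] xy.
  rewrite tau_lc // line_endo_lc; last exact: tau_scalar.
  by rewrite /u /ft /gt /= mulN1r scaleNr addrA.
rewrite (jet_lc t v du dft dgt); congr lc.
- rewrite /u (jetD v.1 dF dxz) (jetD v.1 dx dz).
  rewrite (jetZ fr v.1 (dk f) (pc_gdiff_gcov x)).
  rewrite (jetZ fr v.1 (dk (- g)) (pc_gdiff_gvec x)).
  by rewrite !tderive_cst !scale0r !add0r scaleNr addrA.
- by rewrite (tderive_bpair_tau v.1 (pc_gdiff_gvec x) sc).
- rewrite (tderiveM v.1 (dk _) dgt0) tderive_cst mul0r add0r mulN1r.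
  by rewrite (tderive_bpair_tau v.1 (pc_gdiff_gcov x) sc).
Qed.

(** Differentiate FF xi = 0. *)
Lemma Sjet_gcov x w : S x w (gcov x) = - FF x (Dxi x w).
Proof.
have := jet_endo fr pc_bundle w (pc_gdiff_gcov x).
rewrite (jet_eq (u' := fun=> 0)); last by apply: nearW => y; exact: pc_FFxi.
by rewrite jet0 addrC => /esym/eqP; rewrite addr_eq0 => /eqP.
Qed.

Lemma Sjet_gvec x w : S x w (gvec x) = - FF x (DZ x w).
Proof.
have := jet_endo fr pc_bundle w (pc_gdiff_gvec x).
rewrite (jet_eq (u' := fun=> 0)); last by apply: nearW => y; exact: pc_FFZ.
by rewrite jet0 addrC => /esym/eqP; rewrite addr_eq0 => /eqP.
Qed.

(** Differentiate xi(Z) = 1. *)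
Lemma bpair_DZ_gcov x w : bpair (DZ x w) (gcov x) = - bpair (Dxi x w) (gvec x).
Proof.
have := tderive_bpair fr w (pc_gdiff_gcov x) (pc_gdiff_gvec x).
rewrite (tderive_eq (g := fun=> 1 : R)); last first.
  by apply: nearW => y; rewrite bpair_gvec; exact: pc_xiZ.
rewrite tderive_cst bpairC addrC -/(DZ x w) -/(Dxi x w) => /esym/eqP.
by rewrite addr_eq0 (bpairC (gcov x)) => /eqP.
Qed.

Lemma DZ2 x w : (DZ x w).2 = 0.
Proof. by apply/funext => v; exact: tderive_cst. Qed.

Lemma Dxi1 x w : (Dxi x w).1 = 0.
Proof. exact: (congr1 fst (jet0 x w)). Qed.

Lemma bpair_vec (u v : E * (E -> R)) : u.2 = 0 -> v.2 = 0 -> bpair u v = 0.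
Proof. by rewrite /bpair => -> ->; rewrite addr0. Qed.

Lemma bpair_cov (u v : E * (E -> R)) : gscalar u -> gscalar v ->
  u.1 = 0 -> v.1 = 0 -> bpair u v = 0.
Proof. by rewrite /bpair => su sv -> ->; rewrite (scalar0 su) (scalar0 sv) addr0. Qed.

Lemma bpair_Sjet_gcov x w c : gscalar c ->
  bpair (S x w c) (gcov x) = - bpair (Dxi x w) (FF x c).
Proof.
move=> sc; rewrite (Sjet_skew fr pc_bundle _ _ pc_skew) // Sjet_gcov.
rewrite bpairNr // opprK bpairC.
by rewrite (bpair_endo _ pc_skew).
Qed.

Lemma bpair_Sjet_gvec x w c : gscalar c ->
  bpair (S x w c) (gvec x) = - bpair (DZ x w) (FF x c).
Proof.
move=> sc; rewrite (Sjet_skew fr pc_bundle _ _ pc_skew) // Sjet_gvec.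
rewrite bpairNr // opprK bpairC.
by rewrite (bpair_endo _ pc_skew).
Qed.

Let bpair_Dxi_gcov x w : bpair (Dxi x w) (gcov x) = 0.
Proof. by apply: bpair_cov => //; exact: Dxi1. Qed.

Let bpair_DZ_gvec x w : bpair (DZ x w) (gvec x) = 0.
Proof. by apply: bpair_vec => //; exact: DZ2. Qed.

(** One summand of the cyclic sum. The last two terms, free of the f's and g's, come from the d/dt-
    and dt-components that [line_endo] gives to an element of M. *)
Lemma line_torsion1 x t c1 f1 g1 c2 f2 g2 c3 f3 g3 :
  gscalar c1 -> gscalar c2 -> gscalar c3 ->
  torsion1 (N := times_line M) (line_endo FF Z xi) (x, t)
    (lc c1 f1 g1) (lc c2 f2 g2) (lc c3 f3 g3) =
  bpair (S x (FF x c1).1 c2) c3 - g1 * bpair (S x (Z x) c2) c3 +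
  f2 * (bpair (Dxi x (FF x c1).1) c3 - g1 * bpair (Dxi x (Z x)) c3) -
  g2 * (bpair (DZ x (FF x c1).1) c3 - g1 * bpair (DZ x (Z x)) c3) +
  (bpair (DZ x (FF x c1).1) c2 - g1 * bpair (DZ x (Z x)) c2) * g3 -
  (bpair (Dxi x (FF x c1).1) c2 - g1 * bpair (Dxi x (Z x)) c2) * f3 +
  bpair (S x c1.1 c2) (FF x c3) - f3 * bpair (Dxi x c1.1) (FF x c2) +
  g3 * bpair (DZ x c1.1) (FF x c2) +
  f2 * (bpair (Dxi x c1.1) (FF x c3) - g3 * bpair (Dxi x c1.1) (gvec x)) -
  g2 * (bpair (DZ x c1.1) (FF x c3) - f3 * bpair (Dxi x c1.1) (gvec x)) -
  bpair (DZ x c1.1) c2 * bpair c3 (gcov x) -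
  bpair (Dxi x c1.1) c2 * bpair c3 (gvec x).
Proof.
move=> s1 s2 s3.
have bF := pc_bundle.
rewrite /torsion1 !line_endo_lc // !Sjet_line_endo // !bpair_lc.
(* The direction of differentiation is the vector part along M of the image of the first argument;
   [f1] disappears because xi has no vector part. *)
have -> : ((lc (FF x c1 + f1 *: gcov x - g1 *: gvec x) (bpair c1 (gvec x))
    (- bpair c1 (gcov x))).1).1 = - g1 *: Z x + (FF x c1).1.
  rewrite -[LHS]/((FF x c1).1 + f1 *: 0 - g1 *: Z x).
  by rewrite scaler0 addr0 scaleNr addrC.
rewrite (SjetPl fr bF x _ _ _ s2) {1 2 3}/Dxi {1 2 3}/DZ.
rewrite !(jetP _ _ _ (pc_gdiff_gcov x)) !(jetP _ _ _ (pc_gdiff_gvec x)).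
rewrite -!/(Dxi x _) -!/(DZ x _) -[(lc c1 f1 g1).1.1]/c1.1.
have sF c : gscalar c -> gscalar (FF x c) by exact: endo_gscalar.
have sS w c : gscalar c -> gscalar (S x w c) by move=> sc; exact: (Sjet_scalar fr bF).
have e1 : bpair (S x c1.1 c2) (gcov x) = - bpair (Dxi x c1.1) (FF x c2).
  exact: bpair_Sjet_gcov.
have e2 : bpair (S x c1.1 c2) (gvec x) = - bpair (DZ x c1.1) (FF x c2).
  exact: bpair_Sjet_gvec.
have e3 := bpair_Dxi_gcov x c1.1; have e4 := bpair_DZ_gvec x c1.1.
have e5 := bpair_DZ_gcov x c1.1.
have sx := pc_gcov_scalar x; have sz := pc_gvec_scalar x.
have sDx w : gscalar (Dxi x w) by []. have sDz w : gscalar (DZ x w) by [].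
move: (S x) (Dxi x) (DZ x) (gcov x) (gvec x) (FF x) (Z x) sF sS
  e1 e2 e3 e4 e5 sx sz sDx sDz
  => T X D gx gz K z sF sT e1 e2 e3 e4 e5 sx sz sX sD.
have sK3 := sF _ s3.
have sKx : gscalar (K c3 + f3 *: gx) by apply: gscalarD => //; exact: gscalarZ.
have sKz : gscalar (K c3 + f3 *: gx - g3 *: gz).
  by apply: gscalarD => //; apply/gscalarN/gscalarZ.
have sT1 := sT c1.1 _ s2.
rewrite !(bpairC c2) !(bpairDl _ _ s3) !(bpairDl _ _ sKz) !(bpairDl _ _ s2).
rewrite !(bpairNl _ s3) !(bpairNl _ sKz) !(bpairZl _ _ s3) !(bpairZl _ _ sKz).
rewrite !(bpairZl _ _ s2) !(bpairDl _ _ s3) !(bpairZl _ _ s3).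
rewrite !(bpairDr _ _ sT1) !(bpairDr _ _ (sX _)) !(bpairDr _ _ (sD _)).
rewrite !(bpairNr _ sT1) !(bpairNr _ (sX _)) !(bpairNr _ (sD _)).
rewrite !(bpairZr _ _ sT1) !(bpairZr _ _ (sX _)) !(bpairZr _ _ (sD _)).
rewrite e1 e2 e3 e4 e5.
by ring.
Qed.

(** The value when all d/dt- and dt-components vanish. The subtracted terms account for [line_endo]
    leaving the part tangent to M. *)
Definition torsion_base x c1 c2 c3 :=
  torsion FF x c1 c2 c3 -
  (bpair (DZ x c1.1) c2 * bpair c3 (gcov x) +
   bpair (Dxi x c1.1) c2 * bpair c3 (gvec x) +
   (bpair (DZ x c2.1) c3 * bpair c1 (gcov x) +
   bpair (Dxi x c2.1) c3 * bpair c1 (gvec x)) +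
   (bpair (DZ x c3.1) c1 * bpair c2 (gcov x) +
   bpair (Dxi x c3.1) c1 * bpair c2 (gvec x))).

(** The coefficient of a d/dt-component: -(d xi(FF c2, c3) + d xi(c2, FF c3)), where d xi sees
    vector parts only. *)
Definition torsion_ddt x c2 c3 :=
  bpair (Dxi x c3.1) (FF x c2) - bpair (Dxi x (FF x c2).1) c3 -
  bpair (Dxi x c2.1) (FF x c3) + bpair (Dxi x (FF x c3).1) c2.

(** The coefficient of a dt-component: up to sign, the Lie derivative of [FF] along Z applied to
    [c2] and paired with [c3]. *)
Definition torsion_dt x c2 c3 :=
  bpair (DZ x (FF x c2).1) c3 - bpair (S x (Z x) c2) c3 +
  bpair (DZ x c2.1) (FF x c3) - bpair (DZ x (FF x c3).1) c2 -
  bpair (DZ x c3.1) (FF x c2).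

(** The coefficient of the antisymmetrized products f_i g_j: the 1-form i_Z d xi, which is L_Z xi
    since xi(Z) = 1. *)
Definition torsion_mixed x c := bpair (Dxi x (Z x)) c - bpair (Dxi x c.1) (gvec x).

Lemma line_torsion x t c1 f1 g1 c2 f2 g2 c3 f3 g3 :
  gscalar c1 -> gscalar c2 -> gscalar c3 ->
  torsion (N := times_line M) (line_endo FF Z xi) (x, t)
    (lc c1 f1 g1) (lc c2 f2 g2) (lc c3 f3 g3) =
  torsion_base x c1 c2 c3 +
  (f1 * torsion_ddt x c2 c3 + f2 * torsion_ddt x c3 c1 + f3 * torsion_ddt x c1 c2) +
  (g1 * torsion_dt x c2 c3 + g2 * torsion_dt x c3 c1 + g3 * torsion_dt x c1 c2) +
  ((f1 * g2 - f2 * g1) * torsion_mixed x c3 + (f2 * g3 - f3 * g2) * torsion_mixed x c1 +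
   (f3 * g1 - f1 * g3) * torsion_mixed x c2).
Proof.
move=> s1 s2 s3; rewrite /torsion !line_torsion1 //.
rewrite /torsion_base /torsion /torsion1 /torsion_ddt /torsion_dt /torsion_mixed.
move: (S x) (Dxi x) (DZ x) (gcov x) (gvec x) (FF x) (Z x) => T X D gx gz K z.
by ring.
Qed.

End Paracontact.

(** Endomorphisms are only meaningful on linear elements. Agreement there passes to derivatives
    because [tau p y c] stays linear near [p]. *)
Lemma torsion_eq (R : realType) (E : normedModType R) (N : smooth_manifold E)
    (J J' : gendo N) p c1 c2 c3 :
  (forall q c, gscalar c -> J q c = J' q c) ->
  gscalar c1 -> gscalar c2 -> gscalar c3 ->
  torsion J p c1 c2 c3 = torsion J' p c1 c2 c3.
Proof.
move=> JJ s1 s2 s3.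
have SE w c : gscalar c -> Sjet J p w c = Sjet J' p w c.
  move=> sc; apply: jet_eq; apply: filterS (near_dom_self p) => y yp.
  by apply: JJ; exact: tau_scalar.
rewrite /torsion /torsion1 -(JJ p c1 s1) -(JJ p c2 s2) -(JJ p c3 s3).
by rewrite !(SE _ c1 s1) !(SE _ c2 s2) !(SE _ c3 s3).
Qed.

(* The coefficients of [line_torsion], with scalars for the tensor expressions. *)
Lemma line_torsion_coefs (R : realType) (T m a1 a2 a3 b1 b2 b3 d1 d2 d3 : R)
    (f1 g1 f2 g2 f3 g3 : R) :
  T = m + (f1 * a1 + f2 * a2 + f3 * a3) + (g1 * b1 + g2 * b2 + g3 * b3) +
    ((f1 * g2 - f2 * g1) * d3 + (f2 * g3 - f3 * g2) * d1 +
     (f3 * g1 - f1 * g3) * d2) ->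
  [/\ m = 0, a1 = 0, a2 = 0, a3 = 0 & b1 = 0] ->
  [/\ b2 = 0, b3 = 0, d1 = 0, d2 = 0 & d3 = 0] ->
  T = 0.
Proof. by move=> -> [-> -> -> -> ->] [-> -> -> -> ->]; rewrite !mulr0 !addr0. Qed.

(** This lemma and the next three evaluate the polynomial at components 0 and 1, so that one
    coefficient at a time is isolated; the hypotheses have the shape that instantiating
    [line_torsion] produces. *)
Lemma line_torsion_f (R : realType) (T m a1 a2 a3 b1 b2 b3 d1 d2 d3 : R) :
  T = m + (1 * a1 + 0 * a2 + 0 * a3) + (0 * b1 + 0 * b2 + 0 * b3) +
    ((1 * 0 - 0 * 0) * d3 + (0 * 0 - 0 * 0) * d1 + (0 * 0 - 1 * 0) * d2) ->
  T = 0 -> m = 0 -> a1 = 0.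
Proof. by move=> + T0 m0; rewrite T0 m0 => H; lra. Qed.

Lemma line_torsion_0 (R : realType) (T m a1 a2 a3 b1 b2 b3 d1 d2 d3 : R) :
  T = m + (0 * a1 + 0 * a2 + 0 * a3) + (0 * b1 + 0 * b2 + 0 * b3) +
    ((0 * 0 - 0 * 0) * d3 + (0 * 0 - 0 * 0) * d1 + (0 * 0 - 0 * 0) * d2) ->
  T = 0 -> m = 0.
Proof. by move=> + T0; rewrite T0 => H; lra. Qed.

Lemma line_torsion_g (R : realType) (T m a1 a2 a3 b1 b2 b3 d1 d2 d3 : R) :
  T = m + (0 * a1 + 0 * a2 + 0 * a3) + (1 * b1 + 0 * b2 + 0 * b3) +
    ((0 * 0 - 0 * 1) * d3 + (0 * 0 - 0 * 0) * d1 + (0 * 1 - 0 * 0) * d2) ->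
  T = 0 -> m = 0 -> b1 = 0.
Proof. by move=> + T0 m0; rewrite T0 m0 => H; lra. Qed.

(** The choice f1 = g2 = 1 makes f1 g2 the only nonzero product. *)
Lemma line_torsion_fg (R : realType) (T m a1 a2 a3 b1 b2 b3 d1 d2 d3 : R) :
  T = m + (1 * a1 + 0 * a2 + 0 * a3) + (0 * b1 + 1 * b2 + 0 * b3) +
    ((1 * 1 - 0 * 0) * d3 + (0 * 0 - 0 * 1) * d1 + (0 * 0 - 1 * 0) * d2) ->
  T = 0 -> m = 0 -> a1 = 0 -> b2 = 0 -> d3 = 0.
Proof. by move=> + T0 m0 a0 b0; rewrite T0 m0 a0 b0 => H; lra. Qed.

(** * Normality as the vanishing of four tensors on M *)

Section Normality.
Context {R : realType} {E : normedModType R} (fr : frame E).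
Variables (M : smooth_manifold E) (FF : gendo M) (Z : vfield M) (xi : form1 M).
Hypothesis HFF : gen_almost_paracontact FF Z xi.
Implicit Types (x y p : M) (t s : R) (w : E) (c : E * (E -> R)).

Let J := line_endo FF Z xi.
Let bF := pc_bundle HFF.
Let bJ : bundle_endo J.
Proof. exact: (line_endo_bundle fr bF (pc_Z HFF) (pc_xi HFF)). Qed.
Let kJ : gskew J.
Proof. exact: (line_endo_skew Z xi (pc_skew HFF)). Qed.
Let JJ : forall (q : times_line M) u, gscalar u -> J q (J q u) = u.
Proof.
move=> q u su.
exact: (line_endo_sqr bF (pc_xi HFF) (pc_skew HFF) (pc_xiZ HFF) (pc_FFxi HFF)
  (pc_FFZ HFF) (pc_FF2 HFF) q su).
Qed.

Let lc0E (v : E * R) : (v, 0 : E * R -> R) = lc (v.1, 0) v.2 0.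
Proof.
case: v => v r; congr (_, _); apply/funext => u.
by rewrite -[RHS]/(0 + 0 * u.2) mul0r addr0.
Qed.

Let lc_covE (a : E * R -> R) : scalar a ->
  (0, a) = lc (0, fun v => a (v, 0)) 0 (a (0, 1)).
Proof. by move=> sa; rewrite [LHS](@lcE R E (0, a)). Qed.

Let J_vec (q : M * R) (v : E * R) : J q (v, 0) =
  lc (FF q.1 (v.1, 0) + v.2 *: gcov xi q.1 - 0 *: gvec Z q.1) 0 (- xi q.1 v.1).
Proof.
rewrite lc0E /J line_endo_lc; last exact: gscalar_vec.
by rewrite bpair_gvec bpair_gcov //; exact: gscalar_vec.
Qed.

Lemma line_endo_adapted : M_adapted J.
Proof.
split=> [//|q k|q k].
  rewrite J_vec (endo0 bF) add0r; split.
    by congr (_, _); rewrite /= scaler0 scale0r subr0.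
  have x0 : xi q.1 0 = 0 := scalar0 (pc_gcov_scalar HFF q.1).
  rewrite -[LHS]/((k * xi q.1 0 - 0 * 0) + (- xi q.1 0) * 1).
  by rewrite x0 !mulr0 subrr oppr0 mul0r addr0.
have -> : (0, fun w : E * R => k * w.2) = lc 0 0 k.
  by congr (_, _); apply/funext => w; rewrite -[RHS]/(0 + k * w.2) add0r.
rewrite /J line_endo_lc; last exact: gscalar0.
have b0 c : gscalar c -> bpair 0 c = 0.
  by move=> sc; rewrite /bpair /= (scalar0 sc) add0r.
rewrite !b0; [|exact: (pc_gcov_scalar HFF)|exact: gscalar_vec].
rewrite (endo0 bF) scale0r addr0 add0r; split=> //.
by apply/funext => v; rewrite /= scaler0 !oppr0 mul0r addr0.
Qed.

Lemma line_endo_corresponding : corresponding_tensors FF Z xi J.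
Proof.
split=> [q v|q a b sa sb|q v w].
- rewrite /tens_end J_vec; congr (_, _).
  by rewrite /= scaler0 scale0r subr0 addr0.
- rewrite /tens_bivector /tens_sharp lc_covE // /J line_endo_lc; last first.
    exact: (@lc_part_scalar R E (0, a)).
  rewrite bpair_gvec scale0r addr0.
  have -> : (lc (FF q.1 (0, fun v => a (v, 0)) - a (0, 1) *: gvec Z q.1)
      (a (Z q.1, 0)) (- bpair (0, fun v => a (v, 0)) (gcov xi q.1))).1 =
      ((FF q.1 (0, fun v => a (v, 0))).1, 0) +
      (a (Z q.1, 0) *: (0, 1) - a (0, 1) *: (Z q.1, 0)).
    congr (_, _); first by rewrite /= scaler0 add0r.
    by rewrite /= scaler0 subr0 add0r; exact/esym/mulr1.
  by rewrite (scalarD _ _ sb) (scalarB _ _ sb) !(scalar_scaler _ _ sb).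
- rewrite /tens_form2 /tens_flat J_vec scale0r subr0.
  rewrite -[LHS]/((FF q.1 (v.1, 0)).2 w.1 + v.2 * xi q.1 w.1 + - xi q.1 v.1 * w.2).
  by ring.
Qed.

(** The tensors a and theta give the image of vectors, pi gives the vector part of the image of
    covectors, and skewness determines the last block as minus the dual of a. *)
Lemma corresponding_unique (J' : gendo (times_line M)) :
  bundle_endo J' -> gskew J' -> corresponding_tensors FF Z xi J' ->
  forall (q : times_line M) u, gscalar u -> J' q u = J q u.
Proof.
move=> bJ' kJ' [C1 C2 C3] q u su; have [D1 D2 D3] := line_endo_corresponding.
have vecE v : J' q (v, 0) = J q (v, 0).
  rewrite [LHS]surjective_pairing [RHS]surjective_pairing; congr (_, _).
    by have := C1 q v; rewrite -D1.
  by apply/funext => w; have := C3 q v w; rewrite -D3.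
have covE a : scalar a -> J' q (0, a) = J q (0, a).
  move=> sa; have sa' : gscalar (0 : E * R, a) := sa.
  rewrite [LHS]surjective_pairing [RHS]surjective_pairing; congr (_, _).
    apply: (frame_eq (fr := line_frame fr)) => i.
    have sf := fcoord_scalar (line_frame fr) i.
    by have := C2 q a _ sa sf; rewrite -D2.
  apply/funext => w.
  (* Skewness transfers the unknown block to the image of the vector [w], where the two
     endomorphisms already agree. *)
  have e1 := bpair_endo q kJ' sa' (gscalar_vec w).
  have e2 := bpair_endo q kJ sa' (gscalar_vec w).
  move: e1; rewrite vecE -e2 /bpair.
  by rewrite !add0r.
have -> : u = (u.1, 0) + (0, u.2).
  by case: u {su} => v a; congr (_, _); rewrite /= ?addr0 ?add0r.
have s0 : gscalar (u.1, 0 : E * R -> R) by exact: gscalar_vec.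
by rewrite (endoD bJ') // (endoD bJ) // vecE covE.
Qed.

(** Uniqueness removes the existential quantifier from normality: every admissible J has the torsion
    of [line_endo]. *)
Lemma normal_integrable :
  normal_paracontact FF Z xi <-> integrable_paracomplex J.
Proof.
have fl := line_frame fr.
split=> [[J' [[bJ' kJ' JJ' _] _ cJ' iJ']]|iJ].
  have JE := corresponding_unique bJ' kJ' cJ'.
  apply/(integrable_torsion fl bJ kJ JJ) => p c1 c2 c3 s1 s2 s3.
  rewrite -(torsion_eq p JE s1 s2 s3).
  by move/(integrable_torsion fl bJ' kJ' JJ'): iJ'; apply.
exists J; split=> //; last exact: line_endo_corresponding.
  split=> //; have [x _] := carrier_nonempty M.
  (* The witness for J <> I is d/dt, whose image xi has no d/dt-component. *)
  exists (x, 0), (lc 0 1 0); split; first exact: (lc_scalar _ _ (@gscalar0 R E)).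
  rewrite /J line_endo_lc; last exact: gscalar0.
  move=> /(congr1 (fun u => u.1.2)) /=; rewrite bpair_gvec /=.
  by move/eqP; rewrite eq_sym oner_eq0.
exact: line_endo_adapted.
Qed.

Lemma normal_paracontactP : normal_paracontact FF Z xi <->
  [/\ forall x c1 c2 c3, gscalar c1 -> gscalar c2 -> gscalar c3 ->
        torsion_base FF Z xi x c1 c2 c3 = 0,
      forall x c1 c2, gscalar c1 -> gscalar c2 -> torsion_ddt FF xi x c1 c2 = 0,
      forall x c1 c2, gscalar c1 -> gscalar c2 -> torsion_dt FF Z x c1 c2 = 0 &
      forall x c, gscalar c -> torsion_mixed Z xi x c = 0].
Proof.
have fl := line_frame fr.
rewrite normal_integrable (integrable_torsion fl bJ kJ JJ).
have s0 := @gscalar0 R E.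
split=> [T0|[M0 X0 Z0 L0] [x t] u v w su sv sw]; last first.
  have su' := lc_part_scalar su; have sv' := lc_part_scalar sv.
  have sw' := lc_part_scalar sw.
  rewrite (lcE su) (lcE sv) (lcE sw).
  apply: (line_torsion_coefs (line_torsion fr HFF x t _ _ _ _ _ _ su' sv' sw')).
    by split; [exact: M0|exact: X0|exact: X0|exact: X0|exact: Z0].
  by split; [exact: Z0|exact: Z0|exact: L0|exact: L0|exact: L0].
have T0' x c1 f1 g1 c2 f2 g2 c3 f3 g3 :
    gscalar c1 -> gscalar c2 -> gscalar c3 ->
    torsion J (x, 0) (lc c1 f1 g1) (lc c2 f2 g2) (lc c3 f3 g3) = 0.
  by move=> s1 s2 s3; apply: T0; exact: lc_scalar.
have M0 x c1 c2 c3 : gscalar c1 -> gscalar c2 -> gscalar c3 ->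
    torsion_base FF Z xi x c1 c2 c3 = 0.
  move=> s1 s2 s3.
  exact: (line_torsion_0 (line_torsion fr HFF x 0 0 0 0 0 0 0 s1 s2 s3)
    (T0' _ _ _ _ _ _ _ _ _ _ s1 s2 s3)).
have X0 x c1 c2 : gscalar c1 -> gscalar c2 -> torsion_ddt FF xi x c1 c2 = 0.
  move=> s1 s2.
  exact: (line_torsion_f (line_torsion fr HFF x 0 1 0 0 0 0 0 s0 s1 s2)
    (T0' _ _ _ _ _ _ _ _ _ _ s0 s1 s2) (M0 _ _ _ _ s0 s1 s2)).
have Z0 x c1 c2 : gscalar c1 -> gscalar c2 -> torsion_dt FF Z x c1 c2 = 0.
  move=> s1 s2.
  exact: (line_torsion_g (line_torsion fr HFF x 0 0 1 0 0 0 0 s0 s1 s2)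
    (T0' _ _ _ _ _ _ _ _ _ _ s0 s1 s2) (M0 _ _ _ _ s0 s1 s2)).
split=> // x c sc.
(* The arguments are d/dt, dt and [c]. *)
exact: (line_torsion_fg (line_torsion fr HFF x 0 1 0 0 1 0 0 s0 s0 sc)
  (T0' _ _ _ _ _ _ _ _ _ _ s0 s0 sc) (M0 _ _ _ _ s0 s0 sc)
  (X0 _ _ _ s0 sc) (Z0 _ _ _ sc s0)).
Qed.

End Normality.

(** * The blocks of the torsion on vectors and covectors *)

Section Blocks.
Context {R : realType} {E : normedModType R} (fr : frame E).
Variables (M : smooth_manifold E) (FF : gendo M) (Z : vfield M) (xi : form1 M).
Hypothesis HFF : gen_almost_paracontact FF Z xi.
Implicit Types (x y p : M) (v w : E) (c : E * (E -> R)) (a b : E -> R).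

Local Notation mt := (torsion_base FF Z xi).
Local Notation cx := (torsion_ddt FF xi).
Local Notation czt := (torsion_dt FF Z).
Local Notation cl := (torsion_mixed Z xi).
Let bF := pc_bundle HFF.
Let sF x c : gscalar c -> gscalar (FF x c) := @endo_gscalar _ _ _ _ bF x c.
Let sS x w c : gscalar c -> gscalar (Sjet FF x w c) := Sjet_scalar fr bF x w (c := c).
Let sX x w : gscalar (Dxi xi x w) := Dxi_scalar fr HFF x w.
Let sD x w : gscalar (DZ Z x w) := DZ_scalar fr HFF x w.

Lemma gsplit c : c = (c.1, 0) + (0, c.2).
Proof. by case: c => v a; congr (_, _); rewrite /= ?addr0 ?add0r. Qed.

Lemma SjetDl x w w' c : gscalar c ->
  Sjet FF x (w + w') c = Sjet FF x w c + Sjet FF x w' c.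
Proof. by move=> sc; have := SjetPl fr bF x 1 w w' sc; rewrite !scale1r. Qed.

Lemma DZD x w w' : DZ Z x (w + w') = DZ Z x w + DZ Z x w'.
Proof.
by have := jetP 1 w w' (pc_gdiff_gvec fr HFF x); rewrite !scale1r.
Qed.

Lemma DxiD x w w' : Dxi xi x (w + w') = Dxi xi x w + Dxi xi x w'.
Proof.
by have := jetP 1 w w' (pc_gdiff_gcov fr HFF x); rewrite !scale1r.
Qed.

Lemma additive0 (V W : zmodType) (f : V -> W) :
  (forall u v : V, f (u + v) = f u + f v) -> f 0 = 0.
Proof. by move=> fD; apply: (@addrI _ (f 0)); rewrite -fD !addr0. Qed.

Lemma addr_rot3 (V : zmodType) (u v w : V) : u + v + w = v + w + u.
Proof. by rewrite -addrA addrC. Qed.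

Lemma DZ0 x : DZ Z x 0 = 0. Proof. exact: (additive0 (DZD x)). Qed.
Lemma Dxi0 x : Dxi xi x 0 = 0. Proof. exact: (additive0 (DxiD x)). Qed.
Lemma Sjet0l x c : gscalar c -> Sjet FF x 0 c = 0.
Proof.
move=> sc; have := SjetDl x 0 0 sc; rewrite addr0 => /esym/eqP.
by rewrite -[X in _ == X]addr0 (inj_eq (addrI _)) => /eqP.
Qed.

Lemma bpair0l c : gscalar c -> bpair 0 c = 0.
Proof. by move=> sc; rewrite /bpair /= (scalar0 sc) add0r. Qed.

Lemma bpair0r c : gscalar c -> bpair c 0 = 0.
Proof. by move=> sc; rewrite bpairC bpair0l. Qed.

Lemma torsion_base_cyc x c1 c2 c3 : mt x c1 c2 c3 = mt x c2 c3 c1.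
Proof.
pose E4 (d1 d2 d3 : E * (E -> R)) := bpair (DZ Z x d1.1) d2 * bpair d3 (gcov xi x) +
  bpair (Dxi xi x d1.1) d2 * bpair d3 (gvec Z x).
have e1 := addr_rot3 (torsion1 FF x c1 c2 c3) (torsion1 FF x c2 c3 c1)
  (torsion1 FF x c3 c1 c2).
have e2 := addr_rot3 (E4 c1 c2 c3) (E4 c2 c3 c1) (E4 c3 c1 c2).
have e3 := congr2 (fun u v : R => u - v) e1 e2.
exact e3.
Qed.

(** With cyclic invariance, additivity in one slot gives it in all three, which suffices to split
    arguments into vector and covector parts. *)
Lemma torsion_base_Dl x c c' c2 c3 :
  gscalar c -> gscalar c' -> gscalar c2 -> gscalar c3 ->
  mt x (c + c') c2 c3 = mt x c c2 c3 + mt x c' c2 c3.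
Proof.
move=> sc sc' s2 s3; rewrite /torsion_base /torsion /torsion1 (endoD bF) //.
have TDl := SjetDl x; have TDr w d d' : gscalar d -> gscalar d' ->
  Sjet FF x w (d + d') = Sjet FF x w d + Sjet FF x w d' by exact: (SjetDr fr bF).
have XD := DxiD x; have DD := DZD x.
have := sF x; have := sS x; have := sX x; have := sD x.
have := pc_gcov_scalar HFF x; have := pc_gvec_scalar Z x.
move: (Sjet FF x) (Dxi xi x) (DZ Z x) (gcov xi x) (gvec Z x) (FF x) TDl TDr XD DD
  => T X D gx gz K TDl TDr XD DD tz tx tD tX tT tK.
rewrite -[(K c + K c').1]/((K c).1 + (K c').1) -[(c + c').1]/(c.1 + c'.1).
rewrite (TDl (K c).1 _ _ s2) (TDl c.1 _ _ s2) (TDr _ _ _ sc sc') (TDr c3.1 _ _ sc sc').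
rewrite XD DD.
have s3K := tK _ s3; have s2K := tK _ s2.
rewrite !(bpairDl _ _ s3) !(bpairDl _ _ s3K) !(bpairDl _ _ s2) !(bpairDl _ _ s2K).
rewrite !(bpairDl _ _ tx) !(bpairDl _ _ tz) !(bpairDr _ _ (tT _ _ s3)).
rewrite !(bpairDr _ _ (tX _)) !(bpairDr _ _ (tD _)).
by ring.
Qed.

(** Eight types of arguments fall into four orbits under cyclic rotation, one representative of each
    being assumed to vanish. *)
Lemma torsion_base_blocks x :
  (forall a b d, scalar a -> scalar b -> scalar d -> mt x (0, a) (0, b) (0, d) = 0) ->
  (forall a b v, scalar a -> scalar b -> mt x (0, a) (0, b) (v, 0) = 0) ->
  (forall v w a, scalar a -> mt x (v, 0) (w, 0) (0, a) = 0) ->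
  (forall u v w, mt x (u, 0) (v, 0) (w, 0) = 0) ->
  forall c1 c2 c3, gscalar c1 -> gscalar c2 -> gscalar c3 -> mt x c1 c2 c3 = 0.
Proof.
move=> M1 M2 M3 M4 c1 c2 c3 s1 s2 s3.
have sv v : gscalar (v, 0 : E -> R) by exact: gscalar_vec.
have sc c : gscalar c -> gscalar (0 : E, c.2) by [].
have split1 c d e : gscalar c -> gscalar d -> gscalar e ->
    mt x c d e = mt x (c.1, 0) d e + mt x (0, c.2) d e.
  by move=> s sd se; rewrite {1}(gsplit c); apply: torsion_base_Dl => //; exact: sc.
have split2 c d e : gscalar c -> gscalar d -> gscalar e ->
    mt x d c e = mt x d (c.1, 0) e + mt x d (0, c.2) e.
  by move=> s sd se; rewrite !(torsion_base_cyc x d); exact: split1.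
have split3 c d e : gscalar c -> gscalar d -> gscalar e ->
    mt x d e c = mt x d e (c.1, 0) + mt x d e (0, c.2).
  by move=> s sd se; rewrite -!(torsion_base_cyc x _ d e); exact: split1.
have t1 := sc _ s1; have t2 := sc _ s2; have t3 := sc _ s3.
rewrite (split1 _ _ _ s1 s2 s3) (split2 _ _ _ s2 (sv _) s3) (split2 _ _ _ s2 t1 s3).
rewrite (split3 _ _ _ s3 (sv c1.1) (sv c2.1)) (split3 _ _ _ s3 (sv c1.1) t2).
rewrite (split3 _ _ _ s3 t1 (sv c2.1)) (split3 _ _ _ s3 t1 t2).
have M3' v a w : scalar a -> mt x (v, 0) (0, a) (w, 0) = 0.
  by move=> sa; rewrite -torsion_base_cyc M3.
have M3'' a v w : scalar a -> mt x (0, a) (v, 0) (w, 0) = 0.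
  by move=> sa; rewrite torsion_base_cyc M3.
have M2' a v b : scalar a -> scalar b -> mt x (0, a) (v, 0) (0, b) = 0.
  by move=> sa sb; rewrite -torsion_base_cyc M2.
have M2'' v a b : scalar a -> scalar b -> mt x (v, 0) (0, a) (0, b) = 0.
  by move=> sa sb; rewrite torsion_base_cyc M2.
rewrite M1 // M2 // M2' // M2'' // M3 // M3' // M3'' // M4 //.
by rewrite !addr0.
Qed.

Lemma torsion_ddt_anti x c1 c2 : cx x c1 c2 = - cx x c2 c1.
Proof.
have aux (a b d e : R) : a - b - d + e = - (d - e - a + b) by ring.
exact: aux.
Qed.

Lemma torsion_ddt_Dl x c c' c2 : gscalar c -> gscalar c' -> gscalar c2 ->
  cx x (c + c') c2 = cx x c c2 + cx x c' c2.
Proof.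
move=> sc sc' s2; rewrite /torsion_ddt (endoD bF) //.
have XD := DxiD x; have := sF x; have := sX x.
move: (Dxi xi x) (FF x) XD => X K XD tX tK.
rewrite -[(K c + K c').1]/((K c).1 + (K c').1) -[(c + c').1]/(c.1 + c'.1).
have s2K := tK _ s2.
rewrite !XD !(bpairDl _ _ s2) !(bpairDl _ _ s2K) !(bpairDr _ _ (tX _)).
by ring.
Qed.

(** Antisymmetry identifies the two mixed blocks. *)
Lemma torsion_ddt_blocks x :
  (forall v w, cx x (v, 0) (w, 0) = 0) ->
  (forall a v, scalar a -> cx x (0, a) (v, 0) = 0) ->
  forall c1 c2, gscalar c1 -> gscalar c2 -> cx x c1 c2 = 0.
Proof.
move=> X1 X2 c1 c2 s1 s2.
have sv v : gscalar (v, 0 : E -> R) by exact: gscalar_vec.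
(* Derivatives of xi are covectors, which pair to zero with covectors, and the directions taken from
   [(0, a)] and [(0, b)] are zero. *)
have X3 a b : scalar a -> scalar b -> cx x (0, a) (0, b) = 0.
  move=> sa sb; rewrite /torsion_ddt [(0, a).1]/= [(0, b).1]/= Dxi0.
  rewrite !bpair0l; [|exact: sF..].
  have D0 w a' : scalar a' -> bpair (Dxi xi x w) (0, a') = 0.
    by move=> sa'; apply: (bpair_cov (sX x w)) => //; exact: Dxi1.
  by rewrite !D0 // !subr0 addr0.
have split1 c d : gscalar c -> gscalar d ->
    cx x c d = cx x (c.1, 0) d + cx x (0, c.2) d.
  by move=> s sd; rewrite {1}(gsplit c); exact: torsion_ddt_Dl.
have split2 c d : gscalar c -> gscalar d ->
    cx x d c = cx x d (c.1, 0) + cx x d (0, c.2).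
  by move=> s sd; rewrite !(torsion_ddt_anti x d) (split1 c d s sd) opprD.
have t1 : gscalar (0 : E, c1.2) := s1.
rewrite (split1 _ _ s1 s2) (split2 _ _ s2 (sv c1.1)) (split2 _ _ s2 t1).
have X2' v a : scalar a -> cx x (v, 0) (0, a) = 0.
  by move=> sa; rewrite torsion_ddt_anti X2 // oppr0.
by rewrite X1 X2 // X2' // X3 // !addr0.
Qed.

Lemma torsion_dt_anti x c1 c2 : gscalar c1 -> gscalar c2 -> czt x c1 c2 = - czt x c2 c1.
Proof.
move=> s1 s2.
have aux (a s s' b d e : R) : s = - s' ->
    a - s + b - d - e = - (d - s' + e - a - b) by move=> ->; ring.
apply: aux; rewrite (Sjet_skew fr bF _ _ (pc_skew HFF) s1 s2).
by rewrite (bpairC c1).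
Qed.

Lemma torsion_dt_Dl x c c' c2 : gscalar c -> gscalar c' -> gscalar c2 ->
  czt x (c + c') c2 = czt x c c2 + czt x c' c2.
Proof.
move=> sc sc' s2; rewrite /torsion_dt (endoD bF) // (SjetDr fr bF) //.
have DD := DZD x; have := sF x; have := sD x.
move: (Sjet FF x) (DZ Z x) (FF x) DD => T D K DD tD tK.
rewrite -[(K c + K c').1]/((K c).1 + (K c').1) -[(c + c').1]/(c.1 + c'.1).
have s2K := tK _ s2.
rewrite !DD !(bpairDl _ _ s2) !(bpairDl _ _ s2K) !(bpairDr _ _ (tD _)).
by ring.
Qed.

Lemma torsion_dt_blocks x :
  (forall a b, scalar a -> scalar b -> czt x (0, a) (0, b) = 0) ->
  (forall v a, scalar a -> czt x (v, 0) (0, a) = 0) ->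
  (forall v w, czt x (v, 0) (w, 0) = 0) ->
  forall c1 c2, gscalar c1 -> gscalar c2 -> czt x c1 c2 = 0.
Proof.
move=> X1 X2 X3 c1 c2 s1 s2.
have sv v : gscalar (v, 0 : E -> R) by exact: gscalar_vec.
have split1 c d : gscalar c -> gscalar d ->
    czt x c d = czt x (c.1, 0) d + czt x (0, c.2) d.
  by move=> s sd; rewrite {1}(gsplit c); exact: torsion_dt_Dl.
have t1 : gscalar (0 : E, c1.2) := s1.
have split2 c d : gscalar c -> gscalar d ->
    czt x d c = czt x d (c.1, 0) + czt x d (0, c.2).
  move=> s sd; have s' : gscalar (0 : E, c.2) := s.
  by rewrite (torsion_dt_anti x sd s) (split1 c d s sd) opprD -!torsion_dt_anti.
rewrite (split1 _ _ s1 s2) (split2 _ _ s2 (sv c1.1)) (split2 _ _ s2 t1).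
have X2' v a : scalar a -> czt x (0, a) (v, 0) = 0.
  by move=> sa; rewrite torsion_dt_anti // X2 // oppr0.
by rewrite X1 // X2 // X2' // X3 // !addr0.
Qed.

(** A covector adds no direction, and it pairs to zero with the derivative of xi. *)
Lemma torsion_mixed_blocks x : (forall v, cl x (v, 0) = 0) ->
  forall c, gscalar c -> cl x c = 0.
Proof.
move=> X1 c sc; have := X1 c.1; rewrite /torsion_mixed.
have -> : bpair (Dxi xi x (Z x)) c = bpair (Dxi xi x (Z x)) (c.1, 0); last by [].
rewrite {1}(gsplit c) (bpairDr _ _ (sX _ _)) [X in _ + X](_ : _ = 0) ?addr0 //.
by apply: (bpair_cov (sX _ _)) => //; exact: Dxi1.
Qed.

End Blocks.

(** * Explicit formulas for the blocks *)

Section BlockFormulas.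
Context {R : realType} {E : normedModType R} (fr : frame E).
Variables (M : smooth_manifold E) (FF : gendo M) (Z : vfield M) (xi : form1 M).
Hypothesis HFF : gen_almost_paracontact FF Z xi.
Implicit Types (x y p : M) (v w : E) (c : E * (E -> R)) (a b d : E -> R)
  (X Y W : vfield M).

Local Notation mt := (torsion_base FF Z xi).
Local Notation cx := (torsion_ddt FF xi).
Local Notation czt := (torsion_dt FF Z).
Local Notation S := (Sjet FF).
Local Notation vc v := (v, 0 : E -> R).
Local Notation cv a := (0 : E, a).
Let bF := pc_bundle HFF.
Let sF x c : gscalar c -> gscalar (FF x c) := @endo_gscalar _ _ _ _ bF x c.
Let sX x w : gscalar (Dxi xi x w) := Dxi_scalar fr HFF x w.
Let sD x w : gscalar (DZ Z x w) := DZ_scalar fr HFF x w.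
Let sv v : gscalar (vc v) := @gscalar_vec R E v.

Lemma bpair_vecr c v : bpair c (vc v) = c.2 v.
Proof. exact: add0r. Qed.

Lemma bpair_vecl c v : bpair (vc v) c = c.2 v.
Proof. exact: addr0. Qed.

Lemma bpair_covr c a : gscalar c -> bpair c (cv a) = a c.1.
Proof. by move=> sc; rewrite /bpair /= (scalar0 sc) addr0. Qed.

Lemma bpair_covl c a : gscalar c -> bpair (cv a) c = a c.1.
Proof. by move=> sc; rewrite bpairC bpair_covr. Qed.

Lemma bpair_vv v w : bpair (vc v) (vc w) = 0.
Proof. by rewrite bpair_vecr. Qed.

Lemma bpair_cc a b : scalar a -> scalar b -> bpair (cv a) (cv b) = 0.
Proof. by move=> sa sb; rewrite bpair_covr //= (scalar0 sb). Qed.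

Lemma DxiE x w : Dxi xi x w = cv (Dxi xi x w).2.
Proof. by rewrite [LHS]surjective_pairing (Dxi1 xi x w). Qed.

Lemma DZE x w : DZ Z x w = vc (DZ Z x w).1.
Proof. by rewrite [LHS]surjective_pairing (DZ2 Z x w). Qed.

Lemma bpair_Dxi_cv x w a : scalar a -> bpair (Dxi xi x w) (cv a) = 0.
Proof. by move=> sa; rewrite DxiE bpair_cc //; exact: sX. Qed.

Lemma bpair_DZ_vc x w v : bpair (DZ Z x w) (vc v) = 0.
Proof. by rewrite DZE bpair_vv. Qed.

Let S0 x c : gscalar c -> S x 0 c = 0. Proof. exact: (Sjet0l fr HFF). Qed.
Let X0 x : Dxi xi x 0 = 0. Proof. exact: (Dxi0 fr HFF). Qed.
Let D0 x : DZ Z x 0 = 0. Proof. exact: (DZ0 fr HFF). Qed.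

(** Replaces the geometric objects by variables and keeps the facts that make terms vanish:
    derivatives in the zero direction, pairings of two vectors and pairings of two covectors. *)
Ltac generalize_jets x :=
  have := S0 x; have := X0 x; have := D0 x; have := sF x;
  have := bpair_Dxi_cv x; have := bpair_DZ_vc x; have := sD x;
  have := (pc_gcov_scalar HFF x : scalar (xi x));
  move: (Z x) (S x) (Dxi xi x) (DZ Z x) (FF x) (xi x)
    => z T X D K k sk tD DV XC tK D00 X00 T00.

(** A covector has zero vector part, so every derivative in the direction of an argument drops out,
    and with it the correction terms. *)
Lemma torsion_base_ccc x a b d : scalar a -> scalar b -> scalar d ->
  mt x (cv a) (cv b) (cv d) = bpair (S x (FF x (cv a)).1 (cv b)) (cv d) +
    bpair (S x (FF x (cv b)).1 (cv d)) (cv a) +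
    bpair (S x (FF x (cv d)).1 (cv a)) (cv b).
Proof.
move=> sa sb sd; rewrite /torsion_base /torsion /torsion1 /gcov /gvec; generalize_jets x.
have s1 : gscalar (cv a) := sa. have s2 : gscalar (cv b) := sb.
have s3 : gscalar (cv d) := sd.
have tK1 := tK _ s1; have tK2 := tK _ s2; have tK3 := tK _ s3.
rewrite [(cv a).1]/= [(cv b).1]/= [(cv d).1]/=.
rewrite !T00 // X00 D00 !bpair0l //.
by ring.
Qed.

Lemma torsion_base_ccv x a b v : scalar a -> scalar b ->
  mt x (cv a) (cv b) (vc v) = bpair (S x (FF x (cv a)).1 (cv b)) (vc v) +
    bpair (S x (FF x (cv b)).1 (vc v)) (cv a) +
    (bpair (S x (FF x (vc v)).1 (cv a)) (cv b) + bpair (S x v (cv a)) (FF x (cv b))).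
Proof.
move=> sa sb; rewrite /torsion_base /torsion /torsion1 /gcov /gvec; generalize_jets x.
have s1 : gscalar (cv a) := sa. have s2 : gscalar (cv b) := sb.
have s3 := sv v.
have tK1 := tK _ s1; have tK2 := tK _ s2; have tK3 := tK _ s3.
rewrite [(cv a).1]/= [(cv b).1]/= [(vc v).1]/=.
rewrite (bpair_cc sb sk) !T00 // X00 D00 !XC // !bpair0l //.
by ring.
Qed.

Lemma torsion_base_vvc x v w a : scalar a ->
  mt x (vc v) (vc w) (cv a) =
    bpair (S x (FF x (vc v)).1 (vc w)) (cv a) + bpair (S x v (vc w)) (FF x (cv a)) +
    (bpair (S x (FF x (vc w)).1 (cv a)) (vc v) + bpair (S x w (cv a)) (FF x (vc v))) +
    bpair (S x (FF x (cv a)).1 (vc v)) (vc w) -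
    (bpair (Dxi xi x v) (vc w) * a (Z x) + a (DZ Z x w).1 * xi x v).
Proof.
move=> sa; rewrite /torsion_base /torsion /torsion1 /gcov /gvec; generalize_jets x.
have s1 := sv v. have s2 := sv w. have s3 : gscalar (cv a) := sa.
have tK1 := tK _ s1; have tK2 := tK _ s2; have tK3 := tK _ s3.
rewrite [(vc v).1]/= [(vc w).1]/= [(cv a).1]/=.
rewrite (T00 _ s1) X00 D00 DV (XC _ _ sa).
rewrite (bpair_covr a (tD w)) (bpair_covr k s1) (bpair_vecr (cv a) z).
rewrite !bpair0l // [(vc v).1]/= [(cv a).2]/=.
by ring.
Qed.

Lemma torsion_base_vvv x u v w :
  mt x (vc u) (vc v) (vc w) =
    bpair (S x (FF x (vc u)).1 (vc v)) (vc w) + bpair (S x u (vc v)) (FF x (vc w)) +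
    (bpair (S x (FF x (vc v)).1 (vc w)) (vc u) + bpair (S x v (vc w)) (FF x (vc u))) +
    (bpair (S x (FF x (vc w)).1 (vc u)) (vc v) + bpair (S x w (vc u)) (FF x (vc v))).
Proof.
rewrite /torsion_base /torsion /torsion1 /gcov /gvec; generalize_jets x.
rewrite [(vc v).1]/= [(vc w).1]/= [(vc u).1]/=.
rewrite !DV !bpair_vv.
by ring.
Qed.

Lemma torsion_ddt_vv x v w : cx x (vc v) (vc w) =
  bpair (Dxi xi x w) (FF x (vc v)) - bpair (Dxi xi x (FF x (vc v)).1) (vc w) -
  bpair (Dxi xi x v) (FF x (vc w)) + bpair (Dxi xi x (FF x (vc w)).1) (vc v).
Proof. by []. Qed.

Lemma torsion_ddt_cv x a v : scalar a -> cx x (cv a) (vc v) =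
  bpair (Dxi xi x v) (FF x (cv a)) - bpair (Dxi xi x (FF x (cv a)).1) (vc v).
Proof.
move=> sa; rewrite /torsion_ddt; generalize_jets x.
have t2 := tK _ (sv v); rewrite [(cv a).1]/= [(vc v).1]/= X00 (XC _ _ sa) (bpair0l t2).
by ring.
Qed.

Lemma torsion_dt_cc x a b : scalar a -> scalar b -> czt x (cv a) (cv b) =
  bpair (DZ Z x (FF x (cv a)).1) (cv b) - bpair (S x (Z x) (cv a)) (cv b) -
  bpair (DZ Z x (FF x (cv b)).1) (cv a).
Proof.
move=> sa sb; rewrite /torsion_dt; generalize_jets x.
have s1 : gscalar (cv a) := sa. have s2 : gscalar (cv b) := sb.
have t1 := tK _ s1; have t2 := tK _ s2.
rewrite [(cv a).1]/= [(cv b).1]/= D00 (bpair0l t1) (bpair0l t2).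
by ring.
Qed.

Lemma torsion_dt_vc x v a : scalar a -> czt x (vc v) (cv a) =
  bpair (DZ Z x (FF x (vc v)).1) (cv a) - bpair (S x (Z x) (vc v)) (cv a) +
  bpair (DZ Z x v) (FF x (cv a)).
Proof.
move=> sa; rewrite /torsion_dt; generalize_jets x.
have t2 := tK _ (sv v).
rewrite [(vc v).1]/= [(cv a).1]/= D00 DV (bpair0l t2).
by ring.
Qed.

Lemma torsion_dt_vv x v w : czt x (vc v) (vc w) =
  bpair (DZ Z x v) (FF x (vc w)) - bpair (S x (Z x) (vc v)) (vc w) -
  bpair (DZ Z x w) (FF x (vc v)).
Proof.
rewrite /torsion_dt; generalize_jets x.
rewrite [(vc v).1]/= [(vc w).1]/= !DV.
by ring.
Qed.

End BlockFormulas.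

(** * Conditions A1 and A2 as blocks of the 3-tensor *)

Section BracketConditions.
Context {R : realType} {E : normedModType R} (fr : frame E).
Variables (M : smooth_manifold E) (FF : gendo M) (Z : vfield M) (xi : form1 M).
Hypothesis HFF : gen_almost_paracontact FF Z xi.
Implicit Types (x y p : M) (v w : E) (c : E * (E -> R)) (a b : form1 M)
  (g : E -> R) (X Y W : vfield M).

Local Notation mt := (torsion_base FF Z xi).
Local Notation S := (Sjet FF).
Local Notation vc v := (v, 0 : E -> R).
Local Notation cv a := (0 : E, a).
Local Notation Fv X := (fun y => tens_end FF y (X y)).
Local Notation Pa a := (fun y => tens_sharp FF y (a y)).
Local Notation Fdual a := (fun y v => a y (tens_end FF y v)).
Let bF := pc_bundle HFF.
Let kF := pc_skew HFF.
Let sF x c : gscalar c -> gscalar (FF x c) := @endo_gscalar _ _ _ _ bF x c.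
Let sS x w c : gscalar c -> gscalar (Sjet FF x w c) := Sjet_scalar fr bF x w (c := c).
Let sv v : gscalar (vc v) := @gscalar_vec R E v.

Lemma jet_vec x X w : jet x (gvec X) w = vc (jetv x X w).
Proof. by congr (_, _); apply/funext => v; exact: tderive_cst. Qed.

Lemma jet_cov x a w : jet x (gcov a) w = cv (jetf x a w).
Proof. by congr (_, _); exact: (congr1 fst (jet0 x w)). Qed.

Lemma vdiff_gdiff x X : vdiff x X -> gdiff x (gvec X).
Proof.
move=> dX; split; first exact: dX.
split; first by apply: nearW => y; exact: (sv 0).
by move=> v; exact: (tdiff_cst (0 : R) x).
Qed.

Lemma fdiff_gdiff x a : fdiff x a -> gdiff x (gcov a).
Proof. by move=> da; split=> //; have [] := @gdiff0 R E M x. Qed.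

Lemma vdiff_F x X : vdiff x X -> vdiff x (Fv X).
Proof. by move=> dX; have [] := gdiff_endo fr bF (vdiff_gdiff dX). Qed.

Lemma vdiff_P x a : fdiff x a -> vdiff x (Pa a).
Proof. by move=> da; have [] := gdiff_endo fr bF (fdiff_gdiff da). Qed.

Lemma jetv_F x X w : vdiff x X ->
  jetv x (Fv X) w = (FF x (vc (jetv x X w)) + S x w (vc (X x))).1.
Proof.
move=> dX; rewrite -jet_vec.
exact: (congr1 fst (jet_endo fr bF w (vdiff_gdiff dX))).
Qed.

Lemma jetv_P x a w : fdiff x a ->
  jetv x (Pa a) w = (FF x (cv (jetf x a w)) + S x w (cv (a x))).1.
Proof.
move=> da; rewrite -jet_cov.
exact: (congr1 fst (jet_endo fr bF w (fdiff_gdiff da))).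
Qed.

Lemma fdiff_scalar x a : fdiff x a -> scalar (a x).
Proof. by case=> sa _; exact: nbhs_singleton sa. Qed.

Let skew x c c' : gscalar c -> gscalar c' ->
  bpair (FF x c) c' = - bpair c (FF x c').
Proof. by move=> sc sc'; exact: bpair_endo. Qed.

(** The derivatives of [a] and [b] along [w] cancel by skewness of P, leaving derivatives along the
    images of P^# and one term in the derivative of P. *)
Lemma bracket_sharpE x a b w : fdiff x a -> fdiff x b ->
  bracket_sharp FF a b x w = jetf x b (FF x (cv (a x))).1 w -
    jetf x a (FF x (cv (b x))).1 w - bpair (S x w (cv (b x))) (cv (a x)).
Proof.
move=> da db; have sa := fdiff_scalar da; have sb := fdiff_scalar db.
have ga : gscalar (cv (a x)) := sa. have gb : gscalar (cv (b x)) := sb.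
have sj : gscalar (cv (jetf x b w)) by exact: jetf_scalar.
have tP : dfun (fun y => tens_bivector FF y (a y) (b y)) x w =
    jetf x b w (FF x (cv (a x))).1 + b x (jetv x (Pa a) w).
  exact: (tderive_pair fr w db (vdiff_P da)).
rewrite /bracket_sharp (lieD_form1E _ w db) (lieD_form1E _ w da) tP.
have -> : a x (jetv x (Pa b) w) =
    - jetf x b w (FF x (cv (a x))).1 + bpair (S x w (cv (b x))) (cv (a x)).
  rewrite (jetv_P w db) -(bpair_covr (a x)); last first.
    by apply: gscalarD; [exact: sF|exact: sS].
  rewrite (bpairDl _ _ ga) (skew x sj ga) bpair_covl //; exact: sF.
rewrite -[tens_sharp FF x (a x)]/(FF x (cv (a x))).1.
rewrite -[tens_sharp FF x (b x)]/(FF x (cv (b x))).1.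
move: (jetf x b _ w) (b x _) (jetf x a _ w) (jetf x b w _) (bpair _ _) => *.
by ring.
Qed.

Lemma bracket_sharp_gvec x a b : fdiff x a -> fdiff x b ->
  cv (bracket_sharp FF a b x) = cv (jetf x b (FF x (cv (a x))).1) -
    cv (jetf x a (FF x (cv (b x))).1) -
    cv (fun w => bpair (S x w (cv (b x))) (cv (a x))).
Proof.
move=> da db; congr (_, _); first by rewrite /= !subr0.
by apply/funext => w; rewrite bracket_sharpE.
Qed.

Lemma Sjet_pair_scalar x c c' : gscalar c -> gscalar c' ->
  scalar (fun w => bpair (S x w c) c').
Proof.
by move=> sc sc' k u v; rewrite (SjetPl fr bF x k u v sc) bpairDl // bpairZl.
Qed.

(** The derivatives of [a] and [b] in the bracket of vector fields are those that P^# produces from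
    the bracket of forms; what is left is the cyclic sum of derivatives of P. *)
Lemma A1_eq x a b g : fdiff x a -> fdiff x b -> scalar g ->
  g (lie_bracket (Pa a) (Pa b) x - tens_sharp FF x (bracket_sharp FF a b x)) =
  mt x (cv (a x)) (cv (b x)) (cv g).
Proof.
move=> da db sg; have sa := fdiff_scalar da; have sb := fdiff_scalar db.
have ga : gscalar (cv (a x)) := sa. have gb : gscalar (cv (b x)) := sb.
have gg : gscalar (cv g) := sg.
rewrite (torsion_base_ccc fr HFF x sa sb sg) lie_bracketE (jetv_P _ da) (jetv_P _ db).
rewrite /tens_sharp (bracket_sharp_gvec da db).
have sja w : gscalar (cv (jetf x a w)) by exact: jetf_scalar.
have sjb w : gscalar (cv (jetf x b w)) by exact: jetf_scalar.
have sQ : gscalar (cv (fun w => bpair (S x w (cv (b x))) (cv (a x)))).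
  exact: Sjet_pair_scalar.
have Sk w c c' : gscalar c -> gscalar c' -> bpair (S x w c) c' = - bpair (S x w c') c.
  by move=> s1 s2; rewrite (Sjet_skew fr bF x w kF s1 s2) bpairC.
have := sF x; have := skew x; have := sS x.
move: (FF x) (S x) sQ Sk (jetf x a) (jetf x b) sja sjb
  => K T sQ Sk ja jb sja sjb tT tk tK.
set Q := cv (fun w => _) in sQ *.
have tKg := tK _ gg; have tKa := tK _ ga; have tKb := tK _ gb.
have tQ : bpair Q (K (cv g)) = bpair (T (K (cv g)).1 (cv (b x))) (cv (a x)).
  by rewrite bpair_covl.
have s1 := sjb (K (cv (a x))).1; have s2 := sja (K (cv (b x))).1.
have t1 := tT (K (cv (a x))).1 _ gb; have t2 := tT (K (cv (b x))).1 _ ga.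
set J1 := cv (jb _) in s1 *; set J2 := cv (ja _) in s2 *.
set T1 := T _ (cv (b x)) in t1 *; set T2 := T _ (cv (a x)) in t2 *.
have sJ : gscalar (J1 - J2 - Q).
  by apply: gscalarD; [apply: gscalarD => //|]; exact: gscalarN.
have sKJ1 := tK _ s1; have sKJ2 := tK _ s2; have sKJ := tK _ sJ.
rewrite -[LHS]/(g ((K J1 + T1) - (K J2 + T2) - K (J1 - J2 - Q)).1).
rewrite -(bpair_covr g); last first.
  apply: gscalarD; last exact: gscalarN.
  by apply: gscalarD; [exact: gscalarD|exact/gscalarN/gscalarD].
rewrite !(bpairBl _ _ gg) !(bpairDl _ _ gg) (tk _ _ s1 gg) (tk _ _ s2 gg) (tk _ _ sJ gg).
rewrite !(bpairBl _ _ tKg) tQ.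
rewrite (Sk _ _ _ gb ga) (Sk _ _ _ gg ga).
rewrite -/T2.
by ring.
Qed.

(** By skewness the lower right block of [FF] is minus the dual of F. *)
Lemma FdualE y a v : scalar (a y) ->
  a y (tens_end FF y v) = - (FF y (cv (a y))).2 v.
Proof.
move=> sa; have ga : gscalar (cv (a y)) := sa.
have := skew y (sv v) ga; rewrite bpair_covr; last exact: sF.
by rewrite bpair_vecl.
Qed.

Lemma tdiff_Fdual x a v : smooth_form1 a ->
  tdiff (fun y => (FF y (cv (a y))).2 (coord_field x v y)) x.
Proof.
move=> Ca; have da := fdiff_gdiff (smooth_fdiff fr x Ca).
by have [_ [_]] := gdiff_endo fr bF da; apply.
Qed.

Lemma fdiff_Fdual x a : smooth_form1 a -> fdiff x (Fdual a).
Proof.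
move=> Ca; have sa y : scalar (a y) by case: Ca => + _; apply.
split=> [|v].
  apply: nearW => y k u v.
  have sy : scalar (FF y (cv (a y))).2 by apply: sF; exact: sa.
  by rewrite !FdualE // sy opprD mulrN.
have := tdiffM (tdiff_cst (-1 : R) x) (tdiff_Fdual x v Ca).
by apply: tdiff_eq; apply: nearW => y; rewrite FdualE // mulN1r.
Qed.

Lemma jetf_Fdual x a w v : smooth_form1 a -> jetf x (Fdual a) w v =
  - (FF x (cv (jetf x a w)) + S x w (cv (a x))).2 v.
Proof.
move=> Ca; have sa y : scalar (a y) by case: Ca => + _; apply.
have da := fdiff_gdiff (smooth_fdiff fr x Ca).
have := congr1 (fun c => c.2 v) (jet_endo fr bF w da).
rewrite jet_cov => <-.
have := tderiveM w (tdiff_cst (-1 : R) x) (tdiff_Fdual x v Ca).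
rewrite tderive_cst mul0r add0r mulN1r => H; apply: etrans _ H.
by apply: tderive_eq; apply: nearW => y; rewrite FdualE // mulN1r.
Qed.

(** By skewness this is the pairing of [c] with the square of [FF] on [c'], and all pairings among
    [c], [c'] and xi vanish. It is F P^# = P^# F^* in paired form. *)
Lemma bpair_FF2_cov x c c' : gscalar c -> gscalar c' -> c.1 = 0 -> c'.1 = 0 ->
  bpair (FF x c) (FF x c') = 0.
Proof.
move=> sc sc' c0 c0'; rewrite skew //; last exact: sF.
have sx := pc_gcov_scalar HFF x.
have sz := pc_gvec_scalar Z x.
rewrite (pc_FF2 HFF) // bpairBr // bpairDr // !bpairZr //.
have -> : bpair c c' = 0 by exact: bpair_cov.
have -> : bpair c' (gcov xi x) = 0 by exact: bpair_cov.
have -> : bpair c (gcov xi x) = 0 by exact: bpair_cov.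
by rewrite mul0r mulr0 addr0 subr0 oppr0.
Qed.

(** The derivatives of the forms cancel by skewness, those of [a] along [v] through
    [bpair_FF2_cov]. *)
Lemma A2_eq x a b v : smooth_form1 a -> smooth_form1 b ->
  lieD_form1 (Pa a) (Fdual b) x v - lieD_form1 (Pa b) (Fdual a) x v +
    dfun (fun y => tens_bivector FF y (b y) (fun v => a y (tens_end FF y v))) x v -
    bracket_sharp FF a b x (tens_end FF x v) =
  - mt x (cv (a x)) (cv (b x)) (vc v).
Proof.
move=> Ca Cb; have da := smooth_fdiff fr x Ca; have db := smooth_fdiff fr x Cb.
have sa := fdiff_scalar da; have sb := fdiff_scalar db.
have ga : gscalar (cv (a x)) := sa. have gb : gscalar (cv (b x)) := sb.
have tP : dfun (fun y => tens_bivector FF y (b y) (fun v => a y (tens_end FF y v))) x v =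
    jetf x (Fdual a) v (FF x (cv (b x))).1 +
    a x (tens_end FF x (jetv x (Pa b) v)).
  exact: (tderive_pair fr v (fdiff_Fdual x Ca) (vdiff_P db)).
rewrite tP (lieD_form1E _ v (fdiff_Fdual x Ca)) (lieD_form1E _ v (fdiff_Fdual x Cb)).
rewrite (bracket_sharpE _ da db) !jetf_Fdual // !FdualE //.
rewrite (jetv_P _ da) (jetv_P _ db) (torsion_base_ccv fr HFF x v sa sb).
rewrite /tens_sharp /tens_end.
have sja w : gscalar (cv (jetf x a w)) by exact: jetf_scalar.
have sjb w : gscalar (cv (jetf x b w)) by exact: jetf_scalar.
have Sk w c c' : gscalar c -> gscalar c' -> bpair (S x w c) c' = - bpair (S x w c') c.
  by move=> s1 s2; rewrite (Sjet_skew fr bF x w kF s1 s2) bpairC.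
have K0 w : bpair (FF x (cv (jetf x a w))) (FF x (cv (b x))) = 0.
  exact: bpair_FF2_cov.
have := sF x; have := skew x; have := sS x.
move: (FF x) (S x) Sk (jetf x a) (jetf x b) sja sjb K0
  => K T Sk ja jb sja sjb K0 tT tk tK.
have tKa := tK _ ga; have tKb := tK _ gb; have tKv := tK _ (sv v).
have eb w : jb w (K (vc v)).1 = - (K (cv (jb w))).2 v.
  by rewrite -(bpair_covr (jb w)) // tk // bpair_vecl.
have ea w : ja w (K (vc v)).1 = - (K (cv (ja w))).2 v.
  by rewrite -(bpair_covr (ja w)) // tk // bpair_vecl.
rewrite eb ea -!bpair_vecr.
have sD w c : gscalar (cv (ja w)) -> gscalar c -> gscalar (K (cv (ja w)) + T w c).
  by move=> s1 s2; apply: gscalarD; [exact: tK|exact: tT].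
rewrite !(bpairDl _ _ (sv v)).
have split1 w c : gscalar (cv (ja w)) -> gscalar c ->
    bpair (K (cv (b x))) (vc (K (cv (ja w)) + T w c).1) +
    bpair (K (cv (ja w)) + T w c) (vc (K (cv (b x))).1) =
    bpair (T w c) (K (cv (b x))).
  move=> s1 s2; rewrite !bpair_vecr.
  rewrite -[LHS]/(bpair (K (cv (ja w)) + T w c) (K (cv (b x)))).
  by rewrite (bpairDl _ _ tKb) K0 add0r.
have sja' := sja v.
rewrite (Sk _ _ _ (sv v) ga) (Sk _ _ _ ga gb).
have := split1 v (cv (a x)) sja' ga => H.
by lra.
Qed.

End BracketConditions.

(** * Exterior derivatives and the Nijenhuis condition of A3 *)

Section NijenhuisCondition.
Context {R : realType} {E : normedModType R} (fr : frame E).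
Variables (M : smooth_manifold E) (FF : gendo M) (Z : vfield M) (xi : form1 M).
Hypothesis HFF : gen_almost_paracontact FF Z xi.
Implicit Types (x y p : M) (v w : E) (c : E * (E -> R)) (a b : form1 M)
  (g : E -> R) (X Y W : vfield M).

Local Notation mt := (torsion_base FF Z xi).
Local Notation S := (Sjet FF).
Local Notation vc v := (v, 0 : E -> R).
Local Notation cv a := (0 : E, a).
Let bF := pc_bundle HFF.
Let kF := pc_skew HFF.
Let sF x c : gscalar c -> gscalar (FF x c) := @endo_gscalar _ _ _ _ bF x c.
Let sS x w c : gscalar c -> gscalar (Sjet FF x w c) := Sjet_scalar fr bF x w (c := c).
Let sv v : gscalar (vc v) := @gscalar_vec R E v.

Let skew x c c' : gscalar c -> gscalar c' ->
  bpair (FF x c) c' = - bpair c (FF x c').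
Proof. by move=> sc sc'; exact: bpair_endo. Qed.

(** The counterpart of [Sjet_anti] on M: differentiating FF^2 = I - Z (.) xi leaves the derivative
    of the defect. *)
Lemma Sjet_FF x w c : gscalar c -> S x w (FF x c) = - FF x (S x w c) -
  (bpair c (Dxi xi x w) *: gvec Z x + bpair c (gcov xi x) *: DZ Z x w +
   (bpair c (DZ Z x w) *: gcov xi x + bpair c (gvec Z x) *: Dxi xi x w)).
Proof.
move=> sc.
have dz := pc_gdiff_gvec fr HFF x; have dx := pc_gdiff_gcov fr HFF x.
have sx := pc_gcov_scalar HFF x; have sz := pc_gvec_scalar Z x.
have dt := gdiff_tau x sc.
have f1 := tdiff_bpair fr dt dx; have f2 := tdiff_bpair fr dt dz.
have d1 := gdiffZ fr f1 dz; have d2 := gdiffZ fr f2 dx.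
have d12 := gdiffD d1 d2; have dk := tdiff_cst (-1 : R) x.
have dm := gdiffZ fr dk d12.
have := jet_endo fr bF w (gdiff_endo_tau fr bF x sc).
rewrite tau_self -/(Sjet FF x w c).
rewrite (jet_eq (u' := fun y => tau x y c + -1 *:
  (bpair (tau x y c) (gcov xi y) *: gvec Z y +
   bpair (tau x y c) (gvec Z y) *: gcov xi y))).
  rewrite (jetD w dt dm) (jetZ fr w dk d12) (jetD w d1 d2).
  rewrite (jetZ fr w f1 dz) (jetZ fr w f2 dx) jet_tau // tderive_cst scale0r add0r.
  rewrite (tderive_bpair_tau fr w dx sc sx) (tderive_bpair_tau fr w dz sc sz).
  rewrite !tau_self !add0r scaleN1r => H.
  by apply: (@addrI _ (FF x (S x w c))); rewrite -H addNKr.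
apply: filterS (near_dom_self x) => y yp.
by rewrite (pc_FF2 HFF) ?scaleN1r //; exact: tau_scalar.
Qed.

Lemma bpair_Sjet_FF x w c c' : gscalar c -> gscalar c' ->
  bpair (S x w c') (FF x c) = - bpair (FF x c') (S x w c) +
    (bpair c (Dxi xi x w) * bpair c' (gvec Z x) +
     bpair c (gcov xi x) * bpair c' (DZ Z x w) +
    (bpair c (DZ Z x w) * bpair c' (gcov xi x) +
     bpair c (gvec Z x) * bpair c' (Dxi xi x w))).
Proof.
move=> sc sc'; rewrite (Sjet_skew fr bF x w kF sc' (sF x sc)) (Sjet_FF x w sc).
rewrite (skew x sc' (sS x w sc)).
move: (FF x _) (gvec Z x) (gcov xi x) (DZ Z x w) (Dxi xi x w) (bpair c)
  => e1 e2 e3 e4 e5 f.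
rewrite (bpairBr _ _ sc') (bpairNr _ sc') !(bpairDr _ _ sc') !(bpairZr _ _ sc').
by ring.
Qed.

Lemma d_form1E x a X Y : fdiff x a -> vdiff x X -> vdiff x Y ->
  d_form1 a X Y x = jetf x a (X x) (Y x) - jetf x a (Y x) (X x).
Proof.
move=> da dX dY; rewrite /d_form1 /vact lie_bracketE.
rewrite (tderive_pair fr _ da dY) (tderive_pair fr _ da dX).
rewrite (scalarB _ _ (fdiff_scalar da)).
move: (jetf x a) (a x) (jetv x X) (jetv x Y) => j l f g.
by ring.
Qed.

(** Here [s'] is the derivative of the components of [s]. The derivatives of the fields cancel
    against the bracket terms by antisymmetry. Keeping [s] abstract covers both sigma and
    sigma_F. *)
Lemma d_form2E x (s : M -> E -> E -> R) (s' : E -> E -> E -> R) X Y W :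
  (forall A B w, vdiff x A -> vdiff x B ->
    tderive (fun y => s y (A y) (B y)) x w =
    s' w (A x) (B x) + s x (jetv x A w) (B x) + s x (A x) (jetv x B w)) ->
  (forall u v w, s x (u - v) w = s x u w - s x v w) ->
  (forall u v, s x u v = - s x v u) ->
  vdiff x X -> vdiff x Y -> vdiff x W ->
  d_form2 s X Y W x =
  s' (X x) (Y x) (W x) - s' (Y x) (X x) (W x) + s' (W x) (X x) (Y x).
Proof.
move=> hD hB hA dX dY dW; rewrite /d_form2 /vact.
have -> := hD Y W (X x) dY dW; have -> := hD X W (Y x) dX dW.
have -> := hD X Y (W x) dX dY; rewrite !lie_bracketE.
move: (jetv x X) (jetv x Y) (jetv x W) (X x) (Y x) (W x) (s x) hB hA
  => f g h u v w t hB hA.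
rewrite !hB (hA (h u)) (hA (h v)) (hA (g w) u).
by ring.
Qed.

Lemma tderive_sigma x A B w : vdiff x A -> vdiff x B ->
  tderive (fun y => tens_form2 FF y (A y) (B y)) x w =
  bpair (S x w (vc (A x))) (vc (B x)) + tens_form2 FF x (jetv x A w) (B x) +
  tens_form2 FF x (A x) (jetv x B w).
Proof.
move=> dA dB; have gA := vdiff_gdiff dA; have gB := vdiff_gdiff dB.
have := tderive_bpair fr w (gdiff_endo fr bF gA) gB.
rewrite (jet_endo fr bF w gA) !jet_vec (bpairDl _ _ (sv (B x))) !bpair_vecr.
rewrite (addrC (_ (B x))) => <-; apply: tderive_eq; apply: nearW => y.
by rewrite bpair_vecr.
Qed.

Lemma sigma_sub x u v w : tens_form2 FF x (u - v) w =
  tens_form2 FF x u w - tens_form2 FF x v w.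
Proof.
rewrite /tens_form2 /tens_flat.
have -> : vc (u - v) = vc u - vc v by congr (_, _); rewrite /= subr0.
by rewrite (endoD bF) ?(endoN bF) //; exact: gscalarN.
Qed.

Lemma sigma_anti x u v : tens_form2 FF x u v = - tens_form2 FF x v u.
Proof.
rewrite /tens_form2 /tens_flat -(bpair_vecr (FF x (vc u)) v).
by rewrite (skew x (sv u) (sv v)) bpair_vecl.
Qed.

Lemma d_sigmaE x X Y W : vdiff x X -> vdiff x Y -> vdiff x W ->
  d_form2 (tens_form2 FF) X Y W x =
  bpair (S x (X x) (vc (Y x))) (vc (W x)) -
  bpair (S x (Y x) (vc (X x))) (vc (W x)) +
  bpair (S x (W x) (vc (X x))) (vc (Y x)).
Proof.
apply: (d_form2E (s' := fun w u v => bpair (S x w (vc u)) (vc v))).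
- by move=> A B w; exact: tderive_sigma.
- exact: sigma_sub.
- exact: sigma_anti.
Qed.

Lemma scalar_sub_add (f1 f2 f3 : E -> R) : scalar f1 -> scalar f2 -> scalar f3 ->
  scalar (fun v => f1 v - f2 v + f3 v).
Proof. by move=> s1 s2 s3 k u v; rewrite s1 s2 s3; ring. Qed.

Lemma vdiff_coord x v : vdiff x (coord_field x v).
Proof. by have [] := gdiff_tau x (sv v). Qed.

Lemma bpair_Dxi_vc x w v : bpair (Dxi xi x w) (vc v) = jetf x xi w v.
Proof. by rewrite /Dxi jet_cov bpair_vecr. Qed.

Lemma bpairE c c' : bpair c c' = c'.2 c.1 + c.2 c'.1.
Proof. by []. Qed.

(* In the long computation below, conversion and rewriting should treat these as atoms. *)
#[local] Opaque jetv jetf jet Sjet tderive bpair DZ Dxi coord_field.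

(** The derivatives of [X] and [Y] cancel as they do in any Nijenhuis tensor; [g] extracts scalar
    components of the vector identity. *)
Lemma A3_eq x X Y g : vdiff x X -> vdiff x Y -> scalar g ->
  g (nijenhuis (tens_end FF) X Y x -
     tens_sharp FF x (contract_d_form2 X Y (tens_form2 FF) x) -
     d_form1 xi X Y x *: Z x) =
  mt x (vc (X x)) (vc (Y x)) (cv g).
Proof.
move=> dX dY sg; have gg : gscalar (cv g) := sg.
have dxi := smooth_fdiff fr x (pc_xi HFF).
rewrite (d_form1E dxi dX dY) (torsion_base_vvc fr HFF x _ _ sg).
(* This creates one half of d xi(X, Y) g(Z); the other half is in the correction of the 3-tensor,
   whose term in the derivative of Z is cancelled at the same time. *)
rewrite (bpair_Sjet_FF x (Y x) (sv (X x)) gg).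
have s1 : scalar (S x (X x) (vc (Y x))).2 := sS x (X x) (sv (Y x)).
have s2 : scalar (S x (Y x) (vc (X x))).2 := sS x (Y x) (sv (X x)).
have s3 := Sjet_pair_scalar fr HFF x (sv (X x)) (sv (Y x)).
have -> : contract_d_form2 X Y (tens_form2 FF) x = fun v =>
    (S x (X x) (vc (Y x))).2 v - (S x (Y x) (vc (X x))).2 v +
    bpair (S x v (vc (X x))) (vc (Y x)).
  apply/funext => v; apply: etrans (d_sigmaE dX dY (vdiff_coord x v)) _.
  have -> : coord_field x v x = v by exact: coord_field_self.
  congr (_ - _ + _); exact: bpair_vecr.
have sO := scalar_sub_add s1 s2 s3.
rewrite /nijenhuis !lie_bracketE (jetv_F fr HFF _ dX) (jetv_F fr HFF _ dY).
rewrite !(jetv_F fr HFF _ dX) !(jetv_F fr HFF _ dY).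
have q1 : bpair (vc (X x)) (Dxi xi x (Y x)) = jetf x xi (Y x) (X x).
  by rewrite bpairC bpair_Dxi_vc.
have q2 : bpair (cv g) (gvec Z x) = g (Z x) := bpair_vecr (cv g) (Z x).
have q3 : bpair (vc (X x)) (gcov xi x) = xi x (X x) := bpair_gcov xi x (sv (X x)).
have q4 : bpair (cv g) (DZ Z x (Y x)) = g (DZ Z x (Y x)).1.
  exact: (bpair_covl g (DZ_scalar fr HFF x (Y x))).
have q5 : bpair (vc (X x)) (DZ Z x (Y x)) = 0 by rewrite bpairC bpair_DZ_vc.
have q6 : bpair (vc (X x)) (gvec Z x) = 0 := bpair_vv (X x) (Z x).
have q7 := bpair_Dxi_vc x (X x) (Y x).
rewrite q1 q2 q3 q4 q5 q6 q7.
rewrite /tens_sharp /tens_end.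
have Sk w c c' : gscalar c -> gscalar c' -> bpair (S x w c) c' = - bpair (S x w c') c.
  by move=> t1 t2; rewrite (Sjet_skew fr bF x w kF t1 t2) bpairC.
have KD c c' : gscalar c -> gscalar c' -> FF x (c + c') = FF x c + FF x c'.
  exact: (endoD bF).
have KN c : gscalar c -> FF x (- c) = - FF x c by exact: (endoN bF).
have := sF x; have := skew x; have := sS x; move: sO.
move: (FF x) (S x) Sk KD KN (DZ Z x) (jetf x xi) (xi x) (jetv x X) (jetv x Y)
  (X x) (Y x) (Z x) {s1 s2 s3 q1 q2 q3 q4 q5 q6 q7}
  => K T Sk KD KN D j k p q u v z sO tT tk tK.
pose f w := (K (vc w)).1.
pose O w := (T u (vc v)).2 w - (T v (vc u)).2 w + bpair (T w (vc u)) (vc v).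
have {}sO : scalar O := sO.
have fD w w' : f (w + w') = f w + f w'.
  rewrite /f (_ : vc (w + w') = vc w + vc w') ?KD //.
  by congr (_, _); rewrite /= addr0.
have fN w : f (- w) = - f w.
  by rewrite /f (_ : vc (- w) = - vc w) ?KN //; congr (_, _); rewrite /= oppr0.
have fB w w' : f (w - w') = f w - f w' by rewrite fD fN.
have tKg := tK _ gg.
have gT w c : gscalar c -> g (T w c).1 = bpair (T w c) (cv g).
  by move=> sc; rewrite bpair_covr //; exact: tT.
have gf w : g (f w) = - (K (cv g)).2 w.
  by rewrite -(bpair_covr g (tK _ (sv w))) tk // bpair_vecl.
have gO : g (K (cv O)).1 = - O (K (cv g)).1.
  rewrite -(bpair_covr g (tK (cv O) sO)) tk // bpair_covl //.
rewrite -[LHS]/(g ((f (q (f u)) + (T (f u) (vc v)).1) -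
  (f (p (f v)) + (T (f v) (vc u)).1) + f (f (q u - p v)) -
  f (q (f u) - (f (p v) + (T v (vc u)).1)) -
  f ((f (q u) + (T u (vc v)).1) - p (f v)) - (K (cv O)).1 -
  (j u v - j v u) *: z)).
have gD w w' : g (w + w') = g w + g w' := scalarD w w' sg.
have gB w w' : g (w - w') = g w - g w' := scalarB w w' sg.
rewrite !(fB, fD) !(gB, gD) (scalar_scaler _ _ sg) gO.
rewrite (gT _ _ (sv u)) (gT _ _ (sv v)) (gf (T u (vc v)).1) (gf (T v (vc u)).1).
rewrite /O (Sk (f v) (cv g) (vc u)) // -/(f u) -/(f v).
rewrite (bpairE (T u (vc v)) (K (cv g))) (bpairE (K (cv g)) (T v (vc u))).
by ring.
Qed.

#[local] Transparent jetv jetf jet Sjet tderive bpair DZ Dxi coord_field.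

End NijenhuisCondition.

(** * The last two conditions of A4, and A5 *)

Section LieDerivativeConditions.
Context {R : realType} {E : normedModType R} (fr : frame E).
Variables (M : smooth_manifold E) (FF : gendo M) (Z : vfield M) (xi : form1 M).
Hypothesis HFF : gen_almost_paracontact FF Z xi.
Implicit Types (x y p : M) (v w : E) (c : E * (E -> R)) (a b : form1 M)
  (g : E -> R) (X Y W : vfield M).

Local Notation mt := (torsion_base FF Z xi).
Local Notation cx := (torsion_ddt FF xi).
Local Notation czt := (torsion_dt FF Z).
Local Notation cl := (torsion_mixed Z xi).
Local Notation S := (Sjet FF).
Local Notation vc v := (v, 0 : E -> R).
Local Notation cv a := (0 : E, a).
Local Notation Fv X := (fun y => tens_end FF y (X y)).
Local Notation Pa a := (fun y => tens_sharp FF y (a y)).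
Let bF := pc_bundle HFF.
Let kF := pc_skew HFF.
Let sF x c : gscalar c -> gscalar (FF x c) := @endo_gscalar _ _ _ _ bF x c.
Let sS x w c : gscalar c -> gscalar (Sjet FF x w c) := Sjet_scalar fr bF x w (c := c).
Let sv v : gscalar (vc v) := @gscalar_vec R E v.

Let skew x c c' : gscalar c -> gscalar c' ->
  bpair (FF x c) c' = - bpair c (FF x c').
Proof. by move=> sc sc'; exact: bpair_endo. Qed.

Lemma Sjet_anti_pair x w c c' : gscalar c -> gscalar c' ->
  bpair (S x w c) c' = - bpair (S x w c') c.
Proof.
by move=> t1 t2; rewrite (bpairC _ c); exact: (Sjet_skew fr bF x w kF t1 t2).
Qed.

Lemma bpair_FF2_vec x c c' : gscalar c -> gscalar c' -> c.2 = 0 -> c'.2 = 0 ->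
  bpair (FF x c) (FF x c') = 0.
Proof.
move=> sc sc' c0 c0'; rewrite skew //; last exact: sF.
have sx := pc_gcov_scalar HFF x.
have sz := pc_gvec_scalar Z x.
rewrite (pc_FF2 HFF) // bpairBr // bpairDr // !bpairZr //.
have -> : bpair c c' = 0 by exact: bpair_vec.
have -> : bpair c' (gvec Z x) = 0 by exact: bpair_vec.
have -> : bpair c (gvec Z x) = 0 by exact: bpair_vec.
by rewrite mul0r mulr0 addr0 subr0 oppr0.
Qed.

Let fD x u v : (FF x (vc (u + v))).1 = (FF x (vc u)).1 + (FF x (vc v)).1.
Proof.
rewrite (_ : vc (u + v) = vc u + vc v) ?(endoD bF) //.
by congr (_, _); rewrite /= addr0.
Qed.

Let fN x u : (FF x (vc (- u))).1 = - (FF x (vc u)).1.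
Proof.
rewrite (_ : vc (- u) = - vc u) ?(endoN bF) //.
by congr (_, _); rewrite /= oppr0.
Qed.

Lemma sigma_add x u v w : tens_form2 FF x (u + v) w =
  tens_form2 FF x u w + tens_form2 FF x v w.
Proof.
rewrite /tens_form2 /tens_flat.
have -> : vc (u + v) = vc u + vc v by congr (_, _); rewrite /= addr0.
by rewrite (endoD bF).
Qed.

(** States that sigma_F is a 2-form: two vectors pair to zero, hence so do their images under
    [FF]. *)
Lemma sigmaF_anti x u v : tens_form2 FF x (tens_end FF x u) v =
  - tens_form2 FF x (tens_end FF x v) u.
Proof.
apply/eqP; rewrite -addr_eq0 (sigma_anti HFF) (sigma_anti HFF x _ u) -opprD.
rewrite oppr_eq0; apply/eqP.
have := bpair_FF2_vec x (sv u) (sv v) erefl erefl.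
by rewrite /bpair.
Qed.

Lemma tderive_sigmaF x A B w : vdiff x A -> vdiff x B ->
  tderive (fun y => tens_form2 FF y (tens_end FF y (A y)) (B y)) x w =
  bpair (S x w (vc (tens_end FF x (A x)))) (vc (B x)) +
  tens_form2 FF x (S x w (vc (A x))).1 (B x) +
  tens_form2 FF x (tens_end FF x (jetv x A w)) (B x) +
  tens_form2 FF x (tens_end FF x (A x)) (jetv x B w).
Proof.
move=> dA dB.
have -> := tderive_sigma fr HFF w (vdiff_F fr HFF dA) dB.
rewrite (jetv_F fr HFF w dA).
rewrite -[(_ + _).1]/((FF x (vc (jetv x A w))).1 + (S x w (vc (A x))).1).
rewrite sigma_add -[(FF x (vc (jetv x A w))).1]/(tens_end FF x (jetv x A w)).
by rewrite (addrC (tens_form2 _ _ _ _)) !addrA.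
Qed.

Lemma d_sigmaFE x X Y W : vdiff x X -> vdiff x Y -> vdiff x W ->
  d_form2 (fun y u v => tens_form2 FF y (tens_end FF y u) v) X Y W x =
  bpair (S x (X x) (vc (tens_end FF x (Y x)))) (vc (W x)) +
    tens_form2 FF x (S x (X x) (vc (Y x))).1 (W x) -
  (bpair (S x (Y x) (vc (tens_end FF x (X x)))) (vc (W x)) +
    tens_form2 FF x (S x (Y x) (vc (X x))).1 (W x)) +
  (bpair (S x (W x) (vc (tens_end FF x (X x)))) (vc (Y x)) +
    tens_form2 FF x (S x (W x) (vc (X x))).1 (Y x)).
Proof.
apply: (d_form2E (s' := fun w u v => bpair (S x w (vc (tens_end FF x u))) (vc v) +
  tens_form2 FF x (S x w (vc u)).1 v)).
- by move=> A B w; exact: tderive_sigmaF.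
- move=> u v w; rewrite -(sigma_sub HFF) /tens_end; congr (tens_form2 _ _ _ _).
  by rewrite fD fN.
- exact: sigmaF_anti.
Qed.

#[local] Opaque jetv jetf jet Sjet tderive bpair coord_field.

Lemma A4d_eq x X Y W : vdiff x X -> vdiff x Y -> vdiff x W ->
  d_form2 (fun y u v => tens_form2 FF y (tens_end FF y u) v) X Y W x -
  (d_form2 (tens_form2 FF) (Fv X) Y W x + d_form2 (tens_form2 FF) X (Fv Y) W x +
   d_form2 (tens_form2 FF) X Y (Fv W) x) =
  - mt x (vc (X x)) (vc (Y x)) (vc (W x)).
Proof.
move=> dX dY dW.
have dFX := vdiff_F fr HFF dX; have dFY := vdiff_F fr HFF dY.
have dFW := vdiff_F fr HFF dW.
have -> := d_sigmaFE dX dY dW; have -> := d_sigmaE fr HFF dFX dY dW.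
have -> := d_sigmaE fr HFF dX dFY dW; have -> := d_sigmaE fr HFF dX dY dFW.
have -> := torsion_base_vvv fr HFF x (X x) (Y x) (W x).
(* Every term that the defect of FF^2 contributes contains a pairing of two vectors, so here the
   derivative behaves as if [FF] were an involution. *)
have SK : bpair (S x (Y x) (vc (W x))) (FF x (vc (X x))) =
    - bpair (S x (Y x) (vc (X x))) (FF x (vc (W x))).
  have e1 : bpair (vc (W x)) (DZ Z x (Y x)) = 0 by rewrite bpairC bpair_DZ_vc.
  have e2 : bpair (vc (X x)) (DZ Z x (Y x)) = 0 by rewrite bpairC bpair_DZ_vc.
  rewrite (bpair_Sjet_FF fr HFF x (Y x) (sv (X x)) (sv (W x))).
  rewrite e1 e2 (bpair_vv (W x) (Z x)) (bpair_vv (X x) (Z x)).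
  by rewrite !mulr0 !mul0r !addr0 bpairC.
have sg u v : (FF x (vc u)).2 v = - (FF x (vc v)).2 u := sigma_anti HFF x u v.
have Sk := Sjet_anti_pair x.
rewrite /tens_end /tens_form2 /tens_flat.
move: (FF x) (S x) (X x) (Y x) (W x) Sk sg SK => K T u v w Sk sg.
rewrite (sg (T u (vc v)).1 w) (sg (T v (vc u)).1 w) (sg (T w (vc u)).1 v).
rewrite (Sk (K (vc v)).1 (vc w) (vc u)) //.
rewrite (bpairE (T v (vc u)) (K (vc w))) (bpairE (T u (vc v)) (K (vc w))).
rewrite (bpairE (T w (vc u)) (K (vc v))) => ->.
rewrite (bpair_vecr (T u (vc v)) (K (vc w)).1) (bpair_vecr (T v (vc u)) (K (vc w)).1).
rewrite (bpair_vecr (T w (vc u)) (K (vc v)).1).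
by ring.
Qed.

(** By skewness FF xi = 0 makes xi vanish on images of [FF]; the derivative of the same equation
    handles the second term. *)
Lemma xi_jet_FF x w c c' : gscalar c -> gscalar c' ->
  xi x (FF x c + S x w c').1 = - bpair (Dxi xi x w) (FF x c').
Proof.
move=> sc sc'; have sx := pc_gcov_scalar HFF x.
have s1 := sF x sc; have s2 := sS x w sc'.
apply: etrans (esym (bpair_gcov xi x (gscalarD s1 s2))) _.
rewrite (bpairDl _ _ sx) (skew x sc sx) (pc_FFxi HFF) (bpair0r sc) oppr0 add0r.
exact: (bpair_Sjet_gcov fr HFF).
Qed.

Lemma lieD_xi_F x X w : vdiff x X -> lieD_form1 (Fv X) xi x w =
  bpair (Dxi xi x (FF x (vc (X x))).1) (vc w) -
  bpair (Dxi xi x w) (FF x (vc (X x))).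
Proof.
move=> dX; have dxi := smooth_fdiff fr x (pc_xi HFF).
apply: etrans (lieD_form1E (Fv X) w dxi) _.
apply: congr2; first exact: (esym (bpair_Dxi_vc _ _ _ _)).
apply: etrans (congr1 (xi x) (jetv_F fr HFF w dX)) _.
exact: xi_jet_FF (sv _) (sv _).
Qed.

Lemma lieD_xi_P x a w : fdiff x a -> lieD_form1 (Pa a) xi x w =
  bpair (Dxi xi x (FF x (cv (a x))).1) (vc w) -
  bpair (Dxi xi x w) (FF x (cv (a x))).
Proof.
move=> da; have dxi := smooth_fdiff fr x (pc_xi HFF).
apply: etrans (lieD_form1E (Pa a) w dxi) _.
apply: congr2; first exact: (esym (bpair_Dxi_vc _ _ _ _)).
apply: etrans (congr1 (xi x) (jetv_P fr HFF w da)) _.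
have sj : gscalar (cv (jetf x a w)) := jetf_scalar w da.
have sa : gscalar (cv (a x)) := fdiff_scalar da.
exact: xi_jet_FF sj sa.
Qed.

Lemma A4c_eq x X Y : vdiff x X -> vdiff x Y ->
  lieD_form1 (Fv X) xi x (Y x) - lieD_form1 (Fv Y) xi x (X x) =
  - cx x (vc (X x)) (vc (Y x)).
Proof.
move=> dX dY; rewrite (lieD_xi_F (Y x) dX) (lieD_xi_F (X x) dY) torsion_ddt_vv.
move: (FF x) (Dxi xi x) (X x) (Y x) => K D u v.
by ring.
Qed.

Lemma A5e_eq x a v : fdiff x a ->
  lieD_form1 (Pa a) xi x v = - cx x (cv (a x)) (vc v).
Proof.
move=> da; rewrite (lieD_xi_P v da) (torsion_ddt_cv fr HFF x v (fdiff_scalar da)).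
by rewrite opprB.
Qed.

(** The term xi(D_v Z) of the Lie derivative equals -(D_v xi)(Z), by the derivative of xi(Z) = 1. *)
Lemma A5a_eq x v : lieD_form1 Z xi x v = cl x (vc v).
Proof.
have dxi := smooth_fdiff fr x (pc_xi HFF).
rewrite (lieD_form1E _ v dxi) /torsion_mixed bpair_Dxi_vc; congr (_ + _).
rewrite -(bpair_DZ_gcov fr HFF) /DZ jet_vec.
by rewrite (bpair_gcov xi x (sv _)).
Qed.

(** In [Z, FX] - F[Z, X] the derivative of [X] along Z cancels, leaving (D_Z F)X + F(D_X Z) - D_FX
    Z. *)
Lemma A5c_eq x X g : vdiff x X -> scalar g ->
  g (lieD_endo Z (tens_end FF) X x) = - czt x (vc (X x)) (cv g).
Proof.
move=> dX sg; have gg : gscalar (cv g) := sg.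
rewrite (torsion_dt_vc fr HFF x _ sg) /lieD_endo !lie_bracketE (jetv_F fr HFF _ dX).
rewrite /DZ !jet_vec /tens_end.
have sK := sF x (sv (jetv x Z (X x))).
have e1 : bpair (vc (jetv x Z (X x))) (FF x (cv g)) =
    - g (FF x (vc (jetv x Z (X x)))).1.
  by rewrite -(bpair_covr g sK) (skew x (sv _) gg) opprK.
have e2 : bpair (S x (Z x) (vc (X x))) (cv g) = g (S x (Z x) (vc (X x))).1.
  by rewrite bpair_covr //; exact: sS.
rewrite e1 e2 bpair_covr //.
rewrite -[(_ + S x (Z x) (vc (X x))).1]/((FF x (vc (jetv x X (Z x)))).1 +
  (S x (Z x) (vc (X x))).1).
have -> := fD x (jetv x X (Z x)) (- jetv x Z (X x)); have -> := fN x (jetv x Z (X x)).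
move: (jetv x X) (jetv x Z) (S x) (FF x) => p q T K.
have gD w w' : g (w + w') = g w + g w' := scalarD w w' sg.
have gN w : g (- w) = - g w := scalarN w sg.
rewrite !(gD, gN).
by ring.
Qed.

Lemma A5d_eq x X Y : vdiff x X -> vdiff x Y ->
  lieD_form2 Z (tens_form2 FF) X Y x = - czt x (vc (X x)) (vc (Y x)).
Proof.
move=> dX dY; rewrite (torsion_dt_vv fr HFF) /lieD_form2 /vact !lie_bracketE.
have -> := tderive_sigma fr HFF (Z x) dX dY.
rewrite /DZ !jet_vec !bpair_vecl.
rewrite -[(FF x (vc (Y x))).2 _]/(tens_form2 FF x (Y x) (jetv x Z (X x))).
rewrite -[(FF x (vc (X x))).2 _]/(tens_form2 FF x (X x) (jetv x Z (Y x))).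
have sA := sigma_anti HFF x; have sB := sigma_sub HFF x.
move: (tens_form2 FF x) (jetv x X) (jetv x Y) (jetv x Z) (S x) (X x) (Y x) (Z x) sA sB
  => s p q r T u v z sA sB.
rewrite sB (sA u (q z - r v)) sB (sA u (q z)) (sA v (r u)) (sA u (r v)).
by ring.
Qed.

(** The derivatives of [a] and [b] along Z cancel between P(a, b) and the two Lie derivatives;
    skewness of P turns the term with L_Z a into one evaluated by [a]. *)
Lemma A5b_eq x a b : fdiff x a -> fdiff x b ->
  lieD_bivector Z (tens_bivector FF) a b x = - czt x (cv (a x)) (cv (b x)).
Proof.
move=> da db; have sa := fdiff_scalar da; have sb := fdiff_scalar db.
have ga : gscalar (cv (a x)) := sa. have gb : gscalar (cv (b x)) := sb.
have dZ := smooth_vdiff x (pc_Z HFF).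
have sja w : gscalar (cv (jetf x a w)) by exact: jetf_scalar.
have sjb w : gscalar (cv (jetf x b w)) by exact: jetf_scalar.
have LE d : fdiff x d -> lieD_form1 Z d x =
    fun v => jetf x d (Z x) v + d x (jetv x Z v).
  by move=> dd; apply/funext => v; rewrite (lieD_form1E _ v dd).
have lZ (d : E -> R) : scalar d -> scalar (fun v => d (jetv x Z v)).
  by move=> sd k u v; rewrite (jetvP k u v dZ) sd.
have la := lZ _ sa; have lb := lZ _ sb.
have ja : scalar (jetf x a (Z x)) := sja (Z x).
have jb : scalar (jetf x b (Z x)) := sjb (Z x).
rewrite (torsion_dt_cc fr HFF x sa sb) /lieD_bivector /vact (LE a da) (LE b db).
have -> : tderive (fun y => tens_bivector FF y (a y) (b y)) x (Z x) =
    jetf x b (Z x) (FF x (cv (a x))).1 + b x (jetv x (Pa a) (Z x)).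
  exact: (tderive_pair fr (Z x) db (vdiff_P fr HFF da)).
rewrite (jetv_P fr HFF _ da) /tens_bivector /tens_sharp.
rewrite /DZ !jet_vec.
have -> : cv (fun v => jetf x a (Z x) v + a x (jetv x Z v)) =
    cv (jetf x a (Z x)) + cv (fun v => a x (jetv x Z v)).
  by congr (_, _); rewrite /= addr0.
have gla : gscalar (cv (fun v => a x (jetv x Z v))) := la.
have sK1 := sF x ga; have sK2 := sF x (sja (Z x)); have sK3 := sF x gla.
have sK4 := sF x gb.
have sS1 := sS x (Z x) ga.
rewrite (endoD bF x (sja (Z x)) gla).
rewrite -[(FF x (cv (jetf x a (Z x))) + S x (Z x) (cv (a x))).1]/(
  (FF x (cv (jetf x a (Z x)))).1 + (S x (Z x) (cv (a x))).1).
rewrite -[(FF x (cv (jetf x a (Z x))) + FF x (cv (fun v => a x (jetv x Z v)))).1]/(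
  (FF x (cv (jetf x a (Z x)))).1 + (FF x (cv (fun v => a x (jetv x Z v)))).1).
rewrite !(scalarD _ _ sb).
have e1 : b x (S x (Z x) (cv (a x))).1 = bpair (S x (Z x) (cv (a x))) (cv (b x)).
  by rewrite bpair_covr.
have e2 : b x (FF x (cv (fun v => a x (jetv x Z v)))).1 =
    - a x (jetv x Z (FF x (cv (b x))).1).
  by rewrite -(bpair_covr (b x) sK3) (skew x gla gb) bpair_covl.
rewrite e1 e2 (bpair_covr (b x) (sv _)) (bpair_covr (a x) (sv _)).
by ring.
Qed.

#[local] Transparent jetv jetf jet Sjet tderive bpair coord_field.

End LieDerivativeConditions.

(** * Algebraic conditions and pointwise extensions *)

Section AlgebraicConditions.
Context {R : realType} {E : normedModType R} (fr : frame E).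
Variables (M : smooth_manifold E) (FF : gendo M) (Z : vfield M) (xi : form1 M).
Hypothesis HFF : gen_almost_paracontact FF Z xi.
Local Notation vc v := (v, 0 : E -> R).
Local Notation cv a := (0 : E, a).
Implicit Types (x : M) (v : E).

Lemma FF_split x c : gscalar c ->
  FF x c = FF x (vc c.1) + FF x (cv c.2).
Proof.
move=> sc; have s2 : gscalar (cv c.2) := sc.
by rewrite {1}(gsplit c) (endoD (pc_bundle HFF)) //; exact: gscalar_vec.
Qed.

(** The vector part of FF^2 on a covector: it vanishes, since the multiple of Z in the defect is the
    pairing of that covector with xi. *)
Lemma F_sharp x (a : form1 M) : smooth_form1 a ->
  tens_end FF x (tens_sharp FF x (a x)) =
  tens_sharp FF x (fun v => a x (tens_end FF x v)).
Proof.
move=> Ca; have sa : scalar (a x) by case: Ca => + _; apply.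
have ga : gscalar (cv (a x)) := sa.
have sK : gscalar (FF x (cv (a x))) by exact: (endo_gscalar (pc_bundle HFF)).
have sK2 : gscalar (cv (FF x (cv (a x))).2) := sK.
have -> : (fun v => a x (tens_end FF x v)) = - (FF x (cv (a x))).2.
  by apply/funext => v; rewrite (FdualE HFF).
rewrite /tens_sharp.
rewrite (_ : cv (- (FF x (cv (a x))).2) = - cv (FF x (cv (a x))).2); last first.
  by congr (_, _); rewrite /= oppr0.
rewrite (endoN (pc_bundle HFF)) //.
have := congr1 fst (FF_split x sK); rewrite (pc_FF2 HFF) //.
have -> : bpair (cv (a x)) (gcov xi x) = 0.
  by apply: bpair_cc => //; exact: (pc_gcov_scalar HFF).
rewrite scale0r add0r => /= /esym/eqP.
by rewrite scaler0 subr0 addr_eq0 => /eqP.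
Qed.

Lemma F_sqr x v : tens_end FF x (tens_end FF x v) =
  v - tens_sharp FF x (tens_flat FF x v) - xi x v *: Z x.
Proof.
have sv := gscalar_vec v.
have sK : gscalar (FF x (vc v)) by exact: (endo_gscalar (pc_bundle HFF)).
have := congr1 fst (FF_split x sK); rewrite (pc_FF2 HFF) //.
rewrite (bpair_gcov xi x sv) /= scaler0 addr0 => H.
by rewrite addrAC H addrK.
Qed.

Lemma xi_F x v : xi x (tens_end FF x v) = 0.
Proof.
have sv := gscalar_vec v; have sx := pc_gcov_scalar HFF x.
have sK : gscalar (FF x (vc v)) by exact: (endo_gscalar (pc_bundle HFF)).
rewrite -[LHS](bpair_gcov xi x sK) (bpair_endo _ (pc_skew HFF)) //.
by rewrite (pc_FFxi HFF) bpair_vecl oppr0.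
Qed.

(** The block identities for vector-valued conditions come out after applying a covector [g]; this
    recovers the vector equation. *)
Lemma vector_eq (u v : E) : (forall g : E -> R, scalar g -> g (u - v) = 0) ->
  u = v.
Proof.
move=> uv; apply/eqP; rewrite -subr_eq0; apply/eqP.
apply: (frame_eq (fr := fr)) => i; have si := fcoord_scalar fr i.
by rewrite uv // (scalar0 si).
Qed.

Lemma vfield_extension x v : exists2 X : vfield M, smooth_vfield X & X x = v.
Proof.
have [u [Cu _] uE] := section_extension fr (mem_chart_dom x) (gscalar_vec v).
by exists (fun y => (u y).1) => //; rewrite (nbhs_singleton uE) tau_self.
Qed.

Lemma form1_extension x (a : E -> R) : scalar a ->
  exists2 b : form1 M, smooth_form1 b & b x = a.
Proof.
move=> sa; have ga : gscalar (cv a) := sa.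
have [u [_ Cu] uE] := section_extension fr (mem_chart_dom x) ga.
by exists (fun y => (u y).2) => //; rewrite (nbhs_singleton uE) tau_self.
Qed.

End AlgebraicConditions.

Lemma row_frame (R : realType) n : frame 'rV[R]_n.
Proof.
apply: (@Frame R 'rV[R]_n n (fun i => delta_mx 0 i) (fun i v => v 0 i)).
- by move=> i k u v; rewrite !mxE.
- by move=> i v; exact: coord_continuous.
- exact: row_sum_delta.
Qed.

(* The signs of xi /\ dt in corresponding_tensors and of d xi in the formula for
   the Nijenhuis tensor go together: both are the ones imposed by J^2 = I. *)
Theorem theorem3p1 (R : realType) (n : nat) (hn : odd n)
    (M : smooth_manifold 'rV[R]_n) (FF : gendo M) (Z : vfield M)
    (xi : form1 M) (HFF : gen_almost_paracontact FF Z xi) :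
  let F := tens_end FF in
  let P := tens_bivector FF in
  let Psharp := tens_sharp FF in
  let sigma := tens_form2 FF in
  let sigmaflat := tens_flat FF in
  (* F X, P^# a and F^* a *)
  let Fv := fun (X : vfield M) x => F x (X x) in
  let Pa := fun (a : form1 M) x => Psharp x (a x) in
  let Fdual := fun (a : form1 M) x v => a x (F x v) in
  normal_paracontact FF Z xi <->
  [/\
    (* A1 *)
    forall a b : form1 M, smooth_form1 a -> smooth_form1 b -> forall x,
      lie_bracket (Pa a) (Pa b) x = Psharp x (bracket_sharp FF a b x),
    (* A2 *)
    (forall (a : form1 M), smooth_form1 a -> forall x,
       F x (Pa a x) = Psharp x (Fdual a x)) /\
    (forall a b : form1 M, smooth_form1 a -> smooth_form1 b -> forall x v,
       Fdual (bracket_sharp FF a b) x v =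
       lieD_form1 (Pa a) (Fdual b) x v - lieD_form1 (Pa b) (Fdual a) x v +
       dfun (fun y => P y (b y) (Fdual a y)) x v),
    (* A3 *)
    [/\ forall x v, sigma x (Z x) v = 0,
        forall b : form1 M, smooth_form1 b -> forall x, P x (xi x) (b x) = 0,
        forall x v,
          F x (F x v) = v - Psharp x (sigmaflat x v) - xi x v *: Z x &
        forall X Y : vfield M, smooth_vfield X -> smooth_vfield Y -> forall x,
          nijenhuis F X Y x =
          Psharp x (contract_d_form2 X Y sigma x) + d_form1 xi X Y x *: Z x],
    (* A4 *)
    [/\ forall x, F x (Z x) = 0,
        forall x v, xi x (F x v) = 0,
        forall X Y : vfield M, smooth_vfield X -> smooth_vfield Y -> forall x,
          lieD_form1 (Fv X) xi x (Y x) - lieD_form1 (Fv Y) xi x (X x) = 0 &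
        forall X Y W : vfield M,
          smooth_vfield X -> smooth_vfield Y -> smooth_vfield W -> forall x,
          d_form2 (fun y v w => sigma y (F y v) w) X Y W x =
          d_form2 sigma (Fv X) Y W x + d_form2 sigma X (Fv Y) W x +
          d_form2 sigma X Y (Fv W) x] &
    (* A5 *)
    [/\ forall x v, lieD_form1 Z xi x v = 0,
        forall a b : form1 M, smooth_form1 a -> smooth_form1 b -> forall x,
          lieD_bivector Z P a b x = 0,
        forall X : vfield M, smooth_vfield X -> forall x,
          lieD_endo Z F X x = 0,
        forall X Y : vfield M, smooth_vfield X -> smooth_vfield Y -> forall x,
          lieD_form2 Z sigma X Y x = 0 &
        forall a : form1 M, smooth_form1 a -> forall x v,
          lieD_form1 (Pa a) xi x v = 0]].
Proof.
move=> F P Psharp sigma sigmaflat Fv Pa Fdual.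
have fr := row_frame R n.
have dv (X : vfield M) x : smooth_vfield X -> vdiff x X by exact: smooth_vdiff.
have df (a : form1 M) x : smooth_form1 a -> fdiff x a by exact: (smooth_fdiff fr x).
have sfo (a : form1 M) x : smooth_form1 a -> scalar (a x).
  by move=> [+ _]; apply.
have sv v : gscalar (v, 0 : 'rV[R]_n -> R) by exact: gscalar_vec.
have sc (a : 'rV[R]_n -> R) : scalar a -> gscalar (0 : 'rV[R]_n, a) by [].
split=> [/(normal_paracontactP fr HFF)[M0 X0 Z0 L0]|[A1 [_ A2] [_ _ _ A3] [_ _ A4c A4d]
    [A5a A5b A5c A5d A5e]]].
  split.
  - move=> a b Ca Cb x; apply: (vector_eq fr) => g sg.
    apply: etrans (A1_eq fr HFF (df a x Ca) (df b x Cb) sg) _.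
    by apply: M0 => //; exact/sc/sfo.
  - split=> [a Ca x|a b Ca Cb x v]; first exact: (F_sharp HFF).
    have := A2_eq fr HFF x v Ca Cb.
    rewrite M0 ?oppr0 //; try exact/sc/sfo.
    by move/eqP; rewrite subr_eq0 => /eqP.
  - split.
    + by move=> x v; have := congr1 (fun c => c.2 v) (pc_FFZ HFF x).
    + move=> b Cb x; have sb := sfo b x Cb.
      have := congr1 (fun c => b x c.1) (pc_FFxi HFF x).
      by rewrite (scalar0 sb).
    + exact: (F_sqr HFF).
    + move=> X Y CX CY x; apply: (vector_eq fr) => g sg.
      rewrite opprD addrA.
      apply: etrans (A3_eq fr HFF (dv X x CX) (dv Y x CY) sg) _.
      exact: M0.
  - split.
    + by move=> x; have := congr1 fst (pc_FFZ HFF x).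
    + exact: (xi_F HFF).
    + move=> X Y CX CY x.
      apply: etrans (A4c_eq fr HFF (dv X x CX) (dv Y x CY)) _.
      by rewrite X0 // oppr0.
    + move=> X Y W CX CY CW x.
      have := A4d_eq fr HFF (dv X x CX) (dv Y x CY) (dv W x CW).
      by rewrite M0 // oppr0 => /eqP; rewrite subr_eq0 => /eqP.
  - split.
    + by move=> x v; rewrite (A5a_eq fr HFF) L0.
    + move=> a b Ca Cb x.
      rewrite (A5b_eq fr HFF (df a x Ca) (df b x Cb)) Z0 ?oppr0 //; exact/sc/sfo.
    (* [vector_eq] tests differences, hence the artificial subtraction of 0. *)
    + move=> X CX x; rewrite -[LHS]subr0.
      apply: (vector_eq fr) => g sg; rewrite subr0 subr0.
      by rewrite (A5c_eq fr HFF (dv X x CX) sg) Z0 // oppr0.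
    + move=> X Y CX CY x.
      by rewrite (A5d_eq fr HFF (dv X x CX) (dv Y x CY)) Z0 // oppr0.
    + move=> a Ca x v.
      apply: etrans (A5e_eq fr HFF v (df a x Ca)) _.
      by rewrite X0 ?oppr0 //; exact/sc/sfo.
apply/(normal_paracontactP fr HFF).
(* The blocks concern arbitrary vectors and covectors at [x], the conditions concern global smooth
   fields; each argument below is therefore extended first. *)
have ev (x : M) v := vfield_extension fr x v.
have ef x a sa := @form1_extension _ _ fr M x a sa.
split=> x.
- apply: (torsion_base_blocks fr HFF).
  + move=> a b g sa sb sg; have [a' Ca <-] := ef x a sa; have [b' Cb <-] := ef x b sb.
    apply: etrans (esym (A1_eq fr HFF (df _ x Ca) (df _ x Cb) sg)) _.
    rewrite -(scalar0 sg); congr g; apply/eqP; rewrite subr_eq0; apply/eqP.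
    exact: (A1 a' b' Ca Cb x).
  + move=> a b v sa sb; have [a' Ca <-] := ef x a sa; have [b' Cb <-] := ef x b sb.
    apply/eqP; rewrite -oppr_eq0; apply/eqP.
    apply: etrans (esym (A2_eq fr HFF x v Ca Cb)) _.
    by apply/eqP; rewrite subr_eq0; apply/eqP/esym; exact: A2.
  + move=> v w g sg; have [X CX <-] := ev x v; have [Y CY <-] := ev x w.
    apply: etrans (esym (A3_eq fr HFF (dv _ x CX) (dv _ x CY) sg)) _.
    rewrite -(scalar0 sg); congr g; apply/eqP; rewrite -addrA -opprD subr_eq0.
    apply/eqP; exact: (A3 X Y CX CY x).
  + move=> u v w; have [X CX <-] := ev x u; have [Y CY <-] := ev x v.
    have [W CW <-] := ev x w.
    apply/eqP; rewrite -oppr_eq0; apply/eqP.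
    apply: etrans (esym (A4d_eq fr HFF (dv _ x CX) (dv _ x CY) (dv _ x CW))) _.
    by apply/eqP; rewrite subr_eq0; apply/eqP; exact: (A4d X Y W CX CY CW x).
- apply: (torsion_ddt_blocks fr HFF).
  + move=> v w; have [X CX <-] := ev x v; have [Y CY <-] := ev x w.
    apply/eqP; rewrite -oppr_eq0; apply/eqP.
    apply: etrans (esym (A4c_eq fr HFF (dv _ x CX) (dv _ x CY))) _.
    exact: (A4c X Y CX CY x).
  + move=> a v sa; have [a' Ca <-] := ef x a sa.
    apply/eqP; rewrite -oppr_eq0; apply/eqP.
    apply: etrans (esym (A5e_eq fr HFF v (df _ x Ca))) _.
    exact: (A5e a' Ca x).
- apply: (torsion_dt_blocks fr HFF).
  + move=> a b sa sb; have [a' Ca <-] := ef x a sa; have [b' Cb <-] := ef x b sb.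
    apply/eqP; rewrite -oppr_eq0 -(A5b_eq fr HFF (df _ x Ca) (df _ x Cb)).
    by apply/eqP; exact: (A5b a' b' Ca Cb x).
  + move=> v g sg; have [X CX <-] := ev x v.
    apply/eqP; rewrite -oppr_eq0 -(A5c_eq fr HFF (dv _ x CX) sg) -(scalar0 sg).
    by apply/eqP; congr g; exact: (A5c X CX x).
  + move=> v w; have [X CX <-] := ev x v; have [Y CY <-] := ev x w.
    apply/eqP; rewrite -oppr_eq0 -(A5d_eq fr HFF (dv _ x CX) (dv _ x CY)).
    by apply/eqP; exact: (A5d X Y CX CY x).
- apply: (torsion_mixed_blocks fr HFF) => v.
  by rewrite -(A5a_eq fr HFF); exact: A5a.
Qed.
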